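(* As $N\to\infty$, $$D_N\ \longrightarrow_d\ D:=\frac{1}{\sqrt{\prod_{k=1}^\infty(1-s_k^2)}}\exp\left\{\frac12\sum_{k=1}^\infty\left[-\frac{s_k^2}{1-s_k^2}(U_k^2+V_k^2)+\frac{2s_k}{1-s_k^2}U_kV_k\right]\right\},$$ where $\{U_k\}_{k\ge1}$ and $\{V_k\}_{k\ge1}$ are independent standard normal random variables (all jointly independent).
   Context: Let $P,Q$ be Borel probability measures on $\mathbb{R}^d$, and let $\mu$ be a probability measure on $\mathbb{R}^d\times\mathbb{R}^d$ with marginals $P$ and $Q$, absolutely continuous with respect to $P\otimes Q$, with density $\xi=\frac{d\mu}{d(P\otimes Q)}$. Define $\mathcal{A}:L^2(P)\to L^2(Q)$ and its adjoint $\mathcal{A}^*:L^2(Q)\to L^2(P)$ by $(\mathcal{A}f)(y)=\int f(x)\xi(x,y)\,dP(x)$ and $(\mathcal{A}^*g)(x)=\int g(y)\xi(x,y)\,dQ(y)$. Standing assumptions: (i) $\xi\in L^2(P\otimes Q)$; consequently $\mathcal{A}$ is compact and there are eigenvalue decompositions $\mathcal{A}^*\mathcal{A}\alpha_k=s_k^2\alpha_k$, $\mathcal{A}\mathcal{A}^*\beta_k=s_k^2\beta_k$, $k\ge 0$, with $s_0=1$, $\alpha_0=\beta_0=\mathbf{1}$, $0\le s_k\le 1$, $\mathcal{A}\alpha_k=s_k\beta_k$, $\mathcal{A}^*\beta_k=s_k\alpha_k$; the $s_k$ are the singular values of $\mathcal{A}$, counted with multiplicity. (ii) Spectral gap: $s_k\le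 s_1<1$ for all $k\ge 1$. Let $X_1,X_2,\dots$ be i.i.d. from $P$ and $Y_1,Y_2,\dots$ i.i.d. from $Q$, the two sequences being independent. With $\mathcal{S}_N$ the set of permutations of $\{1,\dots,N\}$, $$D_N:=\frac1{N!}\sum_{\sigma\in\mathcal{S}_N}\prod_{i=1}^N\xi(X_i,Y_{\sigma_i}).$$ $\to_d$ denotes convergence in distribution. *)

(* Defs.v *)
From mathcomp Require Export all_boot all_order all_algebra perm.
From mathcomp Require Export all_classical all_reals all_analysis.

Set Implicit Arguments.
Unset Strict Implicit.
Unset Printing Implicit Defensive.

Export Order.TTheory GRing.Theory Num.Theory.
Export numFieldNormedType.Exports.

Local Open Scope classical_set_scope.
Local Open Scope ring_scope.

Definition product_probability {d1 d2 : measure_display}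
    {T1 : measurableType d1} {T2 : measurableType d2} {R : realType}
    (P : probability T1 R) (Q : probability T2 R) :
  probability (T1 * T2)%type R := (P \x Q)%E.

Section operators.
Context {d1 d2 : measure_display} {T1 : measurableType d1}
  {T2 : measurableType d2} {R : realType}.
Variables (P : {measure set T1 -> \bar R}) (Q : {measure set T2 -> \bar R}).
Variable xi : T1 * T2 -> R.

Definition opA (f : T1 -> R) : T2 -> R :=
  fun y => \int[P]_x (f x * xi (x, y)).

Definition opA_adj (g : T2 -> R) : T1 -> R :=
  fun x => \int[Q]_y (g y * xi (x, y)).

End operators.

Section eigen_decomposition.
Context {d : measure_display} {T : measurableType d} {R : realType}.
Variable mu : {measure set T -> \bar R}.

Definition L2inner (f g : T -> R) : R := \int[mu]_x (f x * g x).

(* Eigenvalue decomposition  L f = \sum_k lam_k <f, e_k> e_k  in L^2(mu).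
   Elements of L^2(mu) are represented by functions, so equalities are mu-a.e.
   L^2(mu) may be finite dimensional while the index set is always nat; the
   list of eigenvalues is then padded with zeros, which is why the e_k are
   required to be orthonormal only along the indices with lam_k != 0. *)
Definition eigen_decomposition (L : (T -> R) -> T -> R)
    (lam : nat -> R) (e : nat -> T -> R) : Prop :=
  [/\ forall k, e k \in Lfun mu 2%:E,
      forall k, L (e k) = (fun x => lam k * e k x) %[ae mu],
      forall j k, lam j != 0 -> lam k != 0 ->
        L2inner (e j) (e k) = (j == k)%:R
    & forall f, f \in Lfun mu 2%:E ->
        Lnorm mu 2%:E (fun x => (L f x -
            \sum_(0 <= k < n) lam k * L2inner f (e k) * e k x)%:E)
          @[n --> \oo] --> 0%E].

End eigen_decomposition.

(* s lists the singular values of A with multiplicity: the A^*A-decomposition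
   forces each nonzero singular value to occur in s as often as its
   multiplicity; zeros may occur arbitrarily often. *)
Record singular_system {d1 d2 : measure_display} {T1 : measurableType d1}
    {T2 : measurableType d2} {R : realType} (P : probability T1 R)
    (Q : probability T2 R) (xi : T1 * T2 -> R) (s : nat -> R)
    (alpha : nat -> T1 -> R) (beta : nat -> T2 -> R) : Prop := SingularSystem {
  ss_alpha : eigen_decomposition P (fun f => opA_adj Q xi (opA P xi f))
    (fun k => s k ^+ 2) alpha ;
  ss_beta : eigen_decomposition Q (fun g => opA P xi (opA_adj Q xi g))
    (fun k => s k ^+ 2) beta ;
  ss_s0 : s 0%N = 1 ;
  ss_alpha0 : alpha 0%N = cst 1 %[ae P] ;
  ss_beta0 : beta 0%N = cst 1 %[ae Q] ;
  ss_bounds : forall k, 0 <= s k <= 1 ;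
  ss_opA : forall k, opA P xi (alpha k) = (fun y => s k * beta k y) %[ae Q] ;
  ss_opA_adj :
    forall k, opA_adj Q xi (beta k) = (fun x => s k * alpha k x) %[ae P]
}.

Section independence.
Context {d : measure_display} {Omega : measurableType d} {R : realType}.
Variable Pr : probability Omega R.

Definition mutually_independent (I : eqType) {d' : measure_display}
    {T : measurableType d'} (Z : I -> Omega -> T) : Prop :=
  forall (J : seq I) (B : I -> set T), uniq J ->
    (forall i, measurable (B i)) ->
    Pr (\bigcap_(i in [set` J]) Z i @^-1` B i) =
    (\prod_(i <- J) Pr (Z i @^-1` B i))%E.

Definition sigma_generated (I : Type) {d' : measure_display}
    {T : measurableType d'} (Z : I -> Omega -> T) : set (set Omega) :=
  <<s \bigcup_i preimage_set_system setT (Z i) measurable >>.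

Definition independent_families (I J : Type) {d1 d2 : measure_display}
    {T1 : measurableType d1} {T2 : measurableType d2}
    (Z : I -> Omega -> T1) (W : J -> Omega -> T2) : Prop :=
  forall A B, sigma_generated Z A -> sigma_generated W B ->
    Pr (A `&` B) = (Pr A * Pr B)%E.

Definition join_families (I J S : Type) (Z : I -> Omega -> S)
    (W : J -> Omega -> S) (i : I + J) : Omega -> S :=
  match i with inl k => Z k | inr k => W k end.

Definition iid {d' : measure_display} {T : measurableType d'}
    (Z : nat -> {RV Pr >-> T}) (law : set T -> \bar R) : Prop :=
  mutually_independent (fun i => Z i : Omega -> T) /\
  forall i A, measurable A -> distribution Pr (Z i) A = law A.

End independence.

(* The two sides may live on different probability spaces. *)
Definition cvg_in_distribution {d d' : measure_display}
    {Omega : measurableType d} {Omega' : measurableType d'} {R : realType}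
    (Pr : probability Omega R) (Pr' : probability Omega' R)
    (Z : nat -> Omega -> R) (Zlim : Omega' -> R) : Prop :=
  forall h : R -> R, continuous h -> bounded_fun h ->
    ('E_Pr[h \o Z N])%E @[N --> \oo] --> ('E_Pr'[h \o Zlim])%E.

Definition DN {T1 T2 Omega : Type} {R : realType} (xi : T1 * T2 -> R)
    (X : nat -> Omega -> T1) (Y : nat -> Omega -> T2) (N : nat) (w : Omega) : R :=
  N`!%:R^-1 * \sum_(sigma : 'S_N) \prod_(i < N) xi (X i w, Y (sigma i) w).

(* U k and V k stand for U_{k+1} and V_{k+1}.  The infinite product and series
   are limits of partial products and partial sums, taken pointwise; the series
   converges almost surely, and limn has an unspecified value on the null set
   where it does not. *)
Definition Dlim {Omega : Type} {R : realType} (s : nat -> R)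
    (U V : nat -> Omega -> R) (w : Omega) : R :=
  (Num.sqrt (\big[*%R/1]_(0 <= k <oo) (1 - s k.+1 ^+ 2)))^-1 *
  expR (2^-1 * \big[+%R/0]_(0 <= k <oo)
    (- (s k.+1 ^+ 2 / (1 - s k.+1 ^+ 2)) * (U k w ^+ 2 + V k w ^+ 2)
     + 2 * s k.+1 / (1 - s k.+1 ^+ 2) * (U k w * V k w))).

(* Main.v *)
Require Import Defs.
From mathcomp Require Import all_boot all_order all_algebra perm.
From mathcomp Require Import all_classical all_reals all_analysis.
From mathcomp Require Import measurable_realfun.
From mathcomp Require Import ring lra.

(* Second-moment method with a Gaussian reference model.  Fix K and put
   a_k = N^(-1/2) \sum_i alpha_k(X_i),  b_k = N^(-1/2) \sum_i beta_k(Y_i) for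
   1 <= k <= K.  The vector (a, b) is asymptotically standard normal.  Under
   the weight D_N the pairs (X_i, Y_(sigma i)) behave like a sample from mu, so
   that (a, b) is asymptotically normal with correlation s_k between a_k and
   b_k.  The density of the second Gaussian law with respect to the first is a
   product of Mehler kernels, whose square has mean \prod_(k <= K) 1/(1 - s_k^2).
   If psi is a bounded function approximating this density, then
   E (D_N - psi(a, b))^2 is asymptotically at most
   \prod_k 1/(1 - s_k^2) - \prod_(k <= K) 1/(1 - s_k^2) up to a small error,
   provided E D_N^2 <= \prod_k 1/(1 - s_k^2).

   For this bound, expand D_N in the functions alpha_k(x) beta_k(y): E D_N^2 is
   1/N! times the sum, over all c : [N] -> {0, 1, ...}, of
   |Stab c| \prod_i s_(c i)^2, which is the complete homogeneous symmetric
   polynomial h_N(1, s_1^2, s_2^2, ...).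

   Both Gaussian limits are only tested on trigonometric functions, whose
   expectations factor over i; psi is chosen to be a trigonometric polynomial
   and Bernstein polynomials give the limit of h(psi(a, b)) for continuous h.
   The partial products of Mehler kernels converge almost surely by
   Kolmogorov's maximal inequality. *)

Set Implicit Arguments.
Unset Strict Implicit.
Unset Printing Implicit Defensive.

Local Open Scope classical_set_scope.
Local Open Scope ring_scope.

Import Order.TTheory GRing.Theory Num.Theory.
Import numFieldNormedType.Exports.

(** * Integrable real functions *)

(** The Mehler density is unbounded, so convergence in law of (a, b) does not by itself control the
    mean of [D_N] times that density. A bounded [psi], fixed before [N] grows, can be inserted into
    both limits. They agree because the mean of a density under its own law equals the mean of its
    square under the reference law; hence E D_N^2 - 2 E (D_N psi) + E psi^2 retains little more than
    the missing tail of the product. The second moment is computed for kernels of finite rank and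
    carried over to [xi] at each fixed [N]. This requires that the sum of the s_k^2 be the squared
    norm of [xi], whereas the hypotheses only expand operators. For s_k = 0 the functions alpha_k
    and beta_k are arbitrary. They are replaced by 0, and so are the matching Gaussian coordinates;
    the kernel factors for s_k = 0 are 1 in any case. The alpha_k and beta_k have two moments only,
    so characteristic functions are expanded by dominated convergence. Likewise [h] is only
    continuous and bounded: its modulus is traded for quadratic terms, which the second moments
    control. *)

Section ge0_measurable_induction.
Context {d : measure_display} {T : measurableType d} {R : realType}.
Variable K : (T -> \bar R) -> Prop.
Hypothesis K_indic : forall E, measurable E -> K (fun x => (\1_E x)%:E).
Hypothesis K_scale : forall (c : R) (f : T -> \bar R), 0 <= c -> measurable_fun setT f ->
  (forall x, 0 <= f x)%E -> K f -> K (fun x => c%:E * f x)%E.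
Hypothesis K_add : forall f g : T -> \bar R, measurable_fun setT f -> measurable_fun setT g ->
  (forall x, 0 <= f x)%E -> (forall x, 0 <= g x)%E ->
  K f -> K g -> K (fun x => f x + g x)%E.
Hypothesis K_lim : forall (f_ : (T -> \bar R)^nat) (f : T -> \bar R),
  (forall n, measurable_fun setT (f_ n)) ->
  (forall n x, 0 <= f_ n x)%E ->
  (forall x, {homo (f_ ^~ x) : n m / (n <= m)%N >-> (n <= m)%E}) ->
  (forall x, limn (f_ ^~ x) = f x) ->
  (forall n, K (f_ n)) -> K f.

Import HBNNSimple.

Lemma ge0_measurable_ind (f : T -> \bar R) :
  measurable_fun setT f -> (forall x, 0 <= f x)%E -> K f.
Proof.
move=> mf f0.
have K0 : K (fun=> 0%E).
  by have := K_indic measurable0; under eq_fun do rewrite indic0.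
have mt (r : R) (E : set T) : measurable E ->
    measurable_fun [set: T] (fun x => r%:E * (\1_E x)%:E)%E.
  move=> mE; apply: emeasurable_funM => //.
  exact/measurable_EFinP/measurable_indic.
(* Nonnegativity of the sums is proved together with [K], because [K_add] accepts nonnegative
   summands only. *)
have Ksum (s : seq R) (E : R -> set T) : (forall r, measurable (E r)) ->
    (forall r, r \in s -> 0 <= r) ->
    (forall x, (0 <= \sum_(r <- s) r%:E * (\1_(E r) x)%:E)%E) /\
    K (fun x => \sum_(r <- s) r%:E * (\1_(E r) x)%:E)%E.
  move=> mE; elim: s => [|r s IH] s0.
    split; last by under eq_fun do rewrite big_nil.
    by move=> x; rewrite big_nil.
  have r0 : 0 <= r by apply: s0; rewrite mem_head.
  have [ge0 Ks] := IH (fun r' r's => s0 r' (mem_behead (s := r :: s) r's)).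
  have ge0' x : (0 <= r%:E * (\1_(E r) x)%:E)%E by rewrite mule_ge0 ?lee_fin.
  split=> [x|]; first by rewrite big_cons adde_ge0.
  under eq_fun do rewrite big_cons.
  apply: K_add => //; first exact: mt.
    by apply: emeasurable_sum => i; exact: mt.
  apply: (@K_scale r (fun x => (\1_(E r) x)%:E)) => //; last exact: K_indic.
  - exact/measurable_EFinP/measurable_indic.
have Knn (g : {nnsfun T >-> R}) : K (EFin \o g).
  have -> : EFin \o g = (fun x => \sum_(r <- finmap.enum_fset (fset_set (range g)))
      r%:E * (\1_(g @^-1` [set r]) x)%:E)%E.
    by apply/funext => x /=; rewrite fimfunE fsbig_finite//= -sumEFin.
  apply: (Ksum _ _ _ _).2 => [r|r]; first exact: measurable_sfunP.
  by rewrite in_fset_set// inE => -[y _ <-].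
pose g := nnsfun_approx measurableT mf.
refine (@K_lim (fun n x => (g n x)%:E) f _ _ _ _ _).
- by move=> n; exact/measurable_EFinP.
- by move=> n x; rewrite lee_fin; exact: fun_ge0.
- by move=> x n m nm; rewrite lee_fin; exact/lefP/nd_nnsfun_approx.
- move=> x; apply/cvg_lim => //; exact: cvg_nnsfun_approx.
- by move=> n; exact: Knn.
Qed.

End ge0_measurable_induction.

Notation L1 mu f := (mu.-integrable [set: _] (EFin \o f)).

Section integrable_real.
Context {d : measure_display} {T : measurableType d} {R : realType}.
Variable mu : {measure set T -> \bar R}.
Implicit Types f g : T -> R.

Lemma L1_measurable f : L1 mu f -> measurable_fun setT f.
Proof. by move=> /measurable_int /measurable_EFinP. Qed.

Lemma L1D f g : L1 mu f -> L1 mu g -> L1 mu (fun x => f x + g x).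
Proof. by move=> mf mg; exact: (integrableD measurableT mf mg). Qed.

Lemma L1B f g : L1 mu f -> L1 mu g -> L1 mu (fun x => f x - g x).
Proof. by move=> mf mg; exact: (integrableB measurableT mf mg). Qed.

Lemma L1Z (c : R) f : L1 mu f -> L1 mu (fun x => c * f x).
Proof. by move=> mf; exact: (integrableZl measurableT c mf). Qed.

Lemma L1_sum (I : Type) (s : seq I) (p : pred I) (F : I -> T -> R) :
  (forall i, p i -> L1 mu (F i)) -> L1 mu (fun x => \sum_(i <- s | p i) F i x).
Proof.
move=> h; have := integrable_sum measurableT s h.
by apply: eq_integrable => // x _; rewrite /= sumEFin.
Qed.

Lemma Rintegral_sum (I : Type) (s : seq I) (p : pred I) (F : I -> T -> R) :
  (forall i, p i -> L1 mu (F i)) ->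
  \int[mu]_x (\sum_(i <- s | p i) F i x) = \sum_(i <- s | p i) \int[mu]_x F i x.
Proof.
move=> h; elim: s => [|i s IH].
  under eq_Rintegral do rewrite big_nil.
  by rewrite big_nil /Rintegral integral0.
under eq_Rintegral do rewrite big_cons.
rewrite big_cons; case: ifPn => // pi.
by rewrite RintegralD ?IH//; [exact: h|exact: L1_sum].
Qed.

Lemma L1_le f g : measurable_fun setT f -> (forall x, `|f x| <= g x) ->
  L1 mu g -> L1 mu f.
Proof.
move=> mf fg; apply: le_integrable => //; first exact/measurable_EFinP.
by move=> x _ /=; rewrite lee_fin (le_trans (fg x))// ler_norm.
Qed.

Lemma L1_norm f : L1 mu f -> L1 mu (fun x => `|f x|).
Proof. by move=> /integrable_abse. Qed.

Lemma L1_bmul (M : R) f g : measurable_fun setT g -> (forall x, `|g x| <= M) ->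
  L1 mu f -> L1 mu (fun x => f x * g x).
Proof.
move=> mg gM Lf; apply: (L1_le (g := fun x => M * `|f x|)).
- by apply: measurable_funM => //; exact: L1_measurable.
- by move=> x; rewrite normrM mulrC ler_wpM2r.
- exact/L1Z/L1_norm.
Qed.

Lemma L1_mul_sqr f g : measurable_fun setT f -> measurable_fun setT g ->
  L1 mu (fun x => f x ^+ 2) -> L1 mu (fun x => g x ^+ 2) ->
  L1 mu (fun x => f x * g x).
Proof.
move=> mf mg Lf Lg; apply: (L1_le (g := fun x => f x ^+ 2 + g x ^+ 2)).
- exact: measurable_funM.
- move=> x; rewrite ler_norml; apply/andP; split; nra.
- exact: L1D.
Qed.

Lemma EFin_Rintegral f : L1 mu f -> (\int[mu]_x f x)%:E = (\int[mu]_x (f x)%:E)%E.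
Proof. by move=> Lf; rewrite fineK//; exact: integrable_fin_num. Qed.

Lemma L1_ae f g : measurable_fun setT g -> f = g %[ae mu] -> L1 mu f -> L1 mu g.
Proof.
move=> mg fg Lf; have mf := L1_measurable Lf.
apply/integrableP; split; first exact/measurable_EFinP.
have /integrableP[_] := Lf; congr (_ < _)%E.
apply: ae_eq_integral => //; [| |].
- by apply/measurableT_comp => //; exact/measurable_EFinP.
- by apply/measurableT_comp => //; exact/measurable_EFinP.
- by apply: filterS fg => x h _ /=; rewrite h.
Qed.

Lemma Rintegral_ae f g : measurable_fun setT f -> measurable_fun setT g ->
  f = g %[ae mu] -> \int[mu]_x f x = \int[mu]_x g x.
Proof.
move=> mf mg fg; congr fine; apply: ae_eq_integral => //.
- exact/measurable_EFinP.
- exact/measurable_EFinP.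
- by apply: filterS fg => x h _ /=; rewrite h.
Qed.

Lemma Rintegral_dct (f_ : nat -> T -> R) f g :
  (forall n, measurable_fun setT (f_ n)) -> measurable_fun setT f ->
  (\forall x \ae mu, f_ ^~ x n @[n --> \oo] --> f x) -> L1 mu g ->
  (forall n x, `|f_ n x| <= g x) ->
  L1 mu f /\ \int[mu]_x f_ n x @[n --> \oo] --> \int[mu]_x f x.
Proof.
move=> mf_ mf cf Lg fg.
have h1 n : measurable_fun [set: T] (EFin \o f_ n) by exact/measurable_EFinP.
have h2 : measurable_fun [set: T] (EFin \o f) by exact/measurable_EFinP.
have h3 : \forall x \ae mu, [set: T] x ->
    (EFin \o f_ n) x @[n --> \oo] --> (EFin \o f) x.
  by apply: filterS cf => x h _; apply: cvg_EFin => //; exact: nearW.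
have h4 : \forall x \ae mu, forall n, [set: T] x ->
    (`|(EFin \o f_ n) x| <= (EFin \o g) x)%E.
  by apply: aeW => x n _; rewrite lee_fin.
have [Lf _ h] := dominated_convergence measurableT h1 h2 h3 Lg h4.
split => //; rewrite -EFin_Rintegral// in h.
by have /fine_cvg := h.
Qed.

End integrable_real.

Section integrable_finite.
Context {d : measure_display} {T : measurableType d} {R : realType}.
Variable mu : probability T R.
Implicit Types f g : T -> R.

Lemma L1_cst (c : R) : L1 mu (fun=> c).
Proof. exact: finite_measure_integrable_cst. Qed.

Lemma L1_bounded (M : R) f : measurable_fun setT f -> (forall x, `|f x| <= M) ->
  L1 mu f.
Proof. by move=> mf fM; apply: (L1_le mf fM); exact: L1_cst. Qed.

Lemma L1_sqr f : measurable_fun setT f -> L1 mu (fun x => f x ^+ 2) -> L1 mu f.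
Proof.
move=> mf Lf; apply: (L1_le (g := fun x => 1 + f x ^+ 2)) => //.
- move=> x; rewrite ler_norml; apply/andP; split; nra.
- by apply: L1D => //; exact: L1_cst.
Qed.

Lemma Rintegral_cst1 (c : R) : \int[mu]_x c = c.
Proof. by rewrite /Rintegral integral_cst//= probability_setT mule1. Qed.

End integrable_finite.

Section weighted_law.
Context {d d' : measure_display} {T : measurableType d} {T' : measurableType d'}
  {R : realType}.
Variables (mu : {measure set T -> \bar R}) (nu : {measure set T' -> \bar R}).
Variables (Z : T -> T') (G : T -> R) (c : R).
Hypotheses (mZ : measurable_fun setT Z) (mG : measurable_fun setT G).
Hypothesis G0 : forall x, 0 <= G x.
Hypothesis lawE : forall B, measurable B ->
  (\int[mu]_x (G x * \1_B (Z x))%:E = c%:E * nu B)%E.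

(** One statement with three uses: for [G] = 1 it is the image measure formula, for [Z] the identity
    it is integration against a density, and for independent variables [G] collects the remaining
    factors of a product. *)
Lemma ge0_integral_weighted (f : T' -> \bar R) :
  measurable_fun setT f -> (forall x, 0 <= f x)%E ->
  (\int[mu]_x ((G x)%:E * f (Z x)) = c%:E * \int[nu]_x f x)%E.
Proof.
pose K (f : T' -> \bar R) :=
  (\int[mu]_x ((G x)%:E * f (Z x)) = c%:E * \int[nu]_x f x)%E.
have mGf (h : T' -> \bar R) : measurable_fun setT h ->
    measurable_fun setT (fun x => ((G x)%:E * h (Z x))%E).
  move=> mh; apply: emeasurable_funM; first exact/measurable_EFinP.
  exact: measurableT_comp mh mZ.
have Gf0 (h : T' -> \bar R) x : (forall x, (0 <= h x)%E) ->
    (0 <= (G x)%:E * h (Z x))%E.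
  by move=> h0; rewrite mule_ge0 ?lee_fin.
apply: (@ge0_measurable_ind _ _ _ K); rewrite /K.
- by move=> E mE; rewrite integral_indic// setIT -lawE.
- move=> r h r0 mh h0 Kh; rewrite ge0_integralZl// ?lee_fin//.
  rewrite muleCA -Kh -ge0_integralZl ?lee_fin//.
  + by apply: eq_integral => x _; rewrite muleCA.
  + exact: mGf.
  + by move=> x _; exact: Gf0.
- move=> g h mg mh g0 h0 Kg Kh.
  rewrite ge0_integralD// ge0_muleDr ?integral_ge0// -Kg -Kh -ge0_integralD//.
  + by apply: eq_integral => x _; rewrite ge0_muleDr.
  + by move=> x _; exact: Gf0.
  + exact: mGf.
  + by move=> x _; exact: Gf0.
  + exact: mGf.
- move=> g_ g mg g0 ndg limg Kg.
  have cg x : g_ ^~ x n @[n --> \oo] --> g x.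
    by rewrite -limg; apply: ereal_nondecreasing_is_cvgn.
  have h1 : (\int[nu]_x g_ n x)%E @[n --> \oo] --> (\int[nu]_x g x)%E.
    have := @cvg_monotone_convergence _ _ _ nu _ measurableT g_ mg
      (fun n x _ => g0 n x) (fun x _ => ndg x).
    by under [X in _ --> X]eq_integral do rewrite limg.
  have h2 : (\int[mu]_x ((G x)%:E * g_ n (Z x)))%E @[n --> \oo] -->
      (\int[mu]_x ((G x)%:E * g (Z x)))%E.
    have -> : (\int[mu]_x ((G x)%:E * g (Z x)) =
        \int[mu]_x limn (fun n => (G x)%:E * g_ n (Z x)))%E.
      apply: eq_integral => x _; apply/esym/cvg_lim => //.
      exact: cvgeZl.
    apply: (@cvg_monotone_convergence _ _ _ mu _ measurableT
      (fun n x => (G x)%:E * g_ n (Z x))%E) => //.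
    + by move=> n; exact: mGf.
    + by move=> n x _; exact: Gf0.
    + by move=> x _ n m nm; apply: lee_wpmul2l; [rewrite lee_fin|exact: ndg].
  have h3 : (\int[mu]_x ((G x)%:E * g_ n (Z x)))%E @[n --> \oo] -->
      (c%:E * \int[nu]_x g x)%E.
    by under eq_cvg do rewrite Kg; exact: cvgeZl.
  exact: cvg_unique h2 h3.
Qed.

Lemma integral_weighted (f : T' -> R) : L1 nu f ->
  L1 mu (fun x => G x * f (Z x)) /\
  \int[mu]_x (G x * f (Z x)) = c * \int[nu]_x f x.
Proof.
have ge0 (h : T' -> R) : (forall x, 0 <= h x) -> L1 nu h ->
    L1 mu (fun x => G x * h (Z x)) /\
    \int[mu]_x (G x * h (Z x)) = c * \int[nu]_x h x.
  move=> h0 Lh; have mh := L1_measurable Lh.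
  have E : (\int[mu]_x (G x * h (Z x))%:E)%E = (c * \int[nu]_x h x)%:E.
    rewrite EFinM EFin_Rintegral// -ge0_integral_weighted//.
    exact/measurable_EFinP.
  split; last by rewrite /Rintegral E.
  apply/integrableP; split.
    apply/measurable_EFinP/measurable_funM => //.
    exact: measurableT_comp mh mZ.
  under eq_integral do rewrite /= ger0_norm ?mulr_ge0//.
  by rewrite E ltry.
move=> Lf; have Ln := L1_norm Lf.
(* Positive and negative parts are written (|f| + f) / 2 and (|f| - f) / 2, so that integrability
   and recombination reduce to linear algebra in f and |f|. *)
have Lp : L1 nu (fun x => (`|f x| + f x) / 2).
  by under eq_fun do rewrite mulrC; apply/L1Z/L1D.
have Lm : L1 nu (fun x => (`|f x| - f x) / 2).
  by under eq_fun do rewrite mulrC; apply/L1Z/L1B.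
have [x|Lp1 Ep] := ge0 _ _ Lp.
  have := ler_norm (- f x); rewrite normrN; lra.
have [x|Lm1 Em] := ge0 _ _ Lm.
  have := ler_norm (f x); lra.
have fE x : f x = (`|f x| + f x) / 2 - (`|f x| - f x) / 2 by field.
have GfE : (fun x => G x * f (Z x)) = (fun x =>
    G x * ((`|f (Z x)| + f (Z x)) / 2) - G x * ((`|f (Z x)| - f (Z x)) / 2)).
  by apply/funext => x; rewrite -mulrBr -fE.
rewrite GfE; split; first exact: L1B.
by rewrite RintegralB// Ep Em -mulrBr -RintegralB//; under eq_Rintegral do rewrite -fE.
Qed.

End weighted_law.

Section law.
Context {d d' : measure_display} {T : measurableType d} {T' : measurableType d'}
  {R : realType}.
Variables (mu : {measure set T -> \bar R}) (nu : {measure set T' -> \bar R}).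
Variables (Z : T -> T').
Hypothesis mZ : measurable_fun setT Z.
Hypothesis lawZ : forall B, measurable B -> mu (Z @^-1` B) = nu B.

Let lawE B : measurable B -> (\int[mu]_x (1 * \1_B (Z x))%:E = 1%:E * nu B)%E.
Proof.
move=> mB; rewrite mul1e -lawZ// -[in RHS](setIT (Z @^-1` B)) -integral_indic//.
  by apply: eq_integral => x _; rewrite mul1r.
by rewrite -[X in measurable X]setTI; exact: mZ.
Qed.

Lemma L1_law (f : T' -> R) : L1 nu f -> L1 mu (fun x => f (Z x)).
Proof.
move=> /(integral_weighted mZ (@measurable_cst _ _ _ R setT 1) (fun=> ler01) lawE)[+ _].
by under eq_fun do rewrite mul1r.
Qed.

Lemma Rintegral_law (f : T' -> R) : L1 nu f ->
  \int[mu]_x f (Z x) = \int[nu]_x f x.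
Proof.
move=> /(integral_weighted mZ (@measurable_cst _ _ _ R setT 1) (fun=> ler01) lawE)[_ +].
by rewrite mul1r => <-; under [RHS]eq_Rintegral do rewrite mul1r.
Qed.

Lemma law_L1 (f : T' -> R) : measurable_fun setT f ->
  L1 mu (fun x => f (Z x)) -> L1 nu f.
Proof.
move=> mf /integrableP[_ foo]; apply/integrableP; split.
  exact/measurable_EFinP.
rewrite -[ltLHS]mul1e -(ge0_integral_weighted mZ (@measurable_cst _ _ _ R setT 1)
  (fun=> ler01) lawE)//.
  by under eq_integral do rewrite mul1e.
by apply/measurableT_comp => //; exact/measurable_EFinP.
Qed.

End law.

(** * Independent families *)

Lemma L1_indic {d : measure_display} {T : measurableType d} {R : realType}
  (mu : probability T R) (A : set T) : measurable A -> L1 mu (\1_A : T -> R).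
Proof.
move=> mA; apply: (@L1_bounded _ _ _ _ 1); first exact: measurable_indic.
by move=> w; rewrite indicE normr_nat; case: (_ \in _).
Qed.

Definition upd {I : eqType} {S : Type} (f : I -> S) (i : I) (g : S) : I -> S :=
  fun j => if j == i then g else f j.

(** Multilinear extension: a statement on families that is known when every coordinate lies in the
    small class [A] is extended to the class [B] by freeing one coordinate at a time. It takes
    indicators to nonnegative functions, these to integrable functions, and rectangles to measurable
    sets. *)
Lemma coordinatewise_ind {I : eqType} {S : Type} (A B : I -> S -> Prop) (P : (I -> S) -> Prop)
    (J : seq I) :
  (forall i g, A i g -> B i g) ->
  (forall f, (forall i, B i (f i)) -> (forall i, i \in J -> A i (f i)) -> P f) ->
  (forall f i, i \in J -> (forall j, B j (f j)) ->
    (forall g, A i g -> P (upd f i g)) -> P f) ->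
  forall f, (forall i, B i (f i)) -> P f.
Proof.
move=> AB PA step.
(* The list [s] holds the coordinates already freed, for which only [B] is known. *)
have H (s : seq I) : forall f, (forall i, B i (f i)) ->
    (forall i, i \in J -> i \notin s -> A i (f i)) -> P f.
  elim: s => [|i s IH] f Bf Af; first by apply: PA => // i iJ; exact: Af.
  have [iJ|iJ] := boolP (i \in J); last first.
    apply: IH => // j jJ js; apply: Af => //.
    by rewrite inE negb_or js andbT; apply: contraNneq iJ => <-.
  apply: (step f i) => // g Ag; apply: IH => [j|j jJ js]; rewrite /upd.
    by case: ifPn => // /eqP ->; exact: AB.
  case: ifPn => [/eqP -> //|ji]; apply: Af => //.
  by rewrite inE negb_or ji.
by move=> f Bf; apply: (H J f Bf) => i ->.
Qed.

Section independent_product.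
Context {d : measure_display} {Omega : measurableType d} {R : realType}.
Variable Pr : probability Omega R.
Context {I : choiceType} {d' : measure_display} {T : measurableType d'}.
Variable Z : I -> Omega -> T.
Hypothesis mZ : forall i, measurable_fun setT (Z i).
Hypothesis indZ : mutually_independent Pr Z.

Let P (J : seq I) (f : I -> T -> R) :=
  L1 Pr (fun w => \prod_(i <- J) f i (Z i w)) /\
  \int[Pr]_w \prod_(i <- J) f i (Z i w) =
  \prod_(i <- J) \int[Pr]_w f i (Z i w).

Let mZi i B : measurable B -> measurable (Z i @^-1` B).
Proof. by move=> mB; rewrite -[X in measurable X]setTI; exact: mZ. Qed.

Let prod_indic (J : seq I) (B : I -> set T) : uniq J ->
  (forall i, measurable (B i)) -> P J (fun i => \1_(B i)).
Proof.
move=> uJ mB; pose A := \bigcap_(i in [set` J]) Z i @^-1` B i.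
have prodE w : \prod_(i <- J) \1_(B i) (Z i w) = \1_A w :> R.
  rewrite indicE; have [|] := boolP (w \in A).
    rewrite inE => wA; rewrite big_seq big1// => i iJ.
    by rewrite indicE mem_set//; exact: wA.
  rewrite notin_setE => /existsNP[i /not_implyP[iJ niB]].
  apply/eqP; rewrite prodf_seq_eq0; apply/hasP; exists i => //=.
  by rewrite indicE memNset.
have mA : measurable A.
  by rewrite /A bigcap_seq; apply: bigsetI_measurable => i _; exact: mZi.
have EA : Pr A = (\prod_(i <- J) \int[Pr]_w \1_(B i) (Z i w))%:E.
  rewrite /A indZ//; elim: J {A prodE uJ mA} => [|i s IH].
    by rewrite !big_nil.
  rewrite !big_cons IH EFinM; congr (_ * _)%E.
  rewrite /Rintegral (_ : (fun w => _) = (fun w => (\1_(Z i @^-1` B i) w)%:E))//.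
  rewrite integral_indic ?setIT//; last exact: mZi.
  by rewrite fineK// fin_num_measure//; exact: mZi.
split.
  under eq_fun do rewrite prodE.
  exact: L1_indic.
under eq_Rintegral do rewrite prodE.
by rewrite /Rintegral integral_indic// setIT; exact: (congr1 fine EA).
Qed.

Let prodD1 (J : seq I) i (F : I -> R) : uniq J -> i \in J ->
  \prod_(j <- J) F j = (\prod_(j <- J | j != i) F j) * F i.
Proof. by move=> uJ iJ; rewrite (bigD1_seq i)//= mulrC. Qed.

Let prodD1upd (J : seq I) i (f : I -> T -> R) g w : uniq J -> i \in J ->
  \prod_(j <- J) upd f i g j (Z j w) =
  (\prod_(j <- J | j != i) f j (Z j w)) * g (Z i w).
Proof.
move=> uJ iJ; rewrite (prodD1 _ uJ iJ) /upd eqxx; congr (_ * _).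
by apply: eq_bigr => j /negbTE ->.
Qed.

Let intD1upd (J : seq I) i (f : I -> T -> R) g : uniq J -> i \in J ->
  \prod_(j <- J) \int[Pr]_w upd f i g j (Z j w) =
  (\prod_(j <- J | j != i) \int[Pr]_w f j (Z j w)) * \int[Pr]_w g (Z i w).
Proof.
move=> uJ iJ; rewrite (prodD1 _ uJ iJ) /upd eqxx; congr (_ * _).
by apply: eq_bigr => j /negbTE ->.
Qed.

Let prod_ge0 (J : seq I) (f : I -> T -> R) : uniq J ->
  (forall i, [/\ measurable_fun setT (f i), forall t, 0 <= f i t &
    L1 Pr (fun w => f i (Z i w))]) -> P J f.
Proof.
move=> uJ; move: f; refine (@coordinatewise_ind _ (T -> R)
  (fun i g => exists2 B, measurable B & g = \1_B)
  (fun i g => [/\ measurable_fun setT g, forall t, 0 <= g t &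
    L1 Pr (fun w => g (Z i w))]) (P J) J _ _ _).
- move=> i g [B mB ->]; split => //.
  exact: (L1_indic Pr (mZi i mB)).
- move=> f _ fJ.
  have /choice[B HB] i : exists B, measurable B /\ (i \in J -> f i = \1_B).
    have [iJ|iJ] := boolP (i \in J); last by exists set0; split.
    by have [B mB E] := fJ i iJ; exists B; split.
  have [LB EB] := prod_indic uJ (fun i => (HB i).1).
  have E w : \prod_(i <- J) f i (Z i w) = \prod_(i <- J) \1_(B i) (Z i w).
    by rewrite big_seq [RHS]big_seq; apply: eq_bigr => i iJ; rewrite (HB i).2.
  split; first by under eq_fun do rewrite E.
  under eq_Rintegral do rewrite E.
  rewrite EB big_seq [RHS]big_seq; apply: eq_bigr => i iJ.
  by rewrite (HB i).2.
(* With the other factors frozen in [G], the hypothesis for indicators says that under the weight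
   [G] the variable [Z i] has [c] times its own law; [integral_weighted] then gives the general
   factor. *)
- move=> f i iJ fP H; have [mf f0 Lf] := fP i.
  pose G w := \prod_(j <- J | j != i) f j (Z j w).
  pose c := \prod_(j <- J | j != i) \int[Pr]_w f j (Z j w).
  have G0 w : 0 <= G w by apply: prodr_ge0 => j _; have [] := fP j.
  have c0 : 0 <= c.
    by apply: prodr_ge0 => j _; apply: Rintegral_ge0 => w _; have [] := fP j.
  have mG : measurable_fun setT G.
    rewrite /G; under eq_fun do rewrite -big_filter.
    apply: measurable_prod => j _; have [mfj _ _] := fP j.
    exact: measurableT_comp mfj (mZ j).
  have lawE B : measurable B ->
      (\int[Pr]_w (G w * \1_B (Z i w))%:E = c%:E * pushforward Pr (Z i) B)%E.
    move=> mB; have [] := H (\1_B) (ex_intro2 _ _ B mB erefl).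
    rewrite (intD1upd _ _ uJ iJ) -/c.
    under eq_fun do rewrite (prodD1upd _ _ _ uJ iJ) -/(G _).
    move=> L E; rewrite -EFin_Rintegral// E EFinM; congr (_ * _)%E.
    rewrite /Rintegral
      (_ : (fun w => _) = (fun w => (\1_(Z i @^-1` B) w)%:E))//.
    rewrite integral_indic ?setIT//; last exact: mZi.
    by rewrite fineK// fin_num_measure//; exact: mZi.
  have Lnu : L1 (pushforward Pr (Z i)) (f i) by exact: (law_L1 (mZ i)).
  have [L E] := integral_weighted (mZ i) mG G0 lawE Lnu.
  split; first by under eq_fun do rewrite (prodD1 _ uJ iJ) -/(G _).
  under eq_Rintegral do rewrite (prodD1 _ uJ iJ) -/(G _).
  rewrite E (prodD1 _ uJ iJ); congr (_ * _).
  by rewrite -(@Rintegral_law _ _ _ _ _ Pr _ (Z i)).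
Qed.

Let prod_indep (J : seq I) (f : I -> T -> R) : uniq J ->
  (forall i, measurable_fun setT (f i)) ->
  (forall i, L1 Pr (fun w => f i (Z i w))) -> P J f.
Proof.
move=> uJ mf Lf.
have {mf Lf} : forall i, measurable_fun setT (f i) /\
    L1 Pr (fun w => f i (Z i w)) by move=> i; split.
move: f; refine (@coordinatewise_ind _ (T -> R)
  (fun i g => [/\ measurable_fun setT g, forall t, 0 <= g t &
    L1 Pr (fun w => g (Z i w))])
  (fun i g => measurable_fun setT g /\ L1 Pr (fun w => g (Z i w))) (P J) J _ _ _).
- by move=> i g [].
- move=> f fB fA.
  (* [prod_ge0] asks for nonnegative functions at every index, and off [J] the sign is unknown;
     there the function is set to 0. *)
  pose f' i := if i \in J then f i else cst 0.
  have [i|L E] := @prod_ge0 J f' uJ.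
    rewrite /f'; case: ifPn => iJ; first exact: fA.
    by split => //; exact: L1_cst.
  have ff' w : \prod_(i <- J) f i (Z i w) = \prod_(i <- J) f' i (Z i w).
    by rewrite big_seq [RHS]big_seq; apply: eq_bigr => i iJ; rewrite /f' iJ.
  split; first by under eq_fun do rewrite ff'.
  under eq_Rintegral do rewrite ff'.
  rewrite E big_seq [RHS]big_seq; apply: eq_bigr => i iJ.
  by rewrite /f' iJ.
- move=> f i iJ fB H; have [mf Lf] := fB i.
  have Ln := L1_norm Lf.
  have mn : measurable_fun setT (fun t => `|f i t|) by exact: measurableT_comp.
  have [|Lp Ep] := H (fun t => (`|f i t| + f i t) / 2).
    split; last by under eq_fun do rewrite mulrC; apply/L1Z/L1D.
      by apply: measurable_funM => //; exact: measurable_funD.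
    by move=> t; have := ler_norm (- f i t); rewrite normrN; lra.
  have [|Lm Em] := H (fun t => (`|f i t| - f i t) / 2).
    split; last by under eq_fun do rewrite mulrC; apply/L1Z/L1B.
      by apply: measurable_funM => //; exact: measurable_funB.
    by move=> t; have := ler_norm (f i t); lra.
  have fE x : f i x = (`|f i x| + f i x) / 2 - (`|f i x| - f i x) / 2 by field.
  have E w : \prod_(j <- J) f j (Z j w) =
      \prod_(j <- J) upd f i (fun t => (`|f i t| + f i t) / 2) j (Z j w) -
      \prod_(j <- J) upd f i (fun t => (`|f i t| - f i t) / 2) j (Z j w).
    by rewrite !(prodD1upd _ _ _ uJ iJ) (prodD1 _ uJ iJ) -mulrBr -fE.
  split; first by under eq_fun do rewrite E; exact: L1B.
  under eq_Rintegral do rewrite E.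
  rewrite RintegralB// Ep Em !(intD1upd _ _ uJ iJ) (prodD1 _ uJ iJ) -mulrBr.
  congr (_ * _); rewrite -RintegralB//.
  + by apply: eq_Rintegral => w _; rewrite -fE.
  + by under eq_fun do rewrite mulrC; apply/L1Z/L1D.
  + by under eq_fun do rewrite mulrC; apply/L1Z/L1B.
Qed.

Lemma L1_prod_indep (J : seq I) (f : I -> T -> R) : uniq J ->
  (forall i, measurable_fun setT (f i)) ->
  (forall i, L1 Pr (fun w => f i (Z i w))) ->
  L1 Pr (fun w => \prod_(i <- J) f i (Z i w)).
Proof. by move=> uJ mf Lf; exact: (prod_indep uJ mf Lf).1. Qed.

Lemma Rintegral_prod_indep (J : seq I) (f : I -> T -> R) : uniq J ->
  (forall i, measurable_fun setT (f i)) ->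
  (forall i, L1 Pr (fun w => f i (Z i w))) ->
  \int[Pr]_w \prod_(i <- J) f i (Z i w) =
  \prod_(i <- J) \int[Pr]_w f i (Z i w).
Proof. by move=> uJ mf Lf; exact: (prod_indep uJ mf Lf).2. Qed.

End independent_product.

Section reindexing.
Context {d : measure_display} {Omega : measurableType d} {R : realType}.
Variable Pr : probability Omega R.
Context {I I' : choiceType} {d' : measure_display} {T : measurableType d'}.

Lemma mutually_independent_inj (Z : I -> Omega -> T) (phi : I' -> I) :
  injective phi -> mutually_independent Pr Z ->
  mutually_independent Pr (fun i => Z (phi i)).
Proof.
move=> inj_phi indZ J B uJ mB.
(* Transport of [B] along [phi]. Injectivity makes [C (phi j)] equal to [B j]; off the range of
   [phi] the condition is empty and [C i] is the whole space. *)
pose C i := [set t | forall j, phi j = i -> B j t].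
have CE j : C (phi j) = B j.
  by apply/seteqP; split => t; [exact|move=> Bt j' /inj_phi ->].
have mC i : measurable (C i).
  have [[j <-]|ni] := pselect (exists j, phi j = i); first by rewrite CE.
  rewrite (_ : C i = setT)//; apply/seteqP; split => // t _ j ji.
  by exfalso; apply: ni; exists j.
have := indZ (map phi J) C; rewrite map_inj_uniq// => /(_ uJ mC).
rewrite big_map => E.
transitivity (Pr (\bigcap_(i in [set` map phi J]) Z i @^-1` C i)).
  congr (Pr _); rewrite !bigcap_seq big_map.
  by apply: eq_bigr => j _; rewrite CE.
by rewrite E; apply: eq_bigr => j _; rewrite CE.
Qed.

End reindexing.

Section independent_pairs.
Context {d : measure_display} {Omega : measurableType d} {R : realType}.
Variable Pr : probability Omega R.
Context {K : choiceType} {d' : measure_display} {T : measurableType d'}.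
Variables (Z : K + K -> Omega -> T) (P Q : probability T R).
Hypothesis mZ : forall i, measurable_fun setT (Z i).
Hypothesis indZ : mutually_independent Pr Z.
Hypothesis lawP : forall k B, measurable B -> Pr (Z (inl k) @^-1` B) = P B.
Hypothesis lawQ : forall k B, measurable B -> Pr (Z (inr k) @^-1` B) = Q B.

Let W k w : T * T := (Z (inl k) w, Z (inr k) w).

Lemma measurable_pair k : measurable_fun setT (W k).
Proof. exact: measurable_fun_pair. Qed.

Let mW k B : measurable B -> measurable (W k @^-1` B).
Proof. by move=> mB; rewrite -[X in measurable X]setTI; exact: measurable_pair. Qed.

Let bigcapD1 (J : seq K) k (E : K -> set (T * T)) : uniq J -> k \in J ->
  \bigcap_(j in [set` J]) W j @^-1` E j =
  W k @^-1` E k `&` \big[setI/setT]_(j <- J | j != k) W j @^-1` E j.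
Proof. by move=> uJ kJ; rewrite bigcap_seq (bigD1_seq k). Qed.

(** For rectangles this is independence of the single variables of [Z]. One coordinate at a time is
    then extended to measurable sets by uniqueness of the product measure, applied to [Pr]
    restricted to the event of the other pairs. *)
Lemma pair_capE (J : seq K) (E : K -> set (T * T)) : uniq J ->
  (forall k, measurable (E k)) ->
  Pr (\bigcap_(k in [set` J]) W k @^-1` E k) = (\prod_(k <- J) (P \x Q) (E k))%E.
Proof.
move=> uJ; move: E; refine (@coordinatewise_ind _ (set (T * T))
  (fun k E => exists A B, [/\ measurable A, measurable B & E = A `*` B])
  (fun k E => measurable E)
  (fun E => Pr (\bigcap_(k in [set` J]) W k @^-1` E k) =
    (\prod_(k <- J) (P \x Q) (E k))%E) J _ _ _).
- by move=> k E [A [B [mA mB ->]]]; exact: measurableX.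
- move=> E _ EJ.
  have /choice[A HA] k : exists A, measurable A /\
      (k \in J -> exists B, measurable B /\ E k = A `*` B).
    have [kJ|kJ] := boolP (k \in J); last by exists set0; split.
    by have [A [B [mA mB E']]] := EJ k kJ; exists A; split => // _; exists B.
  have /choice[B HB] k : exists B, measurable B /\
      (k \in J -> E k = A k `*` B).
    have [kJ|kJ] := boolP (k \in J); last by exists set0; split.
    by have [mA /(_ kJ)[B [mB E']]] := HA k; exists B.
  pose C i := match i with inl k => A k | inr k => B k end.
  pose L : seq (K + K) := map inl J ++ map inr J.
  have uL : uniq L.
    rewrite cat_uniq !map_inj_uniq ?uJ//=; [|by move=> ? ? []..].
    rewrite andbT; apply/hasPn => _ /mapP[k kJ ->].
    by apply/negP => /mapP[].
  have mC i : measurable (C i) by case: i => k; [exact: (HA k).1|exact: (HB k).1].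
  have := indZ uL mC; rewrite big_cat !big_map/= => H.
  transitivity (Pr (\bigcap_(i in [set` L]) Z i @^-1` C i)).
    congr (Pr _); apply/seteqP; split => w.
      move=> Ew i /=; rewrite mem_cat => /orP[] /mapP[k kJ ->].
        by have := Ew k kJ; rewrite /= (HB k).2// => -[].
      by have := Ew k kJ; rewrite /= (HB k).2// => -[].
    move=> Cw k kJ /=; rewrite (HB k).2//; split.
      by apply: (Cw (inl k)); rewrite /= mem_cat map_f.
    by apply: (Cw (inr k)); rewrite /= mem_cat map_f ?orbT.
  rewrite H -big_split/= big_seq [RHS]big_seq; apply: eq_bigr => k kJ.
  have mAk := (HA k).1; have [mBk ->//] := HB k.
  rewrite product_measure1E//; congr (_ * _)%E; [exact: lawP|exact: lawQ].
- move=> E k kJ mE H.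
  pose D := \big[setI/setT]_(j <- J | j != k) W j @^-1` E j.
  have mD : measurable D by apply: bigsetI_measurable => j _; exact: mW.
  pose c := (\prod_(j <- J | j != k) fine ((P \x Q) (E j))).
  have c0 : 0 <= c by apply: prodr_ge0 => j _; exact: fine_ge0.
  have cE : (\prod_(j <- J | j != k) (P \x Q) (E j))%E = c%:E.
    rewrite /c; elim: (J) => [|j s IH]; first by rewrite !big_nil.
    rewrite !big_cons IH; case: ifPn => // _; rewrite EFinM fineK//.
    exact: (@fin_num_measure _ _ _ (product_probability P Q)).
  have prodE F : (\prod_(j <- J) (P \x Q) (upd E k F j) =
      c%:E * (P \x Q) F)%E.
    rewrite (bigD1_seq k)//= /upd eqxx muleC; congr (_ * _)%E.
    by rewrite -cE; apply: eq_bigr => j /negbTE ->.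
  have capE F : \bigcap_(j in [set` J]) W j @^-1` upd E k F j = W k @^-1` F `&` D.
    rewrite (bigcapD1 _ uJ kJ) /upd eqxx; congr (_ `&` _).
    by apply: eq_bigr => j /negbTE ->.
  (* The constant [c] is attached to the first marginal, so that the restricted law is compared with
     a genuine product [m1 \x Q]. *)
  pose m' := pushforward (mrestr Pr mD) (W k).
  pose m1 := mscale (NngNum c0) P.
  have m'E F : m' F = Pr (W k @^-1` F `&` D) by [].
  have rect A B : measurable A -> measurable B -> (m' (A `*` B) = m1 A * Q B)%E.
    move=> mA mB; rewrite m'E -capE H; last by exists A, B.
    by rewrite prodE product_measure1E// muleA.
  have all F : measurable F -> m' F = (c%:E * (P \x Q) F)%E.
    move=> mF; have <- : (m1 \x Q)%E F = m' F.
      apply: (@product_measure_unique _ _ _ _ _ m1 Q m' rect F mF).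
      exact: measurable_pair.
    rewrite /product_measure1 ge0_integral_mscale//.
    exact: measurable_fun_xsection.
  have -> : E = upd E k (E k).
    by apply/funext => j; rewrite /upd; case: eqP => // ->.
  by rewrite prodE capE -m'E all.
Qed.

Lemma pair_law k B : measurable B -> Pr (W k @^-1` B) = (P \x Q)%E B.
Proof.
move=> mB; have := @pair_capE [:: k] (fun=> B) isT (fun=> mB).
by rewrite big_seq1 => <-; rewrite bigcap_seq big_seq1.
Qed.

Lemma pair_independent : mutually_independent Pr W.
Proof.
move=> J B uJ mB; rewrite pair_capE//; apply: eq_bigr => k _.
by rewrite pair_law.
Qed.

End independent_pairs.

Section joined_families.
Context {d : measure_display} {Omega : measurableType d} {R : realType}.
Variable Pr : probability Omega R.
Context {d' : measure_display} {T : measurableType d'}.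
Variables X Y : nat -> Omega -> T.
Hypotheses (mX : forall i, measurable_fun setT (X i))
  (mY : forall i, measurable_fun setT (Y i)).

Lemma mutually_independent_join : mutually_independent Pr X ->
  mutually_independent Pr Y -> independent_families Pr X Y ->
  mutually_independent Pr (join_families X Y).
Proof.
move=> indX indY indXY J B uJ mB.
pose l (i : nat + nat) := if i is inl k then Some k else None.
pose r (i : nat + nat) := if i is inr k then Some k else None.
have lK : ocancel l inl by case.
have rK : ocancel r inr by case.
have meml k : (k \in pmap l J) = (inl k \in J).
  rewrite mem_pmap; apply/mapP/idP => [[[j|j] jJ //= [->]//]|kJ].
  by exists (inl k).
have memr k : (k \in pmap r J) = (inr k \in J).
  rewrite mem_pmap; apply/mapP/idP => [[[j|j] jJ //= [->]//]|kJ].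
  by exists (inr k).
have prodE (F : nat + nat -> \bar R) : (\prod_(i <- J) F i =
    (\prod_(k <- pmap l J) F (inl k)) * (\prod_(k <- pmap r J) F (inr k)))%E.
  elim: (J) => [|[k|k] s IH]; first by rewrite !big_nil mule1.
    by rewrite /= !big_cons IH muleA.
  by rewrite /= !big_cons IH muleCA.
rewrite prodE -[X in (X * _)%E]indX ?(pmap_uniq lK)//.
rewrite -[X in (_ * X)%E]indY ?(pmap_uniq rK)//.
have gen (Z : nat -> Omega -> T) (s : seq nat) (C : nat -> set T) :
    (forall i, measurable (C i)) ->
    sigma_generated Z (\bigcap_(i in [set` s]) Z i @^-1` C i).
  move=> mC; rewrite bigcap_seq.
  elim: s => [|i s IH]; first by rewrite big_nil; exact: (@measurableT _
    (g_sigma_algebraType (\bigcup_i preimage_set_system setT (Z i) measurable))).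
  rewrite big_cons; apply: (@measurableI _
    (g_sigma_algebraType (\bigcup_i preimage_set_system setT (Z i) measurable))) => //.
  apply: sub_sigma_algebra; exists i => //; exists (C i) => //.
  by rewrite setTI.
rewrite -indXY; [|exact: gen|exact: gen].
congr (Pr _); apply/seteqP; split => w.
  by move=> JB; split => k /=; rewrite ?meml ?memr => kJ; exact: (JB _ kJ).
by move=> [lB rB] [k|k] kJ; [apply: lB|apply: rB]; rewrite /= ?meml ?memr.
Qed.

End joined_families.

(** * Trigonometric moments of independent variables *)

Lemma measurable_cos {R : realType} : measurable_fun setT (@cos R).
Proof. by apply: continuous_measurable_fun; exact: continuous_cos. Qed.

Lemma measurable_sin {R : realType} : measurable_fun setT (@sin R).
Proof. by apply: continuous_measurable_fun; exact: continuous_sin. Qed.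

Section trigonometric_moments.
Context {R : realType}.
Implicit Types th : R.

(* Cartesian coordinates of [exp (i th) * \prod_((c, s) <- l) (c + i s)]. *)
Definition rotate th (l : seq (R * R)) : R * R :=
  foldr (fun p q => (p.1 * q.1 - p.2 * q.2, p.1 * q.2 + p.2 * q.1))
    (cos th, sin th) l.

Lemma rotate0 th (l : seq R) : rotate th [seq (c, 0) | c <- l] =
  ((\prod_(c <- l) c) * cos th, (\prod_(c <- l) c) * sin th).
Proof.
elim: l => [|c l IH] /=; first by rewrite big_nil !mul1r.
by rewrite IH/= !mul0r subr0 addr0 !big_cons !mulrA.
Qed.

(** This is |u^n - w^n| <= n |u - w| for u = c + i s: as long as all powers stay bounded by 1, each
    of the [n] steps costs at most [|c - w| + |s|] in each of the two coordinates, whence the factor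
    2. *)
Lemma rotate_nseq_near th (c s w : R) n : 0 <= w <= 1 ->
  (forall m, `|(rotate th (nseq m (c, s))).1| <= 1) ->
  (forall m, `|(rotate th (nseq m (c, s))).2| <= 1) ->
  `|(rotate th (nseq n (c, s))).1 - w ^+ n * cos th| +
  `|(rotate th (nseq n (c, s))).2 - w ^+ n * sin th| <=
  2 * n%:R * (`|c - w| + `|s|).
Proof.
move=> /andP[w0 w1] C1 S1; elim: n => [|n IH].
  by rewrite /= expr0 !mul1r !subrr normr0 addr0 mulr0 mul0r.
rewrite /= ; have := C1 n; have := S1 n; move: IH.
set C := (rotate _ _).1; set S := (rotate _ _).2 => IH S1n C1n.
rewrite exprS -!mulrA; set x := w ^+ n * cos th in IH *.
set y := w ^+ n * sin th in IH *.
have -> : c * C - s * S - w * x = (c - w) * C + w * (C - x) - s * S by ring.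
have -> : c * S + s * C - w * y = (c - w) * S + w * (S - y) + s * C by ring.
have b (a z : R) : `|z| <= 1 -> `|a * z| <= `|a|.
  by move=> z1; rewrite normrM ler_piMr.
have t1 : `|(c - w) * C + w * (C - x) - s * S| <= `|c - w| + w * `|C - x| + `|s|.
  apply: (le_trans (ler_normB _ _)); apply: lerD; last exact: b.
  apply: (le_trans (ler_normD _ _)); apply: lerD; first exact: b.
  by rewrite normrM ger0_norm.
have t2 : `|(c - w) * S + w * (S - y) + s * C| <= `|c - w| + w * `|S - y| + `|s|.
  apply: (le_trans (ler_normD _ _)); apply: lerD; last exact: b.
  apply: (le_trans (ler_normD _ _)); apply: lerD; first exact: b.
  by rewrite normrM ger0_norm.
have t3 : w * (`|C - x| + `|S - y|) <= `|C - x| + `|S - y|.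
  by rewrite ler_piMl// addr_ge0.
rewrite -natr1; nra.
Qed.

Context {d : measure_display} {Omega : measurableType d}.
Variable Pr : probability Omega R.
Context {K : choiceType} {d' : measure_display} {T : measurableType d'}.
Variable W : K -> Omega -> T.
Hypothesis mW : forall k, measurable_fun setT (W k).
Hypothesis indW : mutually_independent Pr W.
Variables (g z : K -> T -> R).
Hypotheses (mg : forall k, measurable_fun setT (g k))
  (mz : forall k, measurable_fun setT (z k))
  (Lg : forall k, L1 Pr (fun w => g k (W k w))).

Let gc k := fun t => g k t * cos (z k t).
Let gs k := fun t => g k t * sin (z k t).

Let mgc k : measurable_fun setT (gc k).
Proof. by apply: measurable_funM => //; apply: measurableT_comp => //; exact: measurable_cos. Qed.

Let mgs k : measurable_fun setT (gs k).
Proof. by apply: measurable_funM => //; apply: measurableT_comp => //; exact: measurable_sin. Qed.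

Let Lgc k : L1 Pr (fun w => gc k (W k w)).
Proof.
apply: (@L1_bmul _ _ _ _ 1) => [|w|]; [|exact: cos_max|exact: Lg].
by apply: measurableT_comp; [exact: measurable_cos|exact: measurableT_comp].
Qed.

Let Lgs k : L1 Pr (fun w => gs k (W k w)).
Proof.
apply: (@L1_bmul _ _ _ _ 1) => [|w|]; [|exact: sin_max|exact: Lg].
by apply: measurableT_comp; [exact: measurable_sin|exact: measurableT_comp].
Qed.

Let moments k := (\int[Pr]_w gc k (W k w), \int[Pr]_w gs k (W k w)).

Let G th (J : seq K) w := (\prod_(k <- J) g k (W k w)) *
  cos (th + \sum_(k <- J) z k (W k w)).
Let H th (J : seq K) w := (\prod_(k <- J) g k (W k w)) *
  sin (th + \sum_(k <- J) z k (W k w)).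

(** The induction needs an arbitrary product over a second list: the addition theorems move the
    index [k] from the angle into the tail [J2], with [gc k] or [gs k] as its factor. *)
Let tail_moments th (J1 J2 : seq K) (f : K -> T -> R) : uniq (J1 ++ J2) ->
  (forall k, measurable_fun setT (f k)) ->
  (forall k, L1 Pr (fun w => f k (W k w))) ->
  [/\ L1 Pr (fun w => G th J1 w * \prod_(k <- J2) f k (W k w)),
      L1 Pr (fun w => H th J1 w * \prod_(k <- J2) f k (W k w)),
      \int[Pr]_w (G th J1 w * \prod_(k <- J2) f k (W k w)) =
        (rotate th (map moments J1)).1 * \prod_(k <- J2) \int[Pr]_w f k (W k w) &
      \int[Pr]_w (H th J1 w * \prod_(k <- J2) f k (W k w)) =
        (rotate th (map moments J1)).2 * \prod_(k <- J2) \int[Pr]_w f k (W k w)].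
Proof.
elim: J1 J2 f => [|k J1 IH] J2 f u mf Lf.
  have L := L1_prod_indep mW indW u mf Lf.
  have E := Rintegral_prod_indep mW indW u mf Lf.
  have -> : G th [::] = fun=> cos th.
    by apply/funext => w; rewrite /G !big_nil mul1r addr0.
  have -> : H th [::] = fun=> sin th.
    by apply/funext => w; rewrite /H !big_nil mul1r addr0.
  by split; rewrite ?RintegralZl ?E//; exact: L1Z.
have u' : uniq (J1 ++ k :: J2).
  by rewrite -(perm_uniq (permEl (perm_catCA [:: k] J1 J2))).
have kJ2 : k \notin J2.
  by move: u; rewrite /= mem_cat negb_or => /andP[/andP[]].
have updE (F : T -> R) w : \prod_(j <- k :: J2) upd f k F j (W j w) =
    F (W k w) * \prod_(j <- J2) f j (W j w).
  rewrite big_cons {1}/upd eqxx; congr (_ * _).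
  rewrite big_seq [RHS]big_seq; apply: eq_bigr => j jJ2; rewrite /upd.
  by case: eqP jJ2 kJ2 => // -> ->.
have updI (F : T -> R) : \prod_(j <- k :: J2) \int[Pr]_w upd f k F j (W j w) =
    (\int[Pr]_w F (W k w)) * \prod_(j <- J2) \int[Pr]_w f j (W j w).
  rewrite big_cons {1}/upd eqxx; congr (_ * _).
  rewrite big_seq [RHS]big_seq; apply: eq_bigr => j jJ2; rewrite /upd.
  by case: eqP jJ2 kJ2 => // -> ->.
have [||C1 C2 C3 C4] := IH (k :: J2) (upd f k (gc k)) u'.
- by move=> j; rewrite /upd; case: eqP.
- by move=> j; rewrite /upd; case: eqP => // ->.
have [||S1 S2 S3 S4] := IH (k :: J2) (upd f k (gs k)) u'.
- by move=> j; rewrite /upd; case: eqP.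
- by move=> j; rewrite /upd; case: eqP => // ->.
have GE w : G th (k :: J1) w * \prod_(j <- J2) f j (W j w) =
    G th J1 w * \prod_(j <- k :: J2) upd f k (gc k) j (W j w) -
    H th J1 w * \prod_(j <- k :: J2) upd f k (gs k) j (W j w).
  rewrite !updE /G /H /gc /gs !big_cons.
  set Sz := \sum_(j <- J1) _.
  have -> : th + (z k (W k w) + Sz) = z k (W k w) + (th + Sz) by ring.
  by rewrite cosD; ring.
have HE w : H th (k :: J1) w * \prod_(j <- J2) f j (W j w) =
    H th J1 w * \prod_(j <- k :: J2) upd f k (gc k) j (W j w) +
    G th J1 w * \prod_(j <- k :: J2) upd f k (gs k) j (W j w).
  rewrite !updE /G /H /gc /gs !big_cons.
  set Sz := \sum_(j <- J1) _.
  have -> : th + (z k (W k w) + Sz) = z k (W k w) + (th + Sz) by ring.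
  by rewrite sinD; ring.
split.
- by under eq_fun do rewrite GE; exact: L1B.
- by under eq_fun do rewrite HE; exact: L1D.
- under eq_Rintegral do rewrite GE.
  by rewrite RintegralB// C3 S4 !updI /=; ring.
- under eq_Rintegral do rewrite HE.
  by rewrite RintegralD// C4 S3 !updI /=; ring.
Qed.

Lemma trig_moments th (J : seq K) : uniq J ->
  [/\ L1 Pr (fun w => (\prod_(k <- J) g k (W k w)) *
        cos (th + \sum_(k <- J) z k (W k w))),
    \int[Pr]_w ((\prod_(k <- J) g k (W k w)) *
      cos (th + \sum_(k <- J) z k (W k w))) =
      (rotate th [seq (\int[Pr]_w (g k (W k w) * cos (z k (W k w))),
        \int[Pr]_w (g k (W k w) * sin (z k (W k w)))) | k <- J]).1 &
    \int[Pr]_w ((\prod_(k <- J) g k (W k w)) *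
      sin (th + \sum_(k <- J) z k (W k w))) =
      (rotate th [seq (\int[Pr]_w (g k (W k w) * cos (z k (W k w))),
        \int[Pr]_w (g k (W k w) * sin (z k (W k w)))) | k <- J]).2].
Proof.
move=> uJ; have u : uniq (J ++ [::]) by rewrite cats0.
have [||L _ E1 E2] := @tail_moments th J [::] (fun=> cst 1) u.
- by [].
- by move=> k; exact: L1_cst.
split.
- by move: L; under eq_fun do rewrite big_nil mulr1.
- by move: E1; under eq_Rintegral do rewrite big_nil mulr1; rewrite big_nil mulr1.
- by move: E2; under eq_Rintegral do rewrite big_nil mulr1; rewrite big_nil mulr1.
Qed.

End trigonometric_moments.

(** * Gaussian integrals and the Mehler kernel *)

Section standard_normal.
Context {R : realType}.
Notation gamma := (normal_prob (0 : R) 1).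
Notation leb := (@lebesgue_measure R).
Implicit Types a b c t th : R.

Let p := normal_pdf (0 : R) 1.

Let p_ge0 x : 0 <= p x. Proof. exact: normal_pdf_ge0. Qed.

Let mp : measurable_fun setT p. Proof. exact: measurable_normal_pdf. Qed.

Lemma normal_pdf01E (x : R) :
  normal_pdf 0 1 x = normal_peak 1 * expR (- (x ^+ 2 / 2)).
Proof.
by rewrite normal_pdfE ?oner_neq0// /normal_fun subr0 expr1n mulNr.
Qed.

Let lawE B : measurable B ->
  (\int[leb]_x (p x * \1_B (idfun x))%:E = 1%:E * gamma B)%E.
Proof.
move=> mB; rewrite mul1e /normal_prob [RHS]integral_mkcond.
by apply: eq_integral => x _; rewrite patchE indicE; case: ifPn;
  rewrite ?mulr1 ?mulr0.
Qed.

Lemma Rintegral_normal_prob01 (f : R -> R) : L1 gamma f ->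
  L1 leb (fun x => normal_pdf 0 1 x * f x) /\
  \int[leb]_x (normal_pdf 0 1 x * f x) = \int[gamma]_x f x.
Proof.
move=> Lf; have := @integral_weighted _ _ _ _ _ leb gamma idfun p 1
  (@measurable_id _ _ _) mp p_ge0 lawE f Lf.
by rewrite mul1r.
Qed.

(** Completing the square turns the integrand times the standard density into a constant times the
    normal density of mean b / (1 + a) and variance 1 / (1 + a). *)
Lemma ge0_gauss_quad a b : -1 < a ->
  (\int[gamma]_x (expR (- (a * x ^+ 2 / 2) + b * x))%:E)%E =
  ((Num.sqrt (1 + a))^-1 * expR (b ^+ 2 / (2 * (1 + a))))%:E.
Proof.
move=> a1; have a0 : 0 < 1 + a by lra.
pose s := (Num.sqrt (1 + a))^-1.
have s0 : 0 < s by rewrite invr_gt0 sqrtr_gt0.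
have s2 : s ^+ 2 = (1 + a)^-1 by rewrite exprVn sqr_sqrtr// ltW.
pose m := b / (1 + a).
pose C := s * expR (b ^+ 2 / (2 * (1 + a))).
have C0 : 0 <= C by rewrite mulr_ge0 ?expR_ge0// ltW.
have mf : measurable_fun setT (fun x : R => expR (- (a * x ^+ 2 / 2) + b * x)).
  apply: measurableT_comp => //; apply: measurable_funD.
    apply: measurableT_comp => //; apply: measurable_funM => //.
    by apply: measurable_funM => //; exact: measurable_funX.
  by apply: measurable_funM.
rewrite -[LHS]mul1e -(@ge0_integral_weighted _ _ _ _ _ leb gamma idfun p 1
  (@measurable_id _ _ _) mp p_ge0 lawE); last 2 first.
- exact/measurable_EFinP.
- by move=> x; rewrite lee_fin expR_ge0.
have E x : p x * expR (- (a * x ^+ 2 / 2) + b * x) = C * normal_pdf m s x.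
  rewrite /p normal_pdf01E normal_pdfE ?gt_eqF// /normal_fun s2.
  have -> : normal_peak (1 : R) = s * normal_peak s.
    rewrite /normal_peak expr1n s2 -[in RHS]mulrnAr mul1r sqrtrM ?invr_ge0 ?ltW//.
    rewrite sqrtrV ?ltW// invfM invrK mulrA mulVf ?mul1r//.
    by rewrite sqrtr_eq0 -ltNge.
  have E : expR (- (x ^+ 2 / 2)) * expR (- (a * x ^+ 2 / 2) + b * x) =
      expR (b ^+ 2 / (2 * (1 + a))) *
      expR (- (x - m) ^+ 2 / ((1 + a)^-1 *+ 2)).
    rewrite -!expRD; congr expR; rewrite /m; field.
    by apply/eqP => h; move: a0; rewrite h ltxx.
  by rewrite -[LHS]mulrA E /C; ring.
under eq_integral do rewrite -EFinM E EFinM.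
rewrite ge0_integralZl//.
- by rewrite integral_normal_pdf mule1.
- by apply/measurable_EFinP; exact: measurable_normal_pdf.
- by move=> x _; rewrite lee_fin normal_pdf_ge0.
Qed.

Lemma L1_gauss_quad a b : -1 < a ->
  L1 gamma (fun x => expR (- (a * x ^+ 2 / 2) + b * x)).
Proof.
move=> a1; apply/integrableP; split.
  apply/measurable_EFinP; apply: measurableT_comp => //; apply: measurable_funD.
    apply: measurableT_comp => //; apply: measurable_funM => //.
    by apply: measurable_funM => //; exact: measurable_funX.
  by apply: measurable_funM.
under eq_integral do rewrite /= ger0_norm ?expR_ge0//.
by rewrite ge0_gauss_quad// ltry.
Qed.

Lemma L1_gauss_sqr : L1 gamma (fun x => x ^+ 2).
Proof.
(* From 1 + y <= exp y at y = x^2 / 4: the dominating function is 4 exp (x^2 / 4), the case a = -1/2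
   of [L1_gauss_quad]. *)
apply: (@L1_le _ _ _ gamma (fun x => x ^+ 2) (fun x => 4 * expR (- (- 2^-1 * x ^+ 2 / 2) + 0 * x))).
- exact: measurable_funX.
- move=> x; rewrite ger0_norm ?sqr_ge0//.
  have := @expR_ge1Dx _ (x ^+ 2 / 4).
  have -> : - (- 2^-1 * x ^+ 2 / 2) + 0 * x = x ^+ 2 / 4 by field.
  by lra.
- by apply: L1Z; apply: L1_gauss_quad; lra.
Qed.

Lemma L1_gauss_id : L1 gamma (fun x => x).
Proof. by apply: (@L1_sqr _ _ _ gamma (fun x => x)) => //; exact: L1_gauss_sqr. Qed.

End standard_normal.

Section normal_characteristic_function.
Context {R : realType}.
Notation gamma := (normal_prob (0 : R) 1).
Notation leb := (@lebesgue_measure R).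
Implicit Types (a b c t x th : R).

Let is_derive_affine a b x : is_derive x (1 : R) (fun y : R => y * a + b) a.
Proof.
have -> : (fun y : R => y * a + b) = (a \*: (@idfun R : R -> R^o)) + cst b.
  by apply/funext => y /=; rewrite mulrC.
have h1 := @is_derive_id _ _ x (1 : R).
have h2 := @is_derive_cst R R^o R^o b x 1.
have := is_deriveD (is_deriveZ a h1) h2.
by rewrite addr0 => /is_derive_eq; apply; rewrite /GRing.scale/= mulr1.
Qed.

Let is_derive_cosaff a b x :
  is_derive x (1 : R) (fun y : R => cos (y * a + b)) (- sin (x * a + b) * a).
Proof. exact: (is_derive1_comp (is_derive_cos _) (is_derive_affine a b x)). Qed.

Let is_derive_sinaff a b x :
  is_derive x (1 : R) (fun y : R => sin (y * a + b)) (cos (x * a + b) * a).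
Proof. exact: (is_derive1_comp (is_derive_sin _) (is_derive_affine a b x)). Qed.

Let is_derive_gauss c x :
  is_derive x (1 : R) (fun y : R => expR (c * y ^+ 2 / 2))
   (expR (c * x ^+ 2 / 2) * (c * x)).
Proof.
have h : is_derive x (1 : R) (fun y : R => c * y ^+ 2 / 2) (c * x).
  have -> : (fun y : R => c * y ^+ 2 / 2) =
      (c / 2) \*: ((@idfun R : R -> R^o) * (@idfun R : R -> R^o)).
    by apply/funext => y; transitivity (c / 2 * (y * y)); first by field.
  have h1 := @is_derive_id _ _ x (1 : R).
  have := is_deriveZ (c / 2) (is_deriveM h1 h1).
  by move=> /is_derive_eq; apply; rewrite /GRing.scale/=; field.
exact: (is_derive1_comp (is_derive_expR _) h).
Qed.

Let is_derive_mul (f g : R -> R) x (df dg : R) : is_derive x (1 : R) f df ->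
  is_derive x (1 : R) g dg ->
  is_derive x (1 : R) (fun y => f y * g y) (f x * dg + g x * df).
Proof. by move=> hf hg; exact: (is_deriveM hf hg). Qed.

Let is_derive_cvg (f : R -> R) x (df : R) : is_derive x (1 : R) f df ->
  f y @[y --> x] --> f x.
Proof.
move=> hf; apply: differentiable_continuous; apply/derivable1_diffP.
exact: ex_derive.
Qed.

Let mcos a b : measurable_fun setT (fun x : R => cos (x * a + b)).
Proof.
apply: measurableT_comp; first exact: measurable_cos.
by apply: measurable_funD => //; exact: measurable_funM.
Qed.

Let msin a b : measurable_fun setT (fun x : R => sin (x * a + b)).
Proof.
apply: measurableT_comp; first exact: measurable_sin.
by apply: measurable_funD => //; exact: measurable_funM.
Qed.

Let Lcos a b : L1 gamma (fun x : R => cos (x * a + b)).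
Proof.
apply: (@L1_bounded _ _ _ gamma 1); first exact: mcos.
by move=> x; exact: cos_max.
Qed.

Let Lxsin a b : L1 gamma (fun x : R => x * sin (x * a + b)).
Proof.
apply: (@L1_bmul _ _ _ gamma 1 (fun x => x)); first exact: msin.
  by move=> x; exact: sin_max.
exact: L1_gauss_id.
Qed.

(** Stein's identity for the sine. The derivative of sin (x t + th) exp (- x^2 / 2) is integrated
    over [-(n+1), n+1], where the boundary terms are at most 1 / (n + 1) each. *)
Let gauss_by_parts t th : \int[gamma]_x (x * sin (x * t + th)) =
  t * \int[gamma]_x cos (x * t + th).
Proof.
pose e x := expR (-1 * x ^+ 2 / 2).
pose K x := sin (x * t + th) * e x.
pose k x := sin (x * t + th) * (e x * (-1 * x)) + e x * (cos (x * t + th) * t).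
have dK x : is_derive x (1 : R) K (k x).
  exact: (is_derive_mul (is_derive_sinaff t th x) (is_derive_gauss (-1) x)).
pose g x := t * cos (x * t + th) - x * sin (x * t + th).
have Lg : L1 gamma g by apply: L1B; [exact: L1Z|exact: Lxsin].
have [Lpg Epg] := Rintegral_normal_prob01 Lg.
have pk0 : 0 < normal_peak (1 : R) by apply: normal_peak_gt0; rewrite oner_neq0.
have kE x : k x = (normal_peak 1)^-1 * (normal_pdf 0 1 x * g x).
  rewrite normal_pdf01E mulrA (mulrA _^-1) mulVf ?gt_eqF// mul1r.
  rewrite /k /g /e (_ : -1 * x ^+ 2 / 2 = - (x ^+ 2 / 2)); last by field.
  by ring.
have Lk : L1 leb k by rewrite (funext kE); exact: L1Z.
have mk := L1_measurable Lk.
have ck : continuous k.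
  move=> x; have c1 := is_derive_cvg (is_derive_sinaff t th x).
  have c2 := is_derive_cvg (is_derive_gauss (-1) x).
  have c3 := is_derive_cvg (is_derive_cosaff t th x).
  exact: (cvgD (cvgM c1 (cvgM c2 (cvgM (cvg_cst _) cvg_id)))
    (cvgM c2 (cvgM c3 (cvg_cst _)))).
have cK : continuous K by move=> x; exact: is_derive_cvg (dK x).
have Kn n : \int[leb]_x (k x * \1_`[(- n.+1%:R), n.+1%:R] x) =
    K n.+1%:R - K (- n.+1%:R).
  have n0 : - n.+1%:R < n.+1%:R :> R by rewrite -subr_gt0 opprK -natrD.
  have := @continuous_FTC2 R k K _ _ n0 _ _ _.
  move=> H; transitivity (\int[leb]_(x in `[- n.+1%:R, n.+1%:R]) k x).
    congr fine; rewrite [RHS]integral_mkcond; apply: eq_integral => x _.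
    by rewrite patchE indicE; case: ifPn; rewrite ?mulr1 ?mulr0.
  rewrite /Rintegral H//.
  - exact: continuous_subspaceT.
  - split; first by move=> x _; exact: ex_derive.
      by apply: cvg_at_right_filter; exact: cK.
    by apply: cvg_at_left_filter; exact: cK.
  - by move=> x _; rewrite derive1E; exact: derive_val.
(* Since exp (x^2 / 2) >= 1 + x^2 / 2 >= x. *)
have Kb x : 0 < x -> `|K x| <= x^-1 /\ `|K (- x)| <= x^-1.
  move=> x0; have H y : y ^+ 2 = x ^+ 2 -> `|K y| <= x^-1.
    move=> yx; rewrite /K normrM (ger0_norm (expR_ge0 _)).
    apply: (@le_trans _ _ (1 * e y)).
      by rewrite ler_wpM2r ?expR_ge0//; exact: sin_max.
    rewrite mul1r /e yx (_ : -1 * x ^+ 2 / 2 = - (x ^+ 2 / 2)); last by field.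
    rewrite expRN lef_pV2 ?posrE ?expR_gt0//.
    by have := @expR_ge1Dx _ (x ^+ 2 / 2); nra.
  by split; apply: H; rewrite ?sqrrN.
have h0 : 2 * harmonic n @[n --> \oo] --> (0 : R).
  by rewrite -[X in _ --> X](mulr0 (2 : R)); apply: cvgMr; exact: cvg_harmonic.
have lim0 : (fun n => \int[leb]_x (k x * \1_`[(- n.+1%:R), n.+1%:R] x))
    @ \oo --> (0 : R).
  apply: (@squeeze_cvgr _ _ _ _ (fun n => - (2 * harmonic n))
    (fun n => 2 * harmonic n)).
  - apply: nearW => n; rewrite Kn -ler_norml.
    have [h1 h2] := Kb n.+1%:R (ltr0Sn _ _).
    by apply: (le_trans (ler_normB _ _)); rewrite mulr_natl mulr2n lerD.
  - by rewrite -[X in _ --> X](@oppr0 R); exact: cvgN h0.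
  - exact: h0.
have [_ limk] : L1 leb k /\
    (fun n => \int[leb]_x (k x * \1_`[(- n.+1%:R), n.+1%:R] x)) @ \oo -->
    \int[leb]_x k x.
  apply: (@Rintegral_dct _ _ _ leb
    (fun n x => k x * \1_`[(- n.+1%:R), n.+1%:R] x) k (fun x => `|k x|)).
  - move=> n; apply: measurable_funM => //; exact: measurable_indic.
  - exact: mk.
  - apply: aeW => x; apply: cvg_near_cst; near=> n.
    rewrite indicE mem_set ?mulr1//= in_itv/= -ler_norml.
    apply: (@le_trans _ _ n%:R); last by rewrite ler_nat.
    by near: n; exact: nbhs_infty_ger.
  - exact: (@L1_norm _ _ _ leb k Lk).
  - move=> n x; rewrite normrM ler_piMr// indicE normr_nat.
    by case: (_ \in _).
have k0 : \int[leb]_x k x = 0 by exact: (cvg_unique _ limk lim0).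
have : \int[gamma]_x g x = 0.
  rewrite -Epg; move: k0; rewrite (funext kE) RintegralZl// => /eqP.
  by rewrite mulf_eq0 invr_eq0 gt_eqF//= => /eqP.
rewrite /g (RintegralB measurableT (L1Z t (Lcos t th)) (Lxsin t th)).
by rewrite (RintegralZl _ measurableT (Lcos t th)); lra.
Unshelve. all: by end_near. Qed.

(** As a function of [t] the integral solves F' = - t F: differentiate under the integral sign and
    apply [gauss_by_parts]. Hence F(t) exp (t^2 / 2) is constant and equals F(0) = cos th. *)
Lemma normal_cos t th :
  \int[gamma]_x cos (x * t + th) = expR (- (t ^+ 2 / 2)) * cos th.
Proof.
pose F s := \int[gamma]_x cos (x * s + th).
pose f (s x : R) := cos (x * s + th).
have df s x : is_derive s (1 : R) (f ^~ x) (- sin (x * s + th) * x).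
  rewrite /f; under eq_fun do rewrite mulrC; rewrite (mulrC x s).
  exact: is_derive_cosaff.
have Is (s : R) : `]s - 1, s + 1[%classic s.
  by rewrite /= in_itv/=; apply/andP; split; lra.
have derf x y : derivable (f ^~ y) x 1 by exact: ex_derive.
have ub x y : `|partial1of2 f x y| <= `|y|.
  rewrite partial1of2E derive_val normrM normrN ler_piMl//.
  exact: sin_max.
have dF s : is_derive s (1 : R) F (- s * F s).
  have L := @L1_norm _ _ _ gamma _ L1_gauss_id.
  have D := @derivable_under_integral _ _ _ gamma f _ measurableT _ _ _ (Is s)
    (fun x _ => Lcos x th) (fun x y _ _ => derf x y) _ (fun y => normr_ge0 y) L
    (fun x y _ _ => ub x y).
  have E := @differentiation_under_integral _ _ _ gamma f _ measurableT _ _ _ (Is s)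
    (fun x _ => Lcos x th) (fun x y _ _ => derf x y) _ (fun y => normr_ge0 y) L
    (fun x y _ _ => ub x y).
  apply: DeriveDef; first exact: D.
  rewrite -derive1E E mulNr -gauss_by_parts -mulN1r.
  rewrite -(RintegralZl (mu := gamma) (D := setT) (-1) measurableT (Lxsin s th)).
  apply: eq_Rintegral => x _; rewrite partial1of2E derive_val; ring.
pose H s := F s * expR (1 * s ^+ 2 / 2).
have dH s : is_derive s (1 : R) H 0.
  have h := is_derive_mul (dF s) (is_derive_gauss 1 s).
  by apply: (is_derive_eq h); ring.
have := is_derive_0_is_cst t 0 dH; rewrite /H expr0n/= mulr0 mul0r expR0 mulr1.
have -> : F 0 = cos th.
  rewrite /F; under eq_Rintegral do rewrite mulr0 add0r.
  exact: (@Rintegral_cst1 _ _ _ gamma).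
by move=> <-; rewrite mulrCA -expRD (_ : _ + _ = 0) ?expR0 ?mulr1//; field.
Qed.

End normal_characteristic_function.

Section normal_quadratic_exponential.
Context {R : realType}.
Notation gamma := (normal_prob (0 : R) 1).
Implicit Types a b c : R.

Definition quad2 a b c (z : R * R) : R :=
  expR (- ((a * z.1 ^+ 2 + 2 * b * (z.1 * z.2) + c * z.2 ^+ 2) / 2)).

Lemma measurable_quad2 a b c : measurable_fun setT (quad2 a b c).
Proof.
apply: measurableT_comp => //; apply: measurableT_comp => //.
apply: measurable_funM => //; apply: measurable_funD.
  apply: measurable_funD; apply: measurable_funM => //.
    by apply: measurable_funX; exact: measurable_fst.
  by apply: measurable_funM; [exact: measurable_fst|exact: measurable_snd].
apply: measurable_funM => //.
by apply: measurable_funX; exact: measurable_snd.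
Qed.

Let measurable_gauss_quad a b :
  measurable_fun setT (fun x : R => expR (- (a * x ^+ 2 / 2) + b * x)).
Proof.
apply: measurableT_comp => //; apply: measurable_funD.
  apply: measurableT_comp => //; apply: measurable_funM => //.
  by apply: measurable_funM => //; exact: measurable_funX.
by apply: measurable_funM.
Qed.

(** The hypotheses say that the identity plus the matrix of the form is positive definite.
    Integrating out the second coordinate leaves a one-dimensional integral whose coefficient 1 + a'
    is the Schur complement. *)
Let ge0_quad2 a b c : -1 < c -> b ^+ 2 < (1 + a) * (1 + c) ->
  (\int[gamma \x gamma]_z (quad2 a b c z)%:E)%E =
  ((Num.sqrt ((1 + a) * (1 + c) - b ^+ 2))^-1)%:E.
Proof.
move=> c1 det; have c0 : 0 < 1 + c by lra.
have cn0 : 1 + c != 0 by rewrite gt_eqF.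
pose a' := a - b ^+ 2 / (1 + c).
have a'1 : -1 < a'.
  rewrite /a' -subr_gt0.
  have -> : a - b ^+ 2 / (1 + c) - -1 = ((1 + a) * (1 + c) - b ^+ 2) / (1 + c).
    by field.
  by rewrite divr_gt0// subr_gt0.
rewrite fubini_tonelli1; last 2 first.
- by apply/measurable_EFinP; exact: measurable_quad2.
- by move=> z; rewrite lee_fin expR_ge0.
have inner x : (fubini_F gamma (EFin \o quad2 a b c) x =
    ((Num.sqrt (1 + c))^-1 * expR (- (a' * x ^+ 2 / 2) + 0 * x))%:E)%E.
  rewrite /fubini_F.
  have E y : quad2 a b c (x, y) =
      expR (- (a * x ^+ 2 / 2)) * expR (- (c * y ^+ 2 / 2) + (- b * x) * y).
    by rewrite -expRD /quad2/=; congr expR; field.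
  under eq_integral do rewrite /= E EFinM.
  rewrite ge0_integralZl//;
    last by apply/measurable_EFinP; exact: measurable_gauss_quad.
  rewrite ge0_gauss_quad// -EFinM mulrCA -expRD /a'; congr (_ * expR _)%:E.
  by field.
transitivity (\int[gamma]_x ((Num.sqrt (1 + c))^-1 *
    expR (- (a' * x ^+ 2 / 2) + 0 * x))%:E)%E.
  by apply: eq_integral => x _; exact: inner.
under eq_integral do rewrite EFinM.
rewrite ge0_integralZl//;
  last by apply/measurable_EFinP; exact: measurable_gauss_quad.
rewrite ge0_gauss_quad// -EFinM expr0n/= mul0r expR0 mulr1 -invfM -sqrtrM ?ltW//.
by congr (_^-1)%:E; congr Num.sqrt; rewrite /a'; field.
Qed.

Lemma L1_quad2 a b c : -1 < c -> b ^+ 2 < (1 + a) * (1 + c) ->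
  L1 (gamma \x gamma)%E (quad2 a b c).
Proof.
move=> c1 det; apply/integrableP; split.
  by apply/measurable_EFinP; exact: measurable_quad2.
under eq_integral do rewrite /= ger0_norm ?expR_ge0//.
by rewrite ge0_quad2// ltry.
Qed.

Lemma Rintegral_quad2 a b c : -1 < c -> b ^+ 2 < (1 + a) * (1 + c) ->
  \int[(gamma \x gamma)%E]_z quad2 a b c z =
  (Num.sqrt ((1 + a) * (1 + c) - b ^+ 2))^-1.
Proof. by move=> c1 det; rewrite /Rintegral ge0_quad2. Qed.

End normal_quadratic_exponential.

(** * The Mehler kernel *)

Section mehler.
Context {R : realType}.
Notation gamma := (normal_prob (0 : R) 1).
Implicit Types s : R.

Definition mehler s (z : R * R) : R :=
  (Num.sqrt (1 - s ^+ 2))^-1 *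
  expR (2^-1 * (- (s ^+ 2 / (1 - s ^+ 2)) * (z.1 ^+ 2 + z.2 ^+ 2)
     + 2 * s / (1 - s ^+ 2) * (z.1 * z.2))).

(** Sends independent standard normals to standard normals with correlation [s]; [mehler s] is the
    density of the image law. *)
Definition correlate s (z : R * R) : R * R :=
  (z.1, s * z.1 + Num.sqrt (1 - s ^+ 2) * z.2).

(* With [p = z.1 + z.2] and [m = z.1 - z.2], the exponent of [mehler s z] is
   [s / (1 + s) * p ^+ 2 / 4 - s / (1 - s) * m ^+ 2 / 4]; the bound drops the
   second term. *)
Definition mehler_bound s (z : R * R) : R :=
  (Num.sqrt (1 - s ^+ 2))^-1 * expR (s / (1 + s) * (z.1 + z.2) ^+ 2 / 4).

Lemma measurable_correlate s : measurable_fun setT (correlate s).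
Proof.
apply: measurable_fun_pair; first exact: measurable_fst.
by apply: measurable_funD; apply: measurable_funM.
Qed.

Lemma measurable_mehler s : measurable_fun setT (mehler s).
Proof.
apply: measurable_funM => //; apply: measurableT_comp => //.
apply: measurable_funM => //; apply: measurable_funD; apply: measurable_funM => //.
  by apply: measurable_funD; apply: measurable_funX;
    [exact: measurable_fst|exact: measurable_snd].
by apply: measurable_funM; [exact: measurable_fst|exact: measurable_snd].
Qed.

Variable s : R.
Hypothesis s01 : 0 <= s < 1.

Let s0 : 0 <= s. Proof. by case/andP: s01. Qed.
Let s1 : s < 1. Proof. by case/andP: s01. Qed.
Let r2_gt0 : 0 < 1 - s ^+ 2. Proof. by rewrite subr_gt0 expr_lt1. Qed.
Let r2_neq0 : 1 - s ^+ 2 != 0. Proof. by rewrite gt_eqF. Qed.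
Let r_gt0 : 0 < Num.sqrt (1 - s ^+ 2). Proof. by rewrite sqrtr_gt0. Qed.
Let rr : Num.sqrt (1 - s ^+ 2) ^+ 2 = 1 - s ^+ 2.
Proof. by rewrite sqr_sqrtr// ltW. Qed.
Let ps_neq0 : 1 + s != 0. Proof. by rewrite gt_eqF// ltr_wpDr. Qed.

Let mehlerE z : mehler s z = (Num.sqrt (1 - s ^+ 2))^-1 *
  quad2 (s ^+ 2 / (1 - s ^+ 2)) (- (s / (1 - s ^+ 2))) (s ^+ 2 / (1 - s ^+ 2)) z.
Proof. by rewrite /mehler /quad2; congr (_ * expR _); field. Qed.

Let mehler_sqrE z : mehler s z ^+ 2 = (1 - s ^+ 2)^-1 *
  quad2 (2 * s ^+ 2 / (1 - s ^+ 2)) (- (2 * s / (1 - s ^+ 2)))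
    (2 * s ^+ 2 / (1 - s ^+ 2)) z.
Proof.
rewrite /mehler /quad2 exprMn exprVn rr -expRM_natl; congr (_ * expR _).
by field.
Qed.

Let mehler_corrE z : mehler s (correlate s z) = (Num.sqrt (1 - s ^+ 2))^-1 *
  quad2 (- s ^+ 2) (- (Num.sqrt (1 - s ^+ 2) * s)) (s ^+ 2) z.
Proof.
rewrite /mehler /quad2 /correlate/=; congr (_ * expR _).
set r := Num.sqrt _.
have -> : (s * z.1 + r * z.2) ^+ 2 =
    s ^+ 2 * z.1 ^+ 2 + 2 * s * r * (z.1 * z.2) + (1 - s ^+ 2) * z.2 ^+ 2.
  by rewrite -rr -/r; ring.
by field.
Qed.

Let mehler_bound_sqrE z : mehler_bound s z ^+ 2 = (1 - s ^+ 2)^-1 *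
  quad2 (- (s / (1 + s))) (- (s / (1 + s))) (- (s / (1 + s))) z.
Proof.
rewrite /mehler_bound /quad2 exprMn exprVn rr -expRM_natl; congr (_ * expR _).
by field.
Qed.

Let mehler_bound_corrE z : mehler_bound s (correlate s z) =
  (Num.sqrt (1 - s ^+ 2))^-1 *
  quad2 (- (s / 2 * (1 + s))) (- (s / 2 * Num.sqrt (1 - s ^+ 2)))
    (- (s / 2 * (1 - s))) z.
Proof.
rewrite /mehler_bound /quad2 /correlate/=; congr (_ * expR _).
set r := Num.sqrt _.
have -> : (z.1 + (s * z.1 + r * z.2)) ^+ 2 = (1 + s) ^+ 2 * z.1 ^+ 2 +
    2 * (1 + s) * r * (z.1 * z.2) + (1 - s ^+ 2) * z.2 ^+ 2.
  by rewrite -rr -/r; ring.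
by field.
Qed.

Let det1 : (1 + s ^+ 2 / (1 - s ^+ 2)) * (1 + s ^+ 2 / (1 - s ^+ 2)) -
  (- (s / (1 - s ^+ 2))) ^+ 2 = (1 - s ^+ 2)^-1.
Proof. by field. Qed.

Let c_gt x : 0 <= x -> -1 < x / (1 - s ^+ 2).
Proof.
by move=> x0; apply: lt_le_trans (divr_ge0 x0 (ltW r2_gt0)); rewrite oppr_lt0.
Qed.

Let det2 : (1 + 2 * s ^+ 2 / (1 - s ^+ 2)) * (1 + 2 * s ^+ 2 / (1 - s ^+ 2)) -
  (- (2 * s / (1 - s ^+ 2))) ^+ 2 = 1.
Proof. by field. Qed.

Let h2c : -1 < 2 * s ^+ 2 / (1 - s ^+ 2).
Proof. by apply: c_gt; rewrite mulr_ge0// sqr_ge0. Qed.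

Let h2d : (- (2 * s / (1 - s ^+ 2))) ^+ 2 <
  (1 + 2 * s ^+ 2 / (1 - s ^+ 2)) * (1 + 2 * s ^+ 2 / (1 - s ^+ 2)).
Proof. by rewrite -subr_gt0 det2. Qed.

Lemma L1_mehler_sqr : L1 (gamma \x gamma)%E (fun z => mehler s z ^+ 2).
Proof. by rewrite (funext mehler_sqrE); exact/L1Z/L1_quad2. Qed.

Lemma Rintegral_mehler_sqr :
  \int[(gamma \x gamma)%E]_z (mehler s z ^+ 2) = (1 - s ^+ 2)^-1.
Proof.
under eq_Rintegral do rewrite mehler_sqrE.
rewrite (RintegralZl _ measurableT (L1_quad2 h2c h2d)) Rintegral_quad2// det2.
by rewrite sqrtr1 invr1 mulr1.
Qed.

Let det3 : (1 + - s ^+ 2) * (1 + s ^+ 2) -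
  (- (Num.sqrt (1 - s ^+ 2) * s)) ^+ 2 = 1 - s ^+ 2.
Proof. by rewrite sqrrN exprMn rr; ring. Qed.

Let h3c : -1 < s ^+ 2.
Proof. by apply: lt_le_trans (sqr_ge0 _); rewrite oppr_lt0. Qed.

Let h3d : (- (Num.sqrt (1 - s ^+ 2) * s)) ^+ 2 < (1 + - s ^+ 2) * (1 + s ^+ 2).
Proof. by rewrite -subr_gt0 det3. Qed.

Lemma L1_mehler_correlate :
  L1 (gamma \x gamma)%E (fun z => mehler s (correlate s z)).
Proof. by rewrite (funext mehler_corrE); exact/L1Z/L1_quad2. Qed.

(** The value agrees with that of [Rintegral_mehler_sqr], as it must for a density integrated
    against its own law. This coincidence cancels the main terms of the mean square distance between
    [D_N] and [psi]. *)
Lemma Rintegral_mehler_correlate :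
  \int[(gamma \x gamma)%E]_z mehler s (correlate s z) = (1 - s ^+ 2)^-1.
Proof.
under eq_Rintegral do rewrite mehler_corrE.
rewrite (RintegralZl _ measurableT (L1_quad2 h3c h3d)) Rintegral_quad2// det3.
by rewrite -expr2 exprVn rr.
Qed.

(** With l = s / (1 + s) the determinant is 1 - 2 l = (1 - s) / (1 + s), positive because [s] <
    1. *)
Lemma L1_mehler_bound_sqr :
  L1 (gamma \x gamma)%E (fun z => mehler_bound s z ^+ 2).
Proof.
have h0 := s0; have h1 := s1.
have lam : s / (1 + s) < 2^-1.
  by rewrite ltr_pdivrMr; [lra|rewrite ltr_wpDr].
rewrite (funext mehler_bound_sqrE); apply/L1Z/L1_quad2; first by lra.
set l := s / (1 + s) in lam *; rewrite -subr_gt0.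
by have -> : (1 + - l) * (1 + - l) - (- l) ^+ 2 = 1 - 2 * l; [ring|lra].
Qed.

(** Here the determinant is 1 - s. *)
Lemma L1_mehler_bound_correlate :
  L1 (gamma \x gamma)%E (fun z => mehler_bound s (correlate s z)).
Proof.
have h0 := s0; have h1 := s1.
rewrite (funext mehler_bound_corrE); apply/L1Z/L1_quad2; first by nra.
rewrite -subr_gt0 sqrrN exprMn rr.
have -> : (1 + - (s / 2 * (1 + s))) * (1 + - (s / 2 * (1 - s))) -
  (s / 2) ^+ 2 * (1 - s ^+ 2) = 1 - s by field.
by rewrite subr_gt0.
Qed.

End mehler.

(** * Convergence of characteristic functions *)

Section trigonometric_bounds.
Context {R : realType}.
Implicit Types x y t : R.

Let within_sin (a b : R) : {within `[a, b], continuous (@sin R)}.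
Proof. by apply: continuous_subspaceT; exact: continuous_sin. Qed.

Let odd_bound (f g : R -> R) : (forall x, f (- x) = - f x) ->
  (forall x, g (- x) = g x) -> (forall x, 0 <= x -> `|f x| <= g x) ->
  forall x, `|f x| <= g x.
Proof.
move=> fN gN h x; have [x0|x0] := leP 0 x; first exact: h.
by rewrite -normrN -fN -gN h// oppr_ge0 ltW.
Qed.

Lemma normr_sin_le x : `|sin x| <= `|x|.
Proof.
move: x; apply: odd_bound => [x|x|x x0]; [exact: sinN|exact: normrN|].
have [c _] := MVT_segment x0 (fun y _ => is_derive_sin y) (@within_sin 0 x).
rewrite sin0 !subr0 => ->; rewrite normrM ler_piMl//; exact: cos_max.
Qed.

Lemma cos_sub1 x : cos x - 1 = - (2 * sin (x / 2) ^+ 2).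
Proof.
have -> : cos x = cos (x / 2 + x / 2) by congr cos; field.
by rewrite cosD; have := cos2Dsin2 (x / 2); lra.
Qed.

Lemma normr_cos_sub1 x : `|cos x - 1| <= x ^+ 2 / 2.
Proof.
rewrite cos_sub1 normrN ger0_norm; last by rewrite mulr_ge0// sqr_ge0.
have : sin (x / 2) ^+ 2 <= (x / 2) ^+ 2.
  rewrite -(real_normK (num_real (sin _))) -(real_normK (num_real (x / 2))).
  by rewrite lerXn2r ?nnegrE// normr_sin_le.
have -> : (x / 2) ^+ 2 = x ^+ 2 / 4 by field.
by lra.
Qed.

Lemma normr_sin_subid x : `|sin x - x| <= `|x| ^+ 3.
Proof.
move: x; apply: odd_bound => [x|x|x x0]; [by rewrite sinN opprB addrC opprK| |].
  by rewrite normrN.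
pose f y : R := sin y - y.
have df y : is_derive y (1 : R) f (cos y - 1).
  exact: (is_deriveB (is_derive_sin y) (is_derive_id y (1 : R))).
have cf : {within `[0, x], continuous f}.
  apply: continuous_subspaceT => y; apply: differentiable_continuous.
  by apply/derivable1_diffP; exact: ex_derive.
have [c] := MVT_segment x0 (fun y _ => df y) cf.
rewrite in_itv/= /f sin0 !subr0 => /andP[c0 cx] ->.
rewrite normrM (ger0_norm x0) exprSr ler_wpM2r//.
apply: (le_trans (normr_cos_sub1 c)).
have : c ^+ 2 <= x ^+ 2 by rewrite lerXn2r ?nnegrE.
by have := sqr_ge0 c; lra.
Qed.

(** The cubic bound serves for pointwise limits; this quadratic one holds for all [x] as well and
    dominates with two moments only. For |x| > 1 it is the trivial bound 2 |x| <= 2 x^2. *)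
Lemma normr_sin_subid_sqr x : `|sin x - x| <= 2 * x ^+ 2.
Proof.
have x2 := real_normK (num_real x).
have [x1|x1] := leP `|x| 1.
  apply: (le_trans (normr_sin_subid x)); rewrite exprSr x2.
  by have := sqr_ge0 x; have := normr_ge0 x; nra.
apply: (@le_trans _ _ (`|x| + `|x|)).
  by apply: (le_trans (ler_normB _ _)); rewrite lerD2r normr_sin_le.
by rewrite -x2; nra.
Qed.

(** [rsqrt 0] is 0 by the conventions on inverses, so [rsqrtK_le] holds for every [n] while [rsqrtK]
    requires [n] to be positive. *)
Definition rsqrt (n : nat) : R := (Num.sqrt n%:R)^-1.

Lemma rsqrt_ge0 n : 0 <= rsqrt n.
Proof. by rewrite invr_ge0 sqrtr_ge0. Qed.

Lemma rsqrtK n : (0 < n)%N -> n%:R * rsqrt n ^+ 2 = 1.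
Proof.
move=> n0; rewrite exprVn sqr_sqrtr ?ler0n// mulfV// pnatr_eq0.
by rewrite -lt0n.
Qed.

Lemma rsqrtK_le n x : n%:R * (x * rsqrt n) ^+ 2 <= x ^+ 2.
Proof.
case: n => [|n]; first by rewrite mul0r sqr_ge0.
by rewrite exprMn mulrCA rsqrtK// mulr1.
Qed.

Lemma cvg_rsqrt : rsqrt n @[n --> \oo] --> (0 : R).
Proof.
have h : `|rsqrt n| ^+ 2 @[n --> \oo] --> (0 : R).
  apply/cvgr0Pnorm_lt => e e0; near=> n.
  have n0 : (0 < n)%N by near: n; exact: nbhs_infty_gt.
  rewrite real_normK ?num_real// ger0_norm ?sqr_ge0//.
  rewrite -(@ltr_pM2l _ n%:R) ?ltr0n// rsqrtK//.
  rewrite mulrC -ltr_pdivrMl// mulr1.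
  by near: n; exact: nbhs_infty_gtr.
apply/cvgr0Pnorm_lt => e e0.
have e2 : 0 < e ^+ 2 by rewrite exprn_gt0.
move/cvgr0Pnorm_lt : h => /(_ _ e2); apply: filterS => n.
rewrite normrX normr_id => h; rewrite ltNge; apply/negP => h'.
by move: h; apply/negP; rewrite -leNgt lerXn2r// nnegrE// ltW.
Unshelve. all: by end_near. Qed.

Lemma cvg_scaled_sin x : n%:R * sin (x * rsqrt n) ^+ 2 @[n --> \oo] --> x ^+ 2.
Proof.
pose u (n : nat) := Num.sqrt n%:R * sin (x * rsqrt n).
have h : u n @[n --> \oo] --> x.
  apply/subr_cvg0; apply/norm_cvg0P.
  apply: (@squeeze_cvgr _ _ _ _ (fun=> 0) (fun n => `|x| ^+ 3 * rsqrt n ^+ 2)).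
  - near=> n; rewrite normr_ge0/=.
    have n0 : (0 < n)%N by near: n; exact: nbhs_infty_gt.
    have sn : 0 < Num.sqrt n%:R :> R by rewrite sqrtr_gt0 ltr0n.
    have -> : u n - x = Num.sqrt n%:R * (sin (x * rsqrt n) - x * rsqrt n).
      by rewrite /u mulrBr mulrCA mulfV ?gt_eqF// mulr1.
    rewrite normrM (ger0_norm (ltW sn)).
    apply: (le_trans (ler_wpM2l (ltW sn) (normr_sin_subid _))).
    rewrite normrM (ger0_norm (rsqrt_ge0 n)) exprMn mulrCA ler_wpM2l ?exprn_ge0//.
    by rewrite exprS mulrA mulfV ?gt_eqF// mul1r.
  - exact: cvg_cst.
  - rewrite -[X in _ --> X](mulr0 (`|x| ^+ 3)); apply: cvgMr.
    rewrite -[X in _ --> X](mulr0 (0 : R)); under eq_fun do rewrite expr2.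
    by apply: cvgM; exact: cvg_rsqrt.
rewrite (_ : (fun n => _) = (fun n => u n * u n)).
  by rewrite expr2; exact: cvgM.
apply/funext => n; rewrite -expr2 /u exprMn sqr_sqrtr//.
Unshelve. all: by end_near. Qed.

Lemma cvg_scaled_cos x :
  n%:R * (cos (x * rsqrt n) - 1) @[n --> \oo] --> - (x ^+ 2 / 2).
Proof.
have -> : (fun n => n%:R * (cos (x * rsqrt n) - 1)) =
    (fun n => -2 * (n%:R * sin (x / 2 * rsqrt n) ^+ 2)).
  by apply/funext => n; rewrite cos_sub1 (mulrAC x); ring.
have -> : - (x ^+ 2 / 2) = -2 * ((x / 2) ^+ 2) by field.
by apply: cvgMr; exact: cvg_scaled_sin.
Qed.

Lemma cvg_scaled_sin_subid x :
  n%:R * (sin (x * rsqrt n) - x * rsqrt n) @[n --> \oo] --> (0 : R).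
Proof.
apply/norm_cvg0P.
apply: (@squeeze_cvgr _ _ _ _ (fun=> 0) (fun n => `|x| ^+ 3 * rsqrt n)).
- near=> n; rewrite normr_ge0/= normrM (ger0_norm (ler0n _ _)).
  have n0 : (0 < n)%N by near: n; exact: nbhs_infty_gt.
  apply: (le_trans (ler_wpM2l (ler0n _ _) (normr_sin_subid _))).
  rewrite normrM (ger0_norm (rsqrt_ge0 n)) exprMn mulrCA ler_wpM2l ?exprn_ge0//.
  by rewrite exprSr mulrA rsqrtK// mul1r.
- exact: cvg_cst.
- rewrite -[X in _ --> X](mulr0 (`|x| ^+ 3)); apply: cvgMr.
  exact: cvg_rsqrt.
Unshelve. all: by end_near. Qed.

(** Applying 1 + x <= exp x to u and to - u / (1 + u) squeezes (1 + u)^n between exp (n u / (1 + u))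
    and exp (n u) once 1 + u > 0. *)
Lemma cvg_exprn1D (u : nat -> R) x : n%:R * u n @[n --> \oo] --> x ->
  (1 + u n) ^+ n @[n --> \oo] --> expR x.
Proof.
move=> ux.
have u0 : u n @[n --> \oo] --> (0 : R).
  have h : n%:R * u n * rsqrt n ^+ 2 @[n --> \oo] --> (0 : R).
    rewrite -[X in _ --> X](mulr0 x); apply: cvgM => //.
    rewrite -[X in _ --> X](mulr0 (0 : R)); under eq_fun do rewrite expr2.
    by apply: cvgM; exact: cvg_rsqrt.
  apply: cvg_trans h; apply: near_eq_cvg; near=> n.
  by rewrite mulrAC rsqrtK ?mul1r//; near: n; exact: nbhs_infty_gt.
have v1 : n%:R * u n / (1 + u n) @[n --> \oo] --> x.
  rewrite -[X in _ --> X]divr1; apply: cvgM => //; apply: cvgV; first exact: oner_neq0.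
  by rewrite -[X in _ --> X]addr0; apply: cvgD => //; exact: cvg_cst.
apply: (@squeeze_cvgr _ _ _ _ (fun n => expR (n%:R * u n / (1 + u n)))
  (fun n => expR (n%:R * u n))).
- near=> n.
  have pos : 0 < 1 + u n.
    have : `|u n| < 1 by near: n; move/cvgr0Pnorm_lt : u0 => /(_ 1 ltr01).
    by rewrite ltr_norml => /andP[h _]; lra.
  have -> : n%:R * u n / (1 + u n) = u n / (1 + u n) * n%:R by ring.
  rewrite (mulrC n%:R) !expRM_natr; apply/andP; split; last first.
    by apply: lerXn2r; rewrite ?nnegrE ?expR_ge0 ?(ltW pos) ?expR_ge1Dx.
  apply: lerXn2r; rewrite ?nnegrE ?expR_ge0 ?(ltW pos)//.
  have := @expR_ge1Dx _ (- (u n / (1 + u n))).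
  have -> : 1 - u n / (1 + u n) = (1 + u n)^-1.
    by field; rewrite gt_eqF.
  by rewrite expRN lef_pV2 ?posrE ?expR_gt0.
- by apply: (@cvg_comp _ _ _ _ expR _ _ _ v1); exact: continuous_expR.
- by apply: (@cvg_comp _ _ _ _ expR _ _ _ ux); exact: continuous_expR.
Unshelve. all: by end_near. Qed.

End trigonometric_bounds.

Lemma cvg_Rintegral {d : measure_display} {T : measurableType d} {R : realType}
  (mu : {measure set T -> \bar R}) (f_ : nat -> T -> R) (f g : T -> R) :
  (forall n, measurable_fun setT (f_ n)) -> measurable_fun setT f ->
  (\forall x \ae mu, f_ ^~ x n @[n --> \oo] --> f x) -> L1 mu g ->
  (forall n x, `|f_ n x| <= g x) ->
  \int[mu]_x f_ n x @[n --> \oo] --> \int[mu]_x f x.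
Proof. by move=> h1 h2 h3 h4 h5; exact: (Rintegral_dct h1 h2 h3 h4 h5).2. Qed.

Section rotation_limit.
Context {R : realType} {d : measure_display} {T : measurableType d}.
Variable nu : probability T R.
Variables g z : T -> R.
Hypotheses (Lg : L1 nu g) (mz : measurable_fun setT z)
  (Lgz2 : L1 nu (fun t => g t * z t ^+ 2)).
Hypotheses (g1 : \int[nu]_t g t = 1) (norm_g1 : \int[nu]_t `|g t| = 1)
  (gz0 : \int[nu]_t (g t * z t) = 0)
  (v_ge0 : 0 <= \int[nu]_t (g t * z t ^+ 2)).

Let v := \int[nu]_t (g t * z t ^+ 2).
Let mg := L1_measurable Lg.

Let Lgz2n : L1 nu (fun t => `|g t| * z t ^+ 2).
Proof.
have := L1_norm Lgz2; under eq_fun do rewrite normrM (ger0_norm (sqr_ge0 _)).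
exact.
Qed.

Let Lgz : L1 nu (fun t => g t * z t).
Proof.
apply: (@L1_le _ _ _ nu _ (fun t => `|g t| + `|g t| * z t ^+ 2)).
- exact: measurable_funM.
- move=> t; rewrite normrM -[X in X + _]mulr1 -mulrDr ler_wpM2l//.
  by rewrite ler_norml; apply/andP; split; nra.
- by apply: L1D => //; exact: L1_norm.
Qed.

Let mzr n : measurable_fun setT (fun t => z t * rsqrt n).
Proof. exact: measurable_funM. Qed.

Let c n := \int[nu]_t (g t * cos (z t * rsqrt n)).
Let s n := \int[nu]_t (g t * sin (z t * rsqrt n)).

Let mcos n : measurable_fun setT (fun t => cos (z t * rsqrt n)).
Proof. exact: measurableT_comp (@measurable_cos R) (mzr n). Qed.

Let msin n : measurable_fun setT (fun t => sin (z t * rsqrt n)).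
Proof. exact: measurableT_comp (@measurable_sin R) (mzr n). Qed.

Let Lc n : L1 nu (fun t => g t * cos (z t * rsqrt n)).
Proof. by apply: (L1_bmul (M := 1)) => // t; exact: cos_max. Qed.

Let Ls n : L1 nu (fun t => g t * sin (z t * rsqrt n)).
Proof. by apply: (L1_bmul (M := 1)) => // t; exact: sin_max. Qed.

Let cvg_c : n%:R * (c n - 1) @[n --> \oo] --> - (v / 2).
Proof.
have E n : n%:R * (c n - 1) =
    \int[nu]_t (g t * (n%:R * (cos (z t * rsqrt n) - 1))).
  rewrite -[X in c n - X]g1 -RintegralB// -RintegralZl//; last exact: L1B.
  by apply: eq_Rintegral => t _; ring.
rewrite (funext E).
have -> : - (v / 2) = \int[nu]_t (g t * (- (z t ^+ 2 / 2))).
  rewrite /v (mulrC _ 2^-1) -mulNr -RintegralZl//.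
  by apply: eq_Rintegral => t _; ring.
apply: (@cvg_Rintegral _ _ _ nu
    (fun n t => g t * (n%:R * (cos (z t * rsqrt n) - 1)))
    (fun t => g t * (- (z t ^+ 2 / 2)))
    (fun t => 2^-1 * (`|g t| * z t ^+ 2))).
- move=> n; apply: measurable_funM => //; apply: measurable_funM => //.
  exact: measurable_funB.
- apply: measurable_funM => //; apply: measurableT_comp => //.
  by apply: measurable_funM => //; exact: measurable_funX.
- by apply: aeW => t; apply: cvgMr; exact: cvg_scaled_cos.
- exact: L1Z.
- move=> n t; rewrite normrM mulrCA ler_wpM2l// normrM (ger0_norm (ler0n _ _)).
  apply: (le_trans (ler_wpM2l (ler0n _ _) (normr_cos_sub1 _))).
  by have := rsqrtK_le n (z t); lra.
Qed.

Let cvg_s : n%:R * s n @[n --> \oo] --> (0 : R).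
Proof.
have E n : n%:R * s n =
    \int[nu]_t (g t * (n%:R * (sin (z t * rsqrt n) - z t * rsqrt n))).
  have Lr : L1 nu (fun t => rsqrt n * (g t * z t)) by exact: L1Z.
  have r0 : \int[nu]_t (rsqrt n * (g t * z t)) = 0 :> R.
    by rewrite RintegralZl// gz0 mulr0.
  rewrite -[s n]subr0 -r0 -RintegralB// -RintegralZl//; last exact: L1B.
  by apply: eq_Rintegral => t _; ring.
rewrite (funext E).
have -> : (0 : R) = \int[nu]_t (g t * 0).
  by under eq_Rintegral do rewrite mulr0; rewrite Rintegral_cst1.
apply: (@cvg_Rintegral _ _ _ nu
    (fun n t => g t * (n%:R * (sin (z t * rsqrt n) - z t * rsqrt n)))
    (fun t => g t * 0) (fun t => 2 * (`|g t| * z t ^+ 2))).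
- move=> n; apply: measurable_funM => //; apply: measurable_funM => //.
  exact: measurable_funB.
- exact: measurable_funM.
- by apply: aeW => t; apply: cvgMr; exact: cvg_scaled_sin_subid.
- exact: L1Z.
- move=> n t; rewrite normrM mulrCA ler_wpM2l// normrM (ger0_norm (ler0n _ _)).
  apply: (le_trans (ler_wpM2l (ler0n _ _) (normr_sin_subid_sqr _))).
  by have := rsqrtK_le n (z t); lra.
Qed.

Let w (n : nat) := expR (- (v / 2) / n%:R).

Let cvg_w : n%:R * (w n - 1) @[n --> \oo] --> - (v / 2).
Proof.
set y := - (v / 2); have y0 : y <= 0 by rewrite oppr_le0 divr_ge0.
(* Both bounds come from 1 + x <= exp x, at y / n and at - y / n; since y <= 0 the denominator is
   positive. *)
apply: (@squeeze_cvgr _ _ _ _ (fun=> y) (fun n => y / (1 - y / n%:R))).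
- near=> n; have n0 : 0 < n%:R :> R.
    by rewrite ltr0n; near: n; exact: nbhs_infty_gt.
  have n0' : n%:R != 0 :> R by rewrite gt_eqF.
  have h0 : 0 < 1 - y / n%:R.
    by rewrite subr_gt0 (le_lt_trans _ ltr01)// pmulr_lle0 ?invr_gt0.
  apply/andP; split.
    have := @expR_ge1Dx _ (y / n%:R); rewrite -/(w n) => h.
    have -> : y = n%:R * (y / n%:R) by field.
    by rewrite ler_wpM2l ?ler0n//; lra.
  have h := @expR_ge1Dx _ (- (y / n%:R)).
  have -> : y / (1 - y / n%:R) = n%:R * ((1 - y / n%:R)^-1 - 1).
    have : 1 - y / n%:R != 0 by rewrite gt_eqF.
    set q := 1 - y / n%:R => q0.
    have -> : y = n%:R * (1 - q) by rewrite /q; field.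
    by field.
  rewrite ler_wpM2l ?ler0n// lerD2r /w -/y.
  rewrite -[leLHS]invrK lef_pV2 ?posrE ?invr_gt0 ?expR_gt0//.
  by rewrite -expRN.
- exact: cvg_cst.
- rewrite -[X in _ --> X]divr1; apply: cvgMr; apply: cvgV.
    exact: oner_neq0.
  rewrite -[X in _ --> X]subr0; apply: cvgB; first exact: cvg_cst.
  rewrite -[X in _ --> X](mulr0 y); apply: cvgMr.
  have -> : (fun n => n%:R^-1) = (fun n => rsqrt n * rsqrt n) :> (nat -> R).
    by apply/funext => n; rewrite -expr2 exprVn sqr_sqrtr.
  by rewrite -[X in _ --> X](mulr0 (0 : R)); apply: cvgM; exact: cvg_rsqrt.
Unshelve. all: by end_near. Qed.

Lemma rotate_nseq_norm th (a b : R) n :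
  (rotate th (nseq n (a, b))).1 ^+ 2 + (rotate th (nseq n (a, b))).2 ^+ 2 =
  (a ^+ 2 + b ^+ 2) ^+ n.
Proof.
elim: n => [|n IH]; first by rewrite /= cos2Dsin2.
by rewrite [in RHS]exprS -IH /=; ring.
Qed.

(** The modulus of an integral is at most the integral of the modulus: q = c^2 + s^2 is the integral
    of g (c cos + s sin), hence at most sqrt q times the integral of |g|, which is 1; and q <= sqrt
    q forces q <= 1. *)
Let cs1 n : c n ^+ 2 + s n ^+ 2 <= 1.
Proof.
set q := _ + _; have q0 : 0 <= q by rewrite addr_ge0// sqr_ge0.
pose r := Num.sqrt q; have r0 : 0 <= r by rewrite sqrtr_ge0.
have r2 : r ^+ 2 = q by rewrite sqr_sqrtr.
suff : q <= r by rewrite -r2 => h; have := r0; nra.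
have E : q = \int[nu]_t (c n * (g t * cos (z t * rsqrt n)) +
    s n * (g t * sin (z t * rsqrt n))).
  rewrite RintegralD//; [|exact: L1Z|exact: L1Z].
  by rewrite !RintegralZl.
have -> : r = \int[nu]_t (r * `|g t|).
  by rewrite RintegralZl ?norm_g1 ?mulr1//; exact: L1_norm.
rewrite E; apply: le_Rintegral => //.
- by apply: L1D; exact: L1Z.
- by apply: L1Z; exact: L1_norm.
move=> t _; set C := cos _; set S := sin _.
have -> : c n * (g t * C) + s n * (g t * S) = (c n * C + s n * S) * g t by ring.
apply: (le_trans (ler_norm _)); rewrite normrM ler_wpM2r//.
rewrite -[leLHS]sqrtr_sqr ler_wsqrtr//.
have CS : C ^+ 2 + S ^+ 2 = 1 by exact: cos2Dsin2.
have -> : q = q * (C ^+ 2 + S ^+ 2) by rewrite CS mulr1.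
rewrite /q -subr_ge0.
have -> : (c n ^+ 2 + s n ^+ 2) * (C ^+ 2 + S ^+ 2) -
  (c n * C + s n * S) ^+ 2 = (c n * S - s n * C) ^+ 2 by ring.
exact: sqr_ge0.
Qed.

(** Central limit theorem for characteristic functions under the weight [g]. The complex number c n
    + i s n is compared with w n = exp (- v / (2 n)), whose n-th power is the limit exactly; n |c n
    - w n| and n |s n| tend to 0 and [rotate_nseq_near] concludes. *)
Lemma cvg_rotate th :
  (rotate th (nseq n (\int[nu]_t (g t * cos (z t * rsqrt n)),
    \int[nu]_t (g t * sin (z t * rsqrt n))))).1 @[n --> \oo] -->
  expR (- (\int[nu]_t (g t * z t ^+ 2) / 2)) * cos th.
Proof.
rewrite -/v.
have bnd n m : `|(rotate th (nseq m (c n, s n))).1| <= 1 /\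
    `|(rotate th (nseq m (c n, s n))).2| <= 1.
  have := rotate_nseq_norm th (c n) (s n) m.
  set A := (rotate _ _).1; set B := (rotate _ _).2.
  have : (c n ^+ 2 + s n ^+ 2) ^+ m <= 1.
    by rewrite exprn_ile1// addr_ge0// sqr_ge0.
  move=> h E; have A2 := sqr_ge0 A; have B2 := sqr_ge0 B.
  by split; rewrite -(@expr_le1 _ 2)// real_normK ?num_real//; lra.
have lim0 : 2 * (`|n%:R * (c n - 1) - n%:R * (w n - 1)| + `|n%:R * s n|)
    @[n --> \oo] --> (0 : R).
  rewrite -[X in _ --> X](mulr0 (2 : R)); apply: cvgMr.
  rewrite -[X in _ --> X](addr0 (0 : R)); apply: cvgD.
    apply/norm_cvg0P; rewrite -[X in _ --> X](subrr (- (v / 2))).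
    exact: cvgB.
  exact/norm_cvg0P.
apply/subr_cvg0; apply/norm_cvg0P.
apply: (@squeeze_cvgr _ _ _ _ (fun=> 0)); last exact: lim0.
- near=> n; rewrite normr_ge0/=.
  have n0 : 0 < n%:R :> R by rewrite ltr0n; near: n; exact: nbhs_infty_gt.
  have -> : expR (- (v / 2)) = w n ^+ n.
    by rewrite /w -expRM_natr divfK// gt_eqF.
  apply: (@le_trans _ _ (2 * n%:R * (`|c n - w n| + `|s n|))).
    have w01 : 0 <= w n <= 1.
      by rewrite expR_ge0/= expR_le1 mulNr oppr_le0 !divr_ge0// ltW.
    have := rotate_nseq_near n w01 (fun m => (bnd n m).1) (fun m => (bnd n m).2).
    by apply: le_trans; rewrite lerDl.
  rewrite -mulrA ler_wpM2l// mulrDr normrM (ger0_norm (ltW n0)) lerD2r.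
  by rewrite -mulrBr opprB addrA subrK normrM (ger0_norm (ltW n0)).
- exact: cvg_cst.
Unshelve. all: by end_near. Qed.

End rotation_limit.

(** * Spectral expansion of the density *)

Section square_integrable.
Context {d : measure_display} {T : measurableType d} {R : realType}.
Variable mu : {measure set T -> \bar R}.
Implicit Types f g : T -> R.

Lemma Lfun2P f :
  f \in Lfun mu 2%:E <-> measurable_fun setT f /\ L1 mu (fun x => f x ^+ 2).
Proof.
split=> [Lf|[mf Lf]].
  split; last exact: Lfun2_integrable_sqr.
  by move: Lf; rewrite inE => /andP[]; rewrite inE.
rewrite inE; apply/andP; split; rewrite inE//=.
rewrite /finite_norm; apply: (@lty_poweRy _ _ 2) => //.
rewrite poweR_Lnorm//; have /integrableP[_] := Lf; congr (_ < _)%E.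
apply: eq_integral => x _ /=.
by rewrite ger0_norm ?sqr_ge0// powR_mulrn// real_normK ?num_real.
Qed.

Lemma cvg_Rintegral_Lnorm2 (f_ : nat -> T -> R) g :
  (forall n, measurable_fun setT (f_ n)) ->
  (forall n, L1 mu (fun x => f_ n x ^+ 2)) ->
  g \in Lfun mu 2%:E ->
  Lnorm mu 2%:E (fun x => (f_ n x)%:E) @[n --> \oo] --> 0%E ->
  \int[mu]_x (f_ n x * g x) @[n --> \oo] --> (0 : R).
Proof.
move=> mf Lf Lg lim; have /Lfun2P[mg Lg2] := Lg.
have Lfg n : L1 mu (fun x => f_ n x * g x) by exact: L1_mul_sqr.
have Ngfin : ('N[mu]_2%:E[EFin \o g])%E \is a fin_num.
  rewrite ge0_fin_numE ?Lnorm_ge0//.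
  by move: Lg; rewrite inE => /andP[_]; rewrite inE.
have bnd n : (`|\int[mu]_x (f_ n x * g x)|%:E <=
    'N[mu]_2%:E[EFin \o f_ n] * 'N[mu]_2%:E[EFin \o g])%E.
  apply: le_trans (@hoelder _ _ _ mu _ _ 2 2 (mf n) mg _ _ _) => //; last first.
    by rewrite [RHS]splitr !div1r.
  rewrite EFin_normr_Rintegral// Lnorm1.
  by apply: le_abse_integral => //; exact/measurable_EFinP/(L1_measurable (Lfg n)).
have lim2 : ('N[mu]_2%:E[EFin \o f_ n] * 'N[mu]_2%:E[EFin \o g])%E
    @[n --> \oo] --> 0%E.
  by rewrite -(mul0e ('N[mu]_2%:E[EFin \o g])%E); exact: cvgeZr.
apply/norm_cvg0P.
have : (`|\int[mu]_x (f_ n x * g x)|%:E)%E @[n --> \oo] --> 0%E.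
  apply: (@squeeze_cvge _ _ _ _ (fun=> 0%E) _ _ _ _ _ lim2).
  - by apply: nearW => n; rewrite lee_fin normr_ge0/=.
  - exact: cvg_cst.
by move=> /fine_cvg.
Qed.

End square_integrable.

(** * Fubini's theorem for real-valued integrals *)

Section fubini_real.
Context {d1 d2 : measure_display} {T1 : measurableType d1}
  {T2 : measurableType d2} {R : realType}.
Variables (P : probability T1 R) (Q : probability T2 R).
Local Notation nu := (P \x Q)%E.
Implicit Types F : T1 * T2 -> R.

Lemma L1_fubini1 F : L1 nu F -> L1 P (fun x => \int[Q]_y F (x, y)).
Proof.
move=> LF; have LE := integrable_fubini_F LF.
apply/integrableP; split.
  apply/measurable_EFinP; apply: (measurableT_comp (f := fine)) => //.
  exact: (measurable_int P).
have /integrableP[mE] := LE; apply: le_lt_trans.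
apply: ge0_le_integral => //.
- apply: measurableT_comp => //; apply/measurable_EFinP.
  by apply: (measurableT_comp (f := fine)).
- exact: measurableT_comp.
- move=> x _; rewrite /= /Rintegral /fubini_F.
  (* Where the inner integral is infinite its real value is 0, so the comparison with the extended
     integral holds at every point. *)
  by case: (\int[Q]_y _)%E => [r| |]//=; rewrite normr0 leey.
Qed.

Lemma Rfubini1 F : L1 nu F ->
  \int[P]_x \int[Q]_y F (x, y) = \int[nu]_z F z.
Proof.
move=> LF; have LE := integrable_fubini_F LF.
congr fine; rewrite -(integral12_prod_meas1 LF).
apply: ae_eq_integral => //.
- by have /integrableP[] := L1_fubini1 LF.
- exact: (measurable_int P).
- have := ae_integrable1 LF; apply: filterS => x h _.
  exact: EFin_Rintegral h.
Qed.

Lemma ae_L1_fubini1 F : L1 nu F -> {ae P, forall x, L1 Q (fun y => F (x, y))}.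
Proof. by move=> LF; have := ae_integrable1 LF. Qed.

Lemma L1_tensor (f : T1 -> R) (g : T2 -> R) : L1 P f -> L1 Q g ->
  L1 nu (fun z => f z.1 * g z.2).
Proof.
move=> Lf Lg; have mf := L1_measurable Lf; have mg := L1_measurable Lg.
have mF : measurable_fun setT (fun z : T1 * T2 => (f z.1 * g z.2)).
  apply: measurable_funM.
    exact: (measurableT_comp mf measurable_fst).
  exact: (measurableT_comp mg measurable_snd).
apply/(integrable12ltyP P Q); first exact/measurable_EFinP.
have E x : (\int[Q]_y `|(f x * g y)%:E| = (`|f x| * \int[Q]_y `|g y|)%:E)%E.
  rewrite EFinM EFin_Rintegral; last exact: L1_norm.
  rewrite -ge0_integralZl//.
  - by apply: eq_integral => y _; rewrite /= normrM EFinM.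
  - by apply/measurable_EFinP; exact: measurableT_comp.
under eq_integral do rewrite /= E.
under eq_integral do rewrite EFinM muleC.
rewrite ge0_integralZl//.
- rewrite lte_mul_pinfty ?lee_fin//; first exact: Rintegral_ge0.
  by have /integrableP[] := Lf.
- by apply/measurable_EFinP; exact: measurableT_comp.
- by rewrite lee_fin Rintegral_ge0.
Qed.

Lemma Rintegral_tensor (f : T1 -> R) (g : T2 -> R) : L1 P f -> L1 Q g ->
  \int[nu]_z (f z.1 * g z.2) = (\int[P]_x f x) * (\int[Q]_y g y).
Proof.
move=> Lf Lg; rewrite -Rfubini1; last exact: L1_tensor.
rewrite -RintegralZr//; apply: eq_Rintegral => x _ /=.
by rewrite RintegralZl.
Qed.

End fubini_real.

Section swap.
Context {d1 d2 : measure_display} {T1 : measurableType d1}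
  {T2 : measurableType d2} {R : realType}.
Variables (P : probability T1 R) (Q : probability T2 R).
Implicit Types F : T1 * T2 -> R.

Let sw (z : T2 * T1) : T1 * T2 := (z.2, z.1).

Let msw : measurable_fun setT sw.
Proof. by apply: measurable_fun_pair. Qed.

Let law_sw B : measurable B -> (Q \x P)%E (sw @^-1` B) = (P \x Q)%E B.
Proof.
move=> mB; apply/esym.
have /= := @product_measure_unique _ _ _ _ _ P Q (pushforward (Q \x P)%E sw).
apply => // A1 A2 mA1 mA2; rewrite /pushforward.
have -> : sw @^-1` (A1 `*` A2) = A2 `*` A1.
  by apply/seteqP; split => -[x y] [].
by rewrite product_measure1E// muleC.
Qed.

Lemma L1_swap F : L1 (P \x Q)%E F -> L1 (Q \x P)%E (fun z => F (z.2, z.1)).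
Proof. exact: (L1_law msw law_sw). Qed.

Lemma Rintegral_swap F : L1 (P \x Q)%E F ->
  \int[(Q \x P)%E]_z F (z.2, z.1) = \int[(P \x Q)%E]_z F z.
Proof. exact: (Rintegral_law msw law_sw). Qed.

Lemma L1_fubini2 F : L1 (P \x Q)%E F -> L1 Q (fun y => \int[P]_x F (x, y)).
Proof. by move=> /L1_swap /L1_fubini1. Qed.

Lemma Rfubini2 F : L1 (P \x Q)%E F ->
  \int[Q]_y \int[P]_x F (x, y) = \int[(P \x Q)%E]_z F z.
Proof.
by move=> LF; rewrite -Rintegral_swap// -Rfubini1//; exact: L1_swap LF.
Qed.

Lemma ae_L1_fubini2 F : L1 (P \x Q)%E F ->
  {ae Q, forall y, L1 P (fun x => F (x, y))}.
Proof. by move=> /L1_swap /ae_L1_fubini1. Qed.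

End swap.

Section cauchy_schwarz.
Context {d : measure_display} {T : measurableType d} {R : realType}.
Variable mu : {measure set T -> \bar R}.
Implicit Types f g : T -> R.

Lemma L1_le_ae f g : measurable_fun setT f -> {ae mu, forall x, `|f x| <= g x} ->
  L1 mu g -> L1 mu f.
Proof.
move=> mf fg Lg; have mg := L1_measurable Lg.
apply/integrableP; split; first exact/measurable_EFinP.
have /integrableP[_] := Lg; apply: le_lt_trans.
apply: ae_ge0_le_integral => //.
- by apply: measurableT_comp => //; exact/measurable_EFinP.
- by apply: measurableT_comp => //; exact/measurable_EFinP.
- by apply: filterS fg => x h _ /=; rewrite lee_fin (le_trans h)// ler_norm.
Qed.

Lemma Rintegral_cauchy_schwarz f g : measurable_fun setT f ->
  measurable_fun setT g ->
  L1 mu (fun x => f x ^+ 2) -> L1 mu (fun x => g x ^+ 2) ->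
  (\int[mu]_x (f x * g x)) ^+ 2 <=
  (\int[mu]_x (f x ^+ 2)) * (\int[mu]_x (g x ^+ 2)).
Proof.
move=> mf mg Lf Lg; have Lfg := L1_mul_sqr mf mg Lf Lg.
set A := \int[mu]_x (f x ^+ 2); set B := \int[mu]_x (g x ^+ 2).
set C := \int[mu]_x (f x * g x).
have H (p q : R) : 0 <= p ^+ 2 * A + 2 * p * q * C + q ^+ 2 * B.
  have E x : (p * f x + q * g x) ^+ 2 =
    p ^+ 2 * (f x ^+ 2) + 2 * p * q * (f x * g x) + q ^+ 2 * (g x ^+ 2) by ring.
  have -> : p ^+ 2 * A + 2 * p * q * C + q ^+ 2 * B =
      \int[mu]_x ((p * f x + q * g x) ^+ 2).
    under [RHS]eq_Rintegral do rewrite E.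
    rewrite RintegralD//; [|by apply: L1D; exact: L1Z|exact: L1Z].
    rewrite RintegralD//; [|exact: L1Z|exact: L1Z].
    by rewrite !RintegralZl.
  by apply: Rintegral_ge0 => x _; exact: sqr_ge0.
have A0 : 0 <= A by apply: Rintegral_ge0 => x _; exact: sqr_ge0.
have B0 : 0 <= B by apply: Rintegral_ge0 => x _; exact: sqr_ge0.
have [A1|A1] := eqVneq A 0.
  rewrite A1 mul0r; have [->|C0] := eqVneq C 0; first by rewrite expr0n.
  (* For A = 0 the form is affine in [p]; this choice gives it the value -1, which is absurd. *)
  have := H (- (B + 1) / (2 * C)) 1; rewrite A1 mulr0 add0r expr1n mul1r.
  have -> : 2 * (- (B + 1) / (2 * C)) * 1 * C = - (B + 1) by field.
  by lra.
have := H (- C) A; have Apos : 0 < A by rewrite lt_def A1.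
have -> : (- C) ^+ 2 * A + 2 * - C * A * C + A ^+ 2 * B =
  A * (A * B - C ^+ 2) by ring.
by rewrite pmulr_rge0// subr_ge0.
Qed.

End cauchy_schwarz.

(** * Weak convergence to 0 of a bounded sequence in L^2 *)

Section weak_convergence.
Context {d : measure_display} {T : measurableType d} {R : realType}.
Variables (mu : probability T R) (rho : nat -> T -> R) (C : R).
Hypothesis mrho : forall n, measurable_fun setT (rho n).
Hypothesis Lrho : forall n, L1 mu (fun x => rho n x ^+ 2).
Hypothesis rhoC : forall n, \int[mu]_x (rho n x ^+ 2) <= C.
Local Notation weak0 h := (\int[mu]_x (rho n x * h x) @[n --> \oo] --> (0 : R)).
Implicit Types f g h : T -> R.

(** By Cauchy-Schwarz and the bound [C] on the norms of [rho n], replacing [h] by [h_ m] costs an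
    error that is uniform in [n]. *)
Lemma weak0_closed (h_ : nat -> T -> R) h :
  (forall m, measurable_fun setT (h_ m)) ->
  (forall m, L1 mu (fun x => h_ m x ^+ 2)) ->
  measurable_fun setT h -> L1 mu (fun x => h x ^+ 2) ->
  \int[mu]_x ((h x - h_ m x) ^+ 2) @[m --> \oo] --> (0 : R) ->
  (forall m, weak0 (h_ m)) -> weak0 h.
Proof.
move=> mh_ Lh_ mh Lh hh_ w; apply/cvgrPdist_le => e e0.
have C0 : 0 <= C by apply: le_trans (rhoC 0); apply: Rintegral_ge0 => x _; exact: sqr_ge0.
have mB m : measurable_fun setT (fun x => h x - h_ m x) by exact: measurable_funB.
have LB m : L1 mu (fun x => (h x - h_ m x) ^+ 2).
  have E x : (h x - h_ m x) ^+ 2 = h x ^+ 2 - 2 * (h x * h_ m x) + h_ m x ^+ 2 by ring.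
  under eq_fun do rewrite E.
  by apply: L1D => //; apply: L1B => //; apply: L1Z; exact: L1_mul_sqr.
have e1 : 0 < (e / 2) ^+ 2 / (C + 1) by rewrite divr_gt0// ?exprn_gt0//; lra.
have /cvgrPdist_le/(_ _ e1)[m _ /(_ m (leqnn m))] := hh_.
rewrite sub0r normrN ger0_norm; last by apply: Rintegral_ge0 => x _; exact: sqr_ge0.
rewrite ler_pdivlMr; last lra.
move=> hm; have e2 : 0 < e / 2 by lra.
have /cvgrPdist_le/(_ _ e2) := w m.
apply: filterS => n; rewrite !sub0r !normrN => hn.
have -> : \int[mu]_x (rho n x * h x) =
    \int[mu]_x (rho n x * h_ m x) + \int[mu]_x (rho n x * (h x - h_ m x)).
  rewrite -RintegralD//; [|exact: L1_mul_sqr|exact: L1_mul_sqr].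
  by apply: eq_Rintegral => x _; ring.
suff : `|\int[mu]_x (rho n x * (h x - h_ m x))| <= e / 2.
  by move=> H; rewrite (le_trans (ler_normD _ _))//; lra.
rewrite -(@ler_pXn2r _ 2)// ?nnegrE//; last exact: ltW.
rewrite real_normK ?num_real//.
apply: le_trans (Rintegral_cauchy_schwarz (mrho n) (mB m) (Lrho n) (LB m)) _.
apply: le_trans hm; rewrite mulrC; apply: ler_wpM2l.
  by apply: Rintegral_ge0 => x _; exact: sqr_ge0.
by apply: le_trans (rhoC n) _; lra.
Qed.

Lemma weak0D f g : measurable_fun setT f -> L1 mu (fun x => f x ^+ 2) ->
  measurable_fun setT g -> L1 mu (fun x => g x ^+ 2) ->
  weak0 f -> weak0 g -> weak0 (fun x => f x + g x).
Proof.
move=> mf Lf mg Lg wf wg; have -> : (fun n => \int[mu]_x (rho n x * (f x + g x))) = (fun n =>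
    \int[mu]_x (rho n x * f x) + \int[mu]_x (rho n x * g x)).
  apply/funext => n; rewrite -RintegralD//; [|exact: L1_mul_sqr|exact: L1_mul_sqr].
  by apply: eq_Rintegral => x _; rewrite mulrDr.
by rewrite -[X in _ --> X](addr0 0); exact: cvgD.
Qed.

Lemma weak0Z (c : R) f : measurable_fun setT f -> L1 mu (fun x => f x ^+ 2) ->
  weak0 f -> weak0 (fun x => c * f x).
Proof.
move=> mf Lf wf; have -> : (fun n => \int[mu]_x (rho n x * (c * f x))) = (fun n =>
    c * \int[mu]_x (rho n x * f x)).
  apply/funext => n; rewrite -RintegralZl//; last exact: L1_mul_sqr.
  by apply: eq_Rintegral => x _; rewrite mulrCA.
by rewrite -[X in _ --> X](mulr0 c); apply: cvgM => //; exact: cvg_cst.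
Qed.

Section generated.
Variable G : set (set T).
Hypotheses (GE : @measurable _ T = <<s G >>) (GI : setI_closed G).
Hypotheses (GT : G [set: T]).
Hypothesis Gw : forall E, G E -> weak0 (\1_E : T -> R).

Let L1_ind (E : set T) : measurable E -> L1 mu (fun x => \1_E x ^+ 2 : R).
Proof.
move=> mE; apply: (@L1_bounded _ _ _ _ 1).
  by apply: measurable_funX; exact: measurable_indic.
by move=> x; rewrite indicE; case: (_ \in _); rewrite ?expr1n ?expr0n ?normr1 ?normr0.
Qed.

Lemma weak0_indic E : measurable E -> weak0 (\1_E : T -> R).
Proof.
pose W (E : set T) : Prop := weak0 (\1_E : T -> R).
suff H S : measurable S -> W S by exact: H.
rewrite GE; move: S; apply: (dynkin_induction (P := W) GE GI); rewrite /W.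
- exact: Gw.
- exact: Gw.
- move=> S mS wS.
  have -> : (\1_(~` S) : T -> R) = fun x => \1_[set: T] x + (-1) * \1_S x.
    apply/funext => x; rewrite !indicE in_setC in_setT.
    by case: (x \in S) => /=; ring.
  apply: weak0D => //.
  + exact: L1_ind.
  + by apply: measurable_funM => //.
  + by under eq_fun do rewrite exprMn; apply: L1Z; exact: L1_ind.
  + exact: Gw.
  + by apply: weak0Z => //; exact: L1_ind.
- move=> F mF tF wF.
  (* By disjointness the partial sums are bounded by 1 and eventually constant at each point, so
     dominated convergence gives convergence in L^2 and [weak0_closed] applies. *)
  pose h_ m x : R := \sum_(i < m) \1_(F i) x.
  have mh_ m : measurable_fun setT (h_ m) 
    by apply: measurable_sum => i; exact: measurable_indic.
  have mU : measurable (\bigcup_k F k) by exact: bigcupT_measurable.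
  have h0 x m : ~ (\bigcup_k F k) x -> h_ m x = 0.
    move=> nx; apply: big1 => i _; rewrite indicE memNset// => Fx.
    by apply: nx; exists i.
  have h1 x k m : F k x -> h_ m x = (k < m)%:R.
    move=> Fk; have Fi_k i : F i x -> i = k.
      by move=> Fi; apply: tF => //; exists x.
    rewrite /h_; case: (ltnP k m) => km.
      rewrite (bigD1 (Ordinal km))//= indicE mem_set// big1 ?addr0// => i ik.
      rewrite indicE memNset// => /Fi_k ik'; move/eqP: ik; apply; exact: val_inj.
    rewrite big1// => i _; rewrite indicE memNset// => /Fi_k ik.
    by move: km; rewrite -ik leqNgt ltn_ord.
  have hb m x : `|h_ m x| <= 1.
    have [[k _ Fk]|nx] := pselect ((\bigcup_k F k) x).
      by rewrite (h1 _ _ _ Fk); case: (_ < _)%N; rewrite ?normr1 ?normr0.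
    by rewrite h0// normr0.
  have Lh_ m : L1 mu (fun x => h_ m x ^+ 2).
    apply: (@L1_bounded _ _ _ _ 1); first exact: measurable_funX.
    by move=> x; rewrite normrX exprn_ile1.
  apply: (@weak0_closed h_) => //.
  + exact: L1_ind.
  + rewrite -(Rintegral_cst1 mu 0).
    apply: (@Rintegral_dct _ _ _ mu (fun m x => (\1_(\bigcup_k F k) x - h_ m x) ^+ 2)
      (fun=> 0) (fun=> 4) _ _ _ _ _).2 => //.
    * by move=> n; apply: measurable_funX; exact: measurable_funB.
    * apply: aeW => x; have [[k Uk Fk]|nx] := pselect ((\bigcup_k F k) x).
        apply: cvg_near_cst; exists k.+1 => // m /= km.
        by rewrite (h1 _ _ _ Fk) km indicE mem_set ?subrr ?expr0n//; exists k.
      by apply: cvg_near_cst; apply: nearW => m; rewrite h0// indicE memNset// subrr expr0n.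
    * exact: L1_cst.
    * move=> n x; have := hb n x; rewrite normrX ler_norml => /andP[b1 b2].
      rewrite (_ : 4 = 2 ^+ 2 :> R); last by ring.
      apply: lerXn2r; rewrite ?nnegrE//.
      by rewrite indicE ler_norml; case: (_ \in _) => /=; apply/andP; split; lra.
  + elim=> [|m IH].
      have -> : (fun n => \int[mu]_x (rho n x * h_ 0 x)) = cst 0.
        apply/funext => n /=; rewrite -[RHS](Rintegral_cst1 mu 0).
        by apply: eq_Rintegral => x _; rewrite /h_ big_ord0 mulr0.
      exact: cvg_cst.
    have -> : h_ m.+1 = fun x => h_ m x + \1_(F m) x.
      by apply/funext => x; rewrite /h_ big_ord_recr.
    by apply: weak0D => //; exact: L1_ind.
Qed.

Lemma weak0_ge0 h : measurable_fun setT h -> (forall x, 0 <= h x) ->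
  L1 mu (fun x => h x ^+ 2) -> weak0 h.
Proof.
move=> mh h0 Lh.
(* The induction runs over extended real functions, but the claim concerns square-integrable ones:
   [K] speaks of real representatives [g] and is vacuous otherwise. Intermediate functions lie
   between 0 and [g], or are multiples of it, hence remain in L^2. *)
pose K (f : T -> \bar R) := forall g, (forall x, f x = (g x)%:E) ->
  L1 mu (fun x => g x ^+ 2) -> weak0 g.
have mEFin g : measurable_fun setT (fun x => (g x)%:E) -> measurable_fun setT g.
  by move/measurable_EFinP.
suff : K (EFin \o h) by apply.
apply: (@ge0_measurable_ind _ _ _ K) => //; last exact/measurable_EFinP.
- move=> E mE g gE Lg.
  have -> : g = \1_E by apply/funext => x; apply/EFin_inj; rewrite -gE.
  exact: weak0_indic.
- move=> c f c0 mf f0 Kf g gE Lg; have [c1|c1] := eqVneq c 0.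
    have -> : g = fun x => 0 * \1_[set: T] x.
      by apply/funext => x; apply/EFin_inj; rewrite -gE c1 mul0e mul0r.
    by apply: weak0Z; [exact: measurable_indic|exact: L1_ind|exact: Gw].
  have fE x : f x = (c^-1 * g x)%:E.
    by rewrite EFinM -gE muleA -EFinM mulVf// mul1e.
  have -> : g = fun x => c * (c^-1 * g x).
    by apply/funext => x; rewrite mulrA divff// mul1r.
  have Lg' : L1 mu (fun x => (c^-1 * g x) ^+ 2).
    by under eq_fun do rewrite exprMn; exact: L1Z.
  apply: weak0Z => //; last exact: Kf.
  by apply: mEFin; rewrite -(funext fE).
- move=> f1 f2 mf1 mf2 f10 f20 K1 K2 g gE Lg.
  have fin (f f' : T -> \bar R) x : (0 <= f x)%E -> (0 <= f' x)%E ->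
      (f x + f' x)%E = (g x)%:E ->
      f x = (fine (f x))%:E /\ 0 <= fine (f x) <= g x.
    case: (f x) => [r| |]; case: (f' x) => [r'| |] //=; rewrite ?lee_fin => r0 r'0 // [<-].
    by split=> //; rewrite r0 lerDl.
  have fin1 x := fin f1 f2 x (f10 x) (f20 x) (gE x).
  have fin2 x := fin f2 f1 x (f20 x) (f10 x) (etrans (addeC _ _) (gE x)).
  have -> : g = fun x => fine (f1 x) + fine (f2 x).
    apply/funext => x; apply/EFin_inj; rewrite -gE EFinD.
    by rewrite -(fin1 x).1 -(fin2 x).1.
  have m1 : measurable_fun setT (fun x => fine (f1 x)).
    by apply: mEFin; rewrite -(funext (fun x => (fin1 x).1)).
  have m2 : measurable_fun setT (fun x => fine (f2 x)).
    by apply: mEFin; rewrite -(funext (fun x => (fin2 x).1)).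
  have Ls f' : measurable_fun setT f' -> (forall x, 0 <= f' x <= g x) ->
      L1 mu (fun x => f' x ^+ 2).
    move=> mf' fg; apply: (L1_le (g := fun x => g x ^+ 2)) => //.
      exact: measurable_funX.
    move=> x; have /andP[a b] := fg x; rewrite ger0_norm ?sqr_ge0//.
    by apply: lerXn2r; rewrite ?nnegrE// (le_trans a).
  apply: weak0D => //.
  + by apply: Ls => // x; exact: (fin1 x).2.
  + by apply: Ls => // x; exact: (fin2 x).2.
  + apply: K1 => [x|]; first exact: (fin1 x).1.
    by apply: Ls => // x; exact: (fin1 x).2.
  + apply: K2 => [x|]; first exact: (fin2 x).1.
    by apply: Ls => // x; exact: (fin2 x).2.
- move=> f_ f mf_ f_0 ndf limf Kf g gE Lg.
  have cf x : f_ ^~ x n @[n --> \oo] --> f x.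
    by rewrite -limf; apply: ereal_nondecreasing_is_cvgn.
  have fle n x : (f_ n x <= (g x)%:E)%E.
    by rewrite -gE -limf; apply: lime_ge; [exact: ereal_nondecreasing_is_cvgn|];
    exists n => // m /= nm; exact: ndf.
  have fin n x : f_ n x = (fine (f_ n x))%:E.
    rewrite fineK// ge0_fin_numE//; apply: le_lt_trans (fle n x) _; exact: ltry.
  have fin0 n x : 0 <= fine (f_ n x) by apply: fine_ge0.
  have fing n x : fine (f_ n x) <= g x by rewrite -lee_fin -fin.
  have mfine n : measurable_fun setT (fun x => fine (f_ n x)).
    by apply: mEFin; rewrite -(funext (fin n)).
  have Lf n : L1 mu (fun x => fine (f_ n x) ^+ 2).
    apply: (L1_le (g := fun x => g x ^+ 2)) => //.
      exact: measurable_funX.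
    move=> x; rewrite ger0_norm ?sqr_ge0//.
    by apply: lerXn2r; rewrite ?nnegrE// (le_trans (fin0 n x)).
  have mf : measurable_fun setT f.
    exact: (emeasurable_fun_cvg f_ f mf_ (fun x _ => cf x)).
  have mg : measurable_fun setT g by apply: mEFin; rewrite -(funext gE).
  apply: (@weak0_closed (fun n x => fine (f_ n x))) => //.
  + rewrite -(Rintegral_cst1 mu 0).
    apply: (@Rintegral_dct _ _ _ mu (fun n x => (g x - fine (f_ n x)) ^+ 2)
      (fun=> 0) (fun x => g x ^+ 2) _ _ _ _ _).2 => //.
    * by move=> n; apply: measurable_funX; exact: measurable_funB.
    * apply: aeW => x.
      have H : fine (f_ n x) @[n --> \oo] --> g x.
        by apply: fine_cvg; rewrite -gE.
      have -> : (0 : R) = (g x - g x) * (g x - g x) by rewrite subrr mulr0.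
      have D : (g x - fine (f_ n x)) @[n --> \oo] --> g x - g x.
        by apply: cvgB => //; exact: cvg_cst.
      exact: (cvgM D D).
    * move=> n x; rewrite ger0_norm ?sqr_ge0//.
      apply: lerXn2r; rewrite ?nnegrE ?subr_ge0// ?(le_trans (fin0 n x))//.
      by rewrite lerBlDr lerDl.
  + by move=> n; apply: Kf.
Qed.

End generated.
End weak_convergence.

(** * The operator of a square-integrable kernel and its expansion *)

Section kernel_operator.
Context {d : measure_display} {T : measurableType d} {R : realType}.
Variables (P Q : probability T R) (xi : T * T -> R).
Local Notation nu := (P \x Q)%E.
Hypothesis mxi : measurable_fun setT xi.
Hypothesis Lxi2 : L1 nu (fun z => xi z ^+ 2).

Let L1nuxi (f g : T -> R) : measurable_fun setT f -> measurable_fun setT g ->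
  L1 P (fun x => f x ^+ 2) -> L1 Q (fun y => g y ^+ 2) ->
  L1 nu (fun z => xi z * (f z.1 * g z.2)).
Proof.
move=> mf mg Lf Lg; apply: L1_mul_sqr => //.
  apply: measurable_funM.
    exact: (measurableT_comp mf measurable_fst).
  exact: (measurableT_comp mg measurable_snd).
by under eq_fun do rewrite exprMn; exact: L1_tensor Lf Lg.
Qed.

Let L1_one (mu : probability T R) : L1 mu (fun=> 1 ^+ 2).
Proof. exact: L1_cst. Qed.

Section operator.
Variable f : T -> R.
Hypotheses (mf : measurable_fun setT f) (Lf : L1 P (fun x => f x ^+ 2)).

Let Lxf : L1 nu (fun z => xi z * f z.1).
Proof.
have := @L1nuxi f (cst 1) mf (measurable_cst _) Lf (L1_one Q).
by under eq_fun do rewrite mulr1.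
Qed.

Let opAE y : opA P xi f y = \int[P]_x (xi (x, y) * f x).
Proof. by rewrite /opA; under eq_Rintegral do rewrite mulrC. Qed.

Lemma measurable_opA : measurable_fun setT (opA P xi f).
Proof.
by rewrite (funext opAE); exact: (L1_measurable (L1_fubini2 Lxf)).
Qed.

Lemma L1_opA_sqr : L1 Q (fun y => opA P xi f y ^+ 2).
Proof.
have LX := L1_fubini2 Lxi2.
apply: (@L1_le_ae _ _ _ Q _ (fun y => (\int[P]_x (f x ^+ 2)) *
   \int[P]_x (xi (x, y) ^+ 2))).
- by apply: measurable_funX; exact: measurable_opA.
- have := ae_L1_fubini2 Lxi2; apply: filterS => y h.
  rewrite ger0_norm ?sqr_ge0// opAE mulrC.
  apply: Rintegral_cauchy_schwarz => //.
  exact: (measurableT_comp mxi (pair2_measurable _)).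
- exact: L1Z.
Qed.

Lemma Rintegral_opA (g : T -> R) : measurable_fun setT g -> L1 Q (fun y => g y ^+ 2) ->
  \int[nu]_z (xi z * (f z.1 * g z.2)) = \int[Q]_y (opA P xi f y * g y).
Proof.
move=> mg Lg; have L := L1nuxi mf mg Lf Lg.
rewrite -(Rfubini2 L); apply: Rintegral_ae.
- exact: (L1_measurable (L1_fubini2 L)).
- by apply: measurable_funM => //; exact: measurable_opA.
- have := ae_L1_fubini2 Lxf; apply: filterS => y h /=.
  rewrite opAE -RintegralZr//.
  by move=> _; apply: eq_Rintegral => x _; rewrite mulrA.
Qed.

End operator.

End kernel_operator.

Section square_integrable.
Context {d : measure_display} {T : measurableType d} {R : realType}.
Variable mu : probability T R.
Implicit Types (f g h : T -> R) (e : nat -> T -> R) (a : nat -> R).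

Definition square_integrable f :=
  measurable_fun setT f /\ L1 mu (fun x => f x ^+ 2).

Lemma sqint_mul f g : square_integrable f -> square_integrable g ->
  L1 mu (fun x => f x * g x).
Proof. by move=> [mf Lf] [mg Lg]; exact: L1_mul_sqr. Qed.

Lemma sqint_cst (c : R) : square_integrable (fun=> c).
Proof. by split; [exact: measurable_cst|exact: L1_cst]. Qed.

Lemma sqintZ (c : R) f : square_integrable f -> square_integrable (fun x => c * f x).
Proof.
move=> [mf Lf]; split; first exact: measurable_funM.
by under eq_fun do rewrite exprMn; exact: L1Z.
Qed.

Lemma sqintD f g : square_integrable f -> square_integrable g ->
  square_integrable (fun x => f x + g x).
Proof.
move=> Sf Sg; split; first by apply: measurable_funD; [case: Sf|case: Sg].
have E x : (f x + g x) ^+ 2 = f x ^+ 2 + 2 * (f x * g x) + g x ^+ 2 by ring.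
under eq_fun do rewrite E.
apply: L1D; last by case: Sg.
by apply: L1D; [case: Sf|apply: L1Z; exact: sqint_mul].
Qed.

Lemma sqintB f g : square_integrable f -> square_integrable g ->
  square_integrable (fun x => f x - g x).
Proof.
move=> Sf /(sqintZ (-1)) Sg; have := sqintD Sf Sg.
by under eq_fun do rewrite mulN1r.
Qed.

Lemma sqint_sum e n : (forall k, square_integrable (e k)) ->
  square_integrable (fun x => \sum_(k < n) e k x).
Proof.
move=> Se; elim: n => [|n IH].
  by under eq_fun do rewrite big_ord0; exact: sqint_cst.
by under eq_fun do rewrite big_ord_recr; exact: sqintD.
Qed.

Lemma sqint_L1 f : square_integrable f -> L1 mu f.
Proof. by move=> [mf Lf]; exact: L1_sqr. Qed.

Lemma Rintegral_sub_sqr f g : square_integrable f -> square_integrable g ->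
  \int[mu]_x ((f x - g x) ^+ 2) =
  \int[mu]_x (f x ^+ 2) - 2 * (\int[mu]_x (f x * g x)) + \int[mu]_x (g x ^+ 2).
Proof.
move=> Sf Sg.
have E x : (f x - g x) ^+ 2 = f x ^+ 2 - 2 * (f x * g x) + g x ^+ 2 by ring.
under eq_Rintegral do rewrite E.
have L1f : L1 mu (fun x => f x ^+ 2) by case: Sf.
have L1g : L1 mu (fun x => g x ^+ 2) by case: Sg.
have L1fg : L1 mu (fun x => 2 * (f x * g x)) by apply: L1Z; exact: sqint_mul.
rewrite RintegralD//; last exact: L1B.
by rewrite RintegralB// RintegralZl//; exact: sqint_mul.
Qed.

Lemma Rintegral_mul_sum f e n : square_integrable f ->
  (forall k, square_integrable (e k)) ->
  \int[mu]_x (f x * \sum_(k < n) e k x) = \sum_(k < n) \int[mu]_x (f x * e k x).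
Proof.
move=> Sf Se; rewrite -Rintegral_sum; last by move=> k _; exact: sqint_mul.
by apply: eq_Rintegral => x _; rewrite mulr_sumr.
Qed.

(** The norms of the [e k] are left free and orthogonality is asked only up to the factor
    [a j * a k]: an inactive function is 0 and has norm 0 rather than 1. *)
Lemma bessel_identity h e a n : square_integrable h ->
  (forall k, square_integrable (e k)) ->
  (forall j k, j != k -> a j * a k * (\int[mu]_x (e j x * e k x)) = 0) ->
  \int[mu]_x ((h x - \sum_(k < n) a k * e k x) ^+ 2) =
  \int[mu]_x (h x ^+ 2) - \sum_(k < n)
    (2 * a k * (\int[mu]_x (h x * e k x)) - a k ^+ 2 * \int[mu]_x (e k x ^+ 2)).
Proof.
move=> Sh Se ort; elim: n => [|n IH].
  by rewrite big_ord0 subr0; under eq_Rintegral do rewrite big_ord0 subr0.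
have Sae k : square_integrable (fun x => a k * e k x) by exact: sqintZ.
have Ss := sqint_sum n Sae.
have E x : h x - \sum_(k < n.+1) a k * e k x =
    (h x - \sum_(k < n) a k * e k x) - a n * e n x.
  by rewrite big_ord_recr/= opprD addrA.
under eq_Rintegral do rewrite E.
rewrite Rintegral_sub_sqr//; last exact: sqintB.
rewrite IH big_ord_recr/=.
have -> : \int[mu]_x ((h x - \sum_(k < n) a k * e k x) * (a n * e n x)) =
    a n * \int[mu]_x (h x * e n x).
  have E1 x : (h x - \sum_(k < n) a k * e k x) * (a n * e n x) =
    a n * (h x * e n x) - (a n * e n x) * \sum_(k < n) a k * e k x by ring.
  under eq_Rintegral do rewrite E1.
  rewrite RintegralB//; [|by apply: L1Z; exact: sqint_mul|exact: sqint_mul].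
  rewrite RintegralZl//; last exact: sqint_mul.
  rewrite (Rintegral_mul_sum n (e := fun k x => a k * e k x))// big1 ?subr0// => k _.
  have E2 x : a n * e n x * (a k * e k x) = (a n * a k) * (e n x * e k x) by ring.
  under eq_Rintegral do rewrite E2.
  rewrite RintegralZl//; last exact: sqint_mul.
  by rewrite ort// gtn_eqF.
have -> : \int[mu]_x ((a n * e n x) ^+ 2) = a n ^+ 2 * \int[mu]_x (e n x ^+ 2).
  under eq_Rintegral do rewrite exprMn.
  by rewrite RintegralZl//; case: (Se n).
by ring.
Qed.

Lemma Rintegral_sqr_sum e n : (forall k, square_integrable (e k)) ->
  (forall j k, j != k -> \int[mu]_x (e j x * e k x) = 0) ->
  \int[mu]_x ((\sum_(k < n) e k x) ^+ 2) = \sum_(k < n) \int[mu]_x (e k x ^+ 2).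
Proof.
move=> Se ort.
have := @bessel_identity (fun=> 0) e (fun=> -1) n (sqint_cst 0) Se.
have -> : \int[mu]_x ((0 - \sum_(k < n) -1 * e k x) ^+ 2) =
    \int[mu]_x ((\sum_(k < n) e k x) ^+ 2).
  by apply: eq_Rintegral => x _; rewrite -mulr_sumr mulN1r opprK add0r.
rewrite expr0n Rintegral_cst1 sub0r => ->; last first.
  by move=> j k jk; rewrite ort ?mulr0.
rewrite -sumrN; apply: eq_bigr => k _.
have -> : \int[mu]_x (0 * e k x) = 0.
  by under eq_Rintegral do rewrite mul0r; rewrite Rintegral_cst1.
by ring.
Qed.

End square_integrable.

Lemma cvg0_sqr_le (R : realType) (v w : nat -> R) : (forall n, v n ^+ 2 <= w n) ->
  w n @[n --> \oo] --> 0 -> v n @[n --> \oo] --> 0.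
Proof.
move=> vw w0; apply/cvgrPdist_le => e e0.
have e2 : 0 < e ^+ 2 by rewrite exprn_gt0.
have /cvgrPdist_le/(_ _ e2) := w0; apply: filterS => n.
rewrite !sub0r !normrN => h; rewrite -(@ler_pXn2r _ 2)// ?nnegrE//; last exact: ltW.
rewrite real_normK ?num_real//; apply: le_trans (vw n) _.
exact: le_trans (ler_norm _) h.
Qed.

Lemma cvg_eq (R : realType) (v w : nat -> R) (l : R) : v =1 w ->
  v n @[n --> \oo] --> l -> w n @[n --> \oo] --> l.
Proof. by move=> /funext ->. Qed.

Section spectral.
Context {d : measure_display} {T : measurableType d} {R : realType}.
Variables (P Q : probability T R) (xi : T * T -> R).
Variables (s : nat -> R) (alpha beta : nat -> T -> R).
Local Notation nu := (product_probability P Q).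
Hypothesis Sxi : square_integrable nu xi.
Hypothesis ss : singular_system P Q xi s alpha beta.

Let xi' (z : T * T) := xi (z.2, z.1).

Let mxi : measurable_fun setT xi. Proof. by case: Sxi. Qed.
Let Lxi2 : L1 (P \x Q)%E (fun z => xi z ^+ 2). Proof. by case: Sxi. Qed.
Let mxi' : measurable_fun setT xi'.
Proof.
apply: (measurableT_comp mxi).
exact/measurable_fun_pair.
Qed.
Let Lxi'2 : L1 (Q \x P)%E (fun z => xi' z ^+ 2).
Proof. exact: L1_swap Lxi2. Qed.

Lemma sqint_tensor (f g : T -> R) : square_integrable P f -> square_integrable Q g ->
  square_integrable nu (fun z => f z.1 * g z.2).
Proof.
move=> [mf Lf] [mg Lg]; split.
  apply: measurable_funM.
    exact: (measurableT_comp mf measurable_fst).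
  exact: (measurableT_comp mg measurable_snd).
by under eq_fun do rewrite exprMn; exact: L1_tensor Lf Lg.
Qed.

Lemma sqint_opA f : square_integrable P f -> square_integrable Q (opA P xi f).
Proof. by move=> [mf Lf]; split; [exact: (measurable_opA mxi Lxi2)|exact: L1_opA_sqr]. Qed.

Lemma sqint_opA_adj g : square_integrable Q g ->
  square_integrable P (opA_adj Q xi g).
Proof.
move=> [mg Lg]; split; first exact: (measurable_opA mxi' Lxi'2 mg Lg).
exact: (L1_opA_sqr mxi' Lxi'2 mg Lg).
Qed.

Lemma Rintegral_kernel f g : square_integrable P f -> square_integrable Q g ->
  \int[nu]_z (xi z * (f z.1 * g z.2)) = \int[Q]_y (opA P xi f y * g y).
Proof. by move=> [mf Lf] [mg Lg]; exact: (Rintegral_opA mxi Lxi2). Qed.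

Lemma Rintegral_kernel_adj f g : square_integrable P f -> square_integrable Q g ->
  \int[nu]_z (xi z * (f z.1 * g z.2)) = \int[P]_x (opA_adj Q xi g x * f x).
Proof.
move=> Sf Sg; have L : L1 (P \x Q)%E (fun z => xi z * (f z.1 * g z.2)).
  by apply: (@sqint_mul _ _ _ nu) => //; exact: sqint_tensor.
rewrite -[LHS](Rintegral_swap L).
have := Rintegral_opA mxi' Lxi'2 Sg.1 Sg.2 Sf.1 Sf.2 => <-.
by apply: eq_Rintegral => z _; rewrite /xi' [f _ * _]mulrC.
Qed.

(* The system with the functions attached to the singular value 0 set to 0;
   these are unconstrained in [singular_system]. *)
Definition active (e : nat -> T -> R) k : T -> R :=
  if s k == 0 then fun=> 0 else e k.

Lemma sqint_alpha k : square_integrable P (alpha k).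
Proof. by case: (ss_alpha ss) => + _ _ _ => /(_ k)/Lfun2P. Qed.

Lemma sqint_beta k : square_integrable Q (beta k).
Proof. by case: (ss_beta ss) => + _ _ _ => /(_ k)/Lfun2P. Qed.

Lemma sqint_al k : square_integrable P (active alpha k).
Proof. by rewrite /active; case: eqP => _; [exact: sqint_cst|exact: sqint_alpha]. Qed.

Lemma sqint_be k : square_integrable Q (active beta k).
Proof. by rewrite /active; case: eqP => _; [exact: sqint_cst|exact: sqint_beta]. Qed.

Let sqr_eq0 (k : nat) : (s k ^+ 2 == 0) = (s k == 0).
Proof. by rewrite sqrf_eq0. Qed.

Lemma inner_al j k : \int[P]_x (active alpha j x * active alpha k x) =
  ((j == k) && (s k != 0))%:R.
Proof.
rewrite /active; case: ifPn => [/eqP sj|sj].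
  under eq_Rintegral do rewrite mul0r.
  by rewrite Rintegral_cst1; case: eqP => // <-; rewrite sj eqxx.
case: ifPn => [/eqP sk|sk].
  by under eq_Rintegral do rewrite mulr0; rewrite Rintegral_cst1 andbF.
by case: (ss_alpha ss) => _ _ + _; rewrite andbT; apply; rewrite sqr_eq0.
Qed.

Lemma inner_be j k : \int[Q]_x (active beta j x * active beta k x) =
  ((j == k) && (s k != 0))%:R.
Proof.
rewrite /active; case: ifPn => [/eqP sj|sj].
  under eq_Rintegral do rewrite mul0r.
  by rewrite Rintegral_cst1; case: eqP => // <-; rewrite sj eqxx.
case: ifPn => [/eqP sk|sk].
  by under eq_Rintegral do rewrite mulr0; rewrite Rintegral_cst1 andbF.
by case: (ss_beta ss) => _ _ + _; rewrite andbT; apply; rewrite sqr_eq0.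
Qed.

Let s0n : s 0%N != 0. Proof. by rewrite (ss_s0 ss) oner_eq0. Qed.

(** The mean is the inner product with [active alpha 0], which is 1 almost everywhere. *)
Lemma mean_al k : \int[P]_x active alpha k x = (k == 0%N)%:R.
Proof.
have -> : \int[P]_x active alpha k x =
    \int[P]_x (active alpha k x * active alpha 0 x).
  apply: Rintegral_ae; [by case: (sqint_al k)| |].
    by apply: measurable_funM; [case: (sqint_al k)|case: (sqint_al 0)].
  have := ss_alpha0 ss; apply: filterS => x h _.
  by rewrite [X in _ = _ * X]/active (negbTE s0n) h// mulr1.
by rewrite inner_al s0n andbT.
Qed.

Lemma mean_be k : \int[Q]_x active beta k x = (k == 0%N)%:R.
Proof.
have -> : \int[Q]_x active beta k x =
    \int[Q]_x (active beta k x * active beta 0 x).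
  apply: Rintegral_ae; [by case: (sqint_be k)| |].
    by apply: measurable_funM; [case: (sqint_be k)|case: (sqint_be 0)].
  have := ss_beta0 ss; apply: filterS => x h _.
  by rewrite [X in _ = _ * X]/active (negbTE s0n) h// mulr1.
by rewrite inner_be s0n andbT.
Qed.

Lemma inner_kernel j k :
  \int[nu]_z (xi z * (active alpha j z.1 * active beta k z.2)) =
  s j * (j == k)%:R.
Proof.
rewrite Rintegral_kernel; [|exact: sqint_al|exact: sqint_be].
have [sj|sj] := eqVneq (s j) 0.
  rewrite sj mul0r /active sj eqxx -[RHS](Rintegral_cst1 Q 0).
  apply: eq_Rintegral => y _; rewrite /opA.
  by under eq_Rintegral do rewrite mul0r; rewrite Rintegral_cst1 mul0r.
have -> : \int[Q]_y (opA P xi (active alpha j) y * active beta k y) =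
    \int[Q]_y (s j * (active beta j y * active beta k y)).
  apply: Rintegral_ae.
  - apply: measurable_funM; last by case: (sqint_be k).
    by case: (sqint_opA (sqint_al j)).
  - apply: measurable_funM => //.
    by apply: measurable_funM; [case: (sqint_be j)|case: (sqint_be k)].
  - have := ss_opA ss j; apply: filterS => y h _.
    by rewrite mulrA [X in opA P xi X]/active [active beta j]/active (negbTE sj) h.
rewrite RintegralZl//; last by apply: sqint_mul; exact: sqint_be.
rewrite inner_be; have [<-|] := eqVneq j k; first by rewrite sj.
by rewrite andFb.
Qed.

Lemma inner_opA f k : square_integrable P f ->
  \int[Q]_y (opA P xi f y * active beta k y) =
  s k * \int[P]_x (f x * active alpha k x).
Proof.
move=> Sf; rewrite -Rintegral_kernel//; last exact: sqint_be.
have [sk|sk] := eqVneq (s k) 0.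
  rewrite sk mul0r /active sk eqxx -[RHS](Rintegral_cst1 nu 0).
  by apply: eq_Rintegral => y _; rewrite !mulr0.
rewrite Rintegral_kernel_adj//; last exact: sqint_be.
rewrite -RintegralZl//; last by apply: sqint_mul => //; exact: sqint_al.
apply: Rintegral_ae.
- apply: measurable_funM; last by case: Sf.
  by case: (sqint_opA_adj (sqint_be k)).
- apply: measurable_funM => //.
  by apply: measurable_funM; [case: Sf|case: (sqint_al k)].
- have := ss_opA_adj ss k; apply: filterS => y h _.
  by rewrite /active (negbTE sk) h//= mulrAC mulrA.
Qed.

(** Parseval's identity for A f, obtained by pairing the L^2 expansion of A^*A f with f, since the
    inner product of A^*A f with f is the squared norm of A f. *)
Lemma cvg_sqr_opA f : square_integrable P f ->
  \int[Q]_y (opA P xi f y ^+ 2) -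
    \sum_(k < n) s k ^+ 2 * (\int[P]_x (f x * active alpha k x)) ^+ 2
    @[n --> \oo] --> (0 : R).
Proof.
move=> Sf; have Lf : f \in Lfun P 2%:E by apply/Lfun2P.
case: (ss_alpha ss) => _ _ _ /(_ f Lf).
move=> F0; pose F n x : R := opA_adj Q xi (opA P xi f) x -
  \sum_(0 <= k < n) s k ^+ 2 * L2inner P f (alpha k) * alpha k x.
pose c k := s k ^+ 2 * L2inner P f (alpha k).
have FE n : F n = fun x => opA_adj Q xi (opA P xi f) x - \sum_(k < n) c k * alpha k x.
  by apply/funext => x; rewrite /F big_mkord.
have Sopa := sqint_opA_adj (sqint_opA Sf).
have SF n : square_integrable P (F n).
  rewrite FE; apply: sqintB => //.
  by apply: (@sqint_sum _ _ _ P (fun k x => c k * alpha k x)) => k; apply: sqintZ; exact: sqint_alpha.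
apply: (cvg_eq _ (@cvg_Rintegral_Lnorm2 _ _ _ P F f (fun n => (SF n).1)
  (fun n => (SF n).2) Lf F0)) => n; rewrite FE.
have Sal k : square_integrable P (fun x => c k * alpha k x).
  by apply: sqintZ; exact: sqint_alpha.
have E x : (opA_adj Q xi (opA P xi f) x - \sum_(k < n) c k * alpha k x) * f x =
  opA_adj Q xi (opA P xi f) x * f x - f x * \sum_(k < n) c k * alpha k x by ring.
under eq_Rintegral do rewrite E.
rewrite RintegralB//; [|exact: sqint_mul|]; last first.
  by apply: sqint_mul => //; exact: (sqint_sum n Sal).
rewrite (Rintegral_mul_sum n (e := fun k x => c k * alpha k x))//; congr (_ - _).
  rewrite -Rintegral_kernel_adj//; last exact: sqint_opA.
  by rewrite Rintegral_kernel//; exact: sqint_opA.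
apply: eq_bigr => k _.
have E1 x : f x * (c k * alpha k x) = c k * (f x * alpha k x) by ring.
under eq_Rintegral do rewrite E1.
rewrite RintegralZl//; last by apply: sqint_mul => //; exact: sqint_alpha.
rewrite /c -mulrA /L2inner /active; have [->|sk] := eqVneq (s k) 0.
  by rewrite expr0n !mul0r.
by rewrite expr2.
Qed.

(** By [bessel_identity] the squared distance is exactly the remainder in [cvg_sqr_opA]; the
    expansion of A^*A thus yields one of A itself. *)
Lemma cvg_opA_expansion f : square_integrable P f ->
  \int[Q]_y ((opA P xi f y - \sum_(k < n)
     (s k * (\int[P]_x (f x * active alpha k x))) * active beta k y) ^+ 2)
    @[n --> \oo] --> (0 : R).
Proof.
move=> Sf; apply: (cvg_eq _ (cvg_sqr_opA Sf)) => n.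
rewrite (@bessel_identity _ _ _ Q (opA P xi f) (active beta) (fun k =>
   s k * (\int[P]_x (f x * active alpha k x)))).
- congr (_ - _); apply: eq_bigr => k _.
  rewrite inner_opA//.
  have -> : \int[Q]_x (active beta k x ^+ 2) = (s k != 0)%:R.
    by under eq_Rintegral do rewrite expr2; rewrite inner_be eqxx.
  by have [->|_] := eqVneq (s k) 0; rewrite /=; ring.
- exact: sqint_opA.
- by move=> k; exact: sqint_be.
- by move=> j k /negbTE jk; rewrite inner_be jk mulr0.
Qed.

Let kap k (z : T * T) : R := active alpha k z.1 * active beta k z.2.
Let Skap k : square_integrable nu (kap k).
Proof. by apply: sqint_tensor; [exact: sqint_al|exact: sqint_be]. Qed.

Definition kernel_partial n (z : T * T) : R :=
  \sum_(k < n) s k * (active alpha k z.1 * active beta k z.2).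

Lemma sqint_kernel_partial n : square_integrable nu (kernel_partial n).
Proof.
by apply: (@sqint_sum _ _ _ nu (fun k z => s k * kap k z)) => k; exact: sqintZ.
Qed.

Lemma inner_kernel_partial n :
  \int[nu]_z (xi z * kernel_partial n z) = \sum_(k < n) s k ^+ 2.
Proof.
rewrite (@Rintegral_mul_sum _ _ _ nu xi (fun k z => s k * kap k z))//; last first.
  by move=> k; exact: sqintZ.
apply: eq_bigr => k _.
have E z : xi z * (s k * kap k z) = s k * (xi z * kap k z) by ring.
under eq_Rintegral do rewrite E.
rewrite RintegralZl//; last exact: sqint_mul.
by rewrite inner_kernel eqxx mulr1 expr2.
Qed.

Let inner_kap j k : \int[nu]_z (kap j z * kap k z) = ((j == k) && (s k != 0))%:R.
Proof.
have E z : kap j z * kap k z = (active alpha j z.1 * active alpha k z.1) *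
  (active beta j z.2 * active beta k z.2) by rewrite /kap; ring.
under eq_Rintegral do rewrite E.
rewrite (@Rintegral_tensor _ _ _ _ _ P Q (fun x => active alpha j x * active alpha k x)
  (fun x => active beta j x * active beta k x)).
- by rewrite inner_al inner_be -natrM mulnb andbb.
- by apply: sqint_mul; exact: sqint_al.
- by apply: sqint_mul; exact: sqint_be.
Qed.

Lemma sqr_kernel_partial n :
  \int[nu]_z (kernel_partial n z ^+ 2) = \sum_(k < n) s k ^+ 2.
Proof.
rewrite (@Rintegral_sqr_sum _ _ _ nu (fun k z => s k * kap k z)).
- apply: eq_bigr => k _; under eq_Rintegral do rewrite exprMn.
  rewrite RintegralZl//; last by case: (Skap k).
  under eq_Rintegral do rewrite expr2.
  rewrite inner_kap eqxx /=; have [->|_] := eqVneq (s k) 0; last by rewrite mulr1.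
  by rewrite expr0n mul0r.
- by move=> k; exact: sqintZ.
- move=> j k /negbTE jk.
  have E z : s j * kap j z * (s k * kap k z) = s j * s k * (kap j z * kap k z) by ring.
  under eq_Rintegral do rewrite E.
  by rewrite RintegralZl ?inner_kap ?jk ?mulr0//; exact: sqint_mul.
Qed.

(** Inner product with [xi] and squared norm of the partial kernel coincide. Nonnegativity of the
    left-hand side is the source of the summability of the s_k^2. *)
Lemma sqr_kernel_sub n :
  \int[nu]_z ((xi z - kernel_partial n z) ^+ 2) =
  \int[nu]_z (xi z ^+ 2) - \sum_(k < n) s k ^+ 2.
Proof.
rewrite Rintegral_sub_sqr//; last exact: sqint_kernel_partial.
by rewrite inner_kernel_partial sqr_kernel_partial; ring.
Qed.

Let mrect (A B : set T) : measurable A -> measurable B ->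
  square_integrable P (\1_A : T -> R) /\ square_integrable Q (\1_B : T -> R).
Proof.
have H (m : probability T R) (E : set T) : measurable E -> square_integrable m (\1_E : T -> R).
  move=> mE; split; first exact: measurable_indic.
  apply: (@L1_bounded _ _ _ _ 1).
    by apply: measurable_funX; exact: measurable_indic.
  by move=> x; rewrite indicE; case: (_ \in _); rewrite ?expr1n ?expr0n ?normr1 ?normr0.
by split; exact: H.
Qed.

(** Against a rectangle the difference of kernels becomes the inner product of [\1_B] with the error
    in the expansion of [opA P xi \1_A]; Cauchy-Schwarz bounds its square by [cvg_opA_expansion],
    the norm of [\1_B] being at most 1. *)
Lemma weak0_rect (A B : set T) : measurable A -> measurable B ->
  \int[nu]_z ((xi z - kernel_partial n z) * \1_(A `*` B) z) @[n --> \oo] --> (0 : R).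
Proof.
move=> mA mB; have [SA SB] := mrect mA mB.
apply: (cvg0_sqr_le _ (cvg_opA_expansion SA)) => n.
set c := fun k => s k * (\int[P]_x (\1_A x * active alpha k x)).
have Sc : square_integrable Q (fun y => opA P xi \1_A y - \sum_(k < n) c k * active beta k y).
  apply: sqintB; first exact: sqint_opA.
  apply: (@sqint_sum _ _ _ Q (fun k y => c k * active beta k y)) => k.
  by apply: sqintZ; exact: sqint_be.
have -> : \int[nu]_z ((xi z - kernel_partial n z) * \1_(A `*` B) z) =
    \int[Q]_y ((opA P xi \1_A y - \sum_(k < n) c k * active beta k y) * \1_B y).
  have E1 z : (xi z - kernel_partial n z) * \1_(A `*` B) z =
      xi z * (\1_A z.1 * \1_B z.2) - (\1_A z.1 * \1_B z.2) * kernel_partial n z.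
    by rewrite !indicE in_setX -mulnb natrM; ring.
  under eq_Rintegral do rewrite E1.
  have SAB := sqint_tensor SA SB.
  rewrite RintegralB//; [|exact: sqint_mul|]; last first.
    by apply: sqint_mul => //; exact: sqint_kernel_partial.
  rewrite Rintegral_kernel//.
  rewrite (@Rintegral_mul_sum _ _ _ nu _ (fun k z => s k * kap k z))//; last first.
    by move=> k; exact: sqintZ.
  have E2 y : (opA P xi \1_A y - \sum_(k < n) c k * active beta k y) * \1_B y =
    opA P xi \1_A y * \1_B y - \1_B y * \sum_(k < n) c k * active beta k y by ring.
  under [RHS]eq_Rintegral do rewrite E2.
  have Scb k : square_integrable Q (fun y => c k * active beta k y).
    by apply: sqintZ; exact: sqint_be.
  rewrite RintegralB//; last 2 first.
  - by apply: sqint_mul => //; exact: sqint_opA.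
  - by apply: sqint_mul => //; exact: (sqint_sum n Scb).
  rewrite (@Rintegral_mul_sum _ _ _ Q _ (fun k y => c k * active beta k y))//.
  congr (_ - _); apply: eq_bigr => k _.
  have E3 z : \1_A z.1 * \1_B z.2 * (s k * kap k z) = s k *
     ((\1_A z.1 * active alpha k z.1) * (\1_B z.2 * active beta k z.2)).
    by rewrite /kap; ring.
  under eq_Rintegral do rewrite E3.
  have LA : L1 P (fun x => \1_A x * active alpha k x).
    by apply: sqint_mul => //; exact: sqint_al.
  have LB : L1 Q (fun x => \1_B x * active beta k x).
    by apply: sqint_mul => //; exact: sqint_be.
  rewrite RintegralZl//; last exact: L1_tensor LA LB.
  rewrite (Rintegral_tensor LA LB).
  have E4 y : \1_B y * (c k * active beta k y) = c k * (\1_B y * active beta k y) by ring.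
  under [RHS]eq_Rintegral do rewrite E4.
  by rewrite RintegralZl// /c mulrA.
apply: le_trans (Rintegral_cauchy_schwarz Sc.1 SB.1 Sc.2 SB.2) _.
rewrite -[leRHS]mulr1; apply: ler_wpM2l.
  by apply: Rintegral_ge0 => x _; exact: sqr_ge0.
rewrite -[leRHS](Rintegral_cst1 Q 1); apply: le_Rintegral => //.
- exact: SB.2.
- exact: L1_cst.
Qed.

(* [singular_system] gives the expansion of the operator only; [xi] minus its
   partial sums therefore tends to 0 against rectangles, hence, by a Dynkin
   argument, against every function of [L^2], in particular against [xi]. *)
Lemma cvg_sum_sqr : xi = (fun z => `|xi z|) %[ae nu] ->
  \sum_(k < n) s k ^+ 2 @[n --> \oo] --> \int[nu]_z (xi z ^+ 2).
Proof.
move=> xi_abs; set C := \int[nu]_z (xi z ^+ 2).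
have Srho n : square_integrable nu (fun z => xi z - kernel_partial n z).
  by apply: sqintB => //; exact: sqint_kernel_partial.
have rhoC n : \int[nu]_z ((xi z - kernel_partial n z) ^+ 2) <= C.
  rewrite sqr_kernel_sub lerBlDr lerDl.
  by apply: sumr_ge0 => k _; exact: sqr_ge0.
have mabs : measurable_fun setT (fun z => `|xi z|) by exact: measurableT_comp.
have Labs : L1 nu (fun z => `|xi z| ^+ 2).
  by under eq_fun do rewrite real_normK ?num_real//; exact: Sxi.2.
have W := @weak0_ge0 _ _ _ nu (fun n z => xi z - kernel_partial n z) C
  (fun n => (Srho n).1) (fun n => (Srho n).2) rhoC
  [set A `*` B | A in measurable & B in measurable]
  (measurable_prod_measurableType _ _) _ _ _ (fun z => `|xi z|) mabs (fun z => normr_ge0 _) Labs.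
have H : \int[nu]_z ((xi z - kernel_partial n z) * `|xi z|) @[n --> \oo] --> (0 : R).
  apply: W.
  - move=> _ _ [A1 mA1 [B1 mB1 <-]] [A2 mA2 [B2 mB2 <-]].
    exists (A1 `&` A2); first exact: measurableI.
    by exists (B1 `&` B2); [exact: measurableI|rewrite setXI].
  - by exists setT => //; exists setT => //; rewrite setXTT.
  - by move=> _ [A mA [B mB <-]]; exact: weak0_rect.
have E n : \int[nu]_z ((xi z - kernel_partial n z) * `|xi z|) =
    C - \sum_(k < n) s k ^+ 2.
  transitivity (\int[nu]_z ((xi z - kernel_partial n z) * xi z)).
    apply: Rintegral_ae.
    - by apply: measurable_funM => //; case: (Srho n).
    - by apply: measurable_funM => //; case: (Srho n).
    - by apply: filterS xi_abs => z h _; rewrite h// normr_id.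
  have E1 z : (xi z - kernel_partial n z) * xi z = xi z ^+ 2 - xi z * kernel_partial n z by ring.
  under eq_Rintegral do rewrite E1.
  rewrite RintegralB//; last by apply: sqint_mul => //; exact: sqint_kernel_partial.
  by rewrite inner_kernel_partial.
have CH : C - \int[nu]_z ((xi z - kernel_partial n z) * `|xi z|)
    @[n --> \oo] --> C - 0 by apply: cvgB => //; exact: cvg_cst.
by rewrite -[X in _ --> X]subr0; apply: (cvg_eq _ CH) => n; rewrite /= E; ring.
Qed.

Section linear_statistic.
Variable m : probability (T * T)%type R.
Hypothesis m1 : forall A, measurable A -> m (fst @^-1` A) = P A.
Hypothesis m2 : forall A, measurable A -> m (snd @^-1` A) = Q A.
Variables (t u : nat -> R) (kappa : nat -> R).
Hypothesis cross : forall j k,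
  \int[m]_z (active alpha j.+1 z.1 * active beta k.+1 z.2) = kappa k * (j == k)%:R.

Let Sal k : square_integrable m (fun z => active alpha k z.1).
Proof.
have [mk Lk] := sqint_al k; split; first exact: (measurableT_comp mk measurable_fst).
exact: (L1_law measurable_fst m1 Lk).
Qed.

Let Sbe k : square_integrable m (fun z => active beta k z.2).
Proof.
have [mk Lk] := sqint_be k; split; first exact: (measurableT_comp mk measurable_snd).
exact: (L1_law measurable_snd m2 Lk).
Qed.

(** Contribution of one pair (x, y) to a linear form in the statistics. It is studied under two laws
    [m] with the same marginals: under mu, where [kappa k] is [s k.+1], and under the product, where
    [kappa] vanishes. *)
Definition linear_stat n (z : T * T) : R :=
  \sum_(k < n) (t k * active alpha k.+1 z.1 + u k * active beta k.+1 z.2).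

Let w k (z : T * T) := t k * active alpha k.+1 z.1 + u k * active beta k.+1 z.2.
Let Sw k : square_integrable m (w k).
Proof. by apply: sqintD; exact: sqintZ. Qed.

Lemma sqint_linear_stat n : square_integrable m (linear_stat n).
Proof. exact: (sqint_sum n Sw). Qed.

Lemma mean_linear_stat n : \int[m]_z linear_stat n z = 0.
Proof.
rewrite (Rintegral_sum (index_enum _) (F := fun k : 'I_n => w k)); last first.
  by move=> k _; exact: sqint_L1.
apply: big1 => k _.
rewrite RintegralD//; [|by apply: sqint_L1; exact: sqintZ..].
rewrite !RintegralZl//; [|exact: sqint_L1..].
rewrite (Rintegral_law measurable_fst m1 (sqint_L1 (sqint_al _))).
rewrite (Rintegral_law measurable_snd m2 (sqint_L1 (sqint_be _))).
by rewrite mean_al mean_be !mulr0 addr0.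
Qed.

Let inner_w j k : \int[m]_z (w j z * w k z) =
  (j == k)%:R * ((s k.+1 != 0)%:R * (t k ^+ 2 + u k ^+ 2) + 2 * t k * u k * kappa k).
Proof.
have E z : w j z * w k z =
  (t j * t k) * (active alpha j.+1 z.1 * active alpha k.+1 z.1) +
  (t j * u k) * (active alpha j.+1 z.1 * active beta k.+1 z.2) +
  (t k * u j) * (active alpha k.+1 z.1 * active beta j.+1 z.2) +
  (u j * u k) * (active beta j.+1 z.2 * active beta k.+1 z.2) by rewrite /w; ring.
under eq_Rintegral do rewrite E.
have L1a : L1 m (fun z => (t j * t k) * (active alpha j.+1 z.1 * active alpha k.+1 z.1)).
  by apply: L1Z; exact: sqint_mul.
have L1b : L1 m (fun z => (t j * u k) * (active alpha j.+1 z.1 * active beta k.+1 z.2)).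
  by apply: L1Z; exact: sqint_mul.
have L1c : L1 m (fun z => (t k * u j) * (active alpha k.+1 z.1 * active beta j.+1 z.2)).
  by apply: L1Z; exact: sqint_mul.
have L1d : L1 m (fun z => (u j * u k) * (active beta j.+1 z.2 * active beta k.+1 z.2)).
  by apply: L1Z; exact: sqint_mul.
rewrite RintegralD//; last by apply: L1D => //; exact: L1D.
rewrite RintegralD//; last exact: L1D.
rewrite RintegralD//.
rewrite !RintegralZl//; [|exact: sqint_mul..].
rewrite !cross.
rewrite (Rintegral_law measurable_fst m1 (f := fun x => active alpha j.+1 x * active alpha k.+1 x)); last first.
  by apply: sqint_mul; exact: sqint_al.
rewrite (Rintegral_law measurable_snd m2 (f := fun x => active beta j.+1 x * active beta k.+1 x)); last first.
  by apply: sqint_mul; exact: sqint_be.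
rewrite inner_al inner_be eqSS [k == j]eq_sym.
have [->|_] := eqVneq j k; rewrite /=; ring.
Qed.

Lemma var_linear_stat n : \int[m]_z (linear_stat n z ^+ 2) = \sum_(k < n)
  ((s k.+1 != 0)%:R * (t k ^+ 2 + u k ^+ 2) + 2 * t k * u k * kappa k).
Proof.
rewrite (Rintegral_sqr_sum _ Sw) => [|j k /negbTE jk]; last by rewrite inner_w jk mul0r.
apply: eq_bigr => k _; under eq_Rintegral do rewrite expr2.
by rewrite inner_w eqxx mul1r.
Qed.

End linear_statistic.

End spectral.

(** * Integration against the Radon-Nikodym density *)

Section density.
Local Open Scope charge_scope.
Context {d : measure_display} {T : measurableType d} {R : realType}.
Variables (nu mu : probability T R) (xi : T -> R).
Hypothesis mu_ac : mu `<< nu.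
Hypothesis xi_density : EFin \o xi =
  'd (charge_of_finite_measure mu) '/d nu %[ae nu].
Hypothesis mxi : measurable_fun setT xi.

Let f := Radon_Nikodym_SigmaFinite.f mu nu.
Let xif : {ae nu, forall z, (xi z)%:E = f z}.
Proof.
have := @ae_eq_Radon_Nikodym_SigmaFinite _ _ _ mu nu mu_ac _ measurableT.
by apply: filterS2 xi_density => z h1 /(_ Logic.I) h2; rewrite /f h2; exact: h1.
Qed.

Lemma density_abs : xi = (fun z => `|xi z|) %[ae nu].
Proof.
apply: filterS xif => z h _; rewrite ger0_norm// -lee_fin h.
exact: (Radon_Nikodym_SigmaFinite.f_ge0 mu_ac).
Qed.

(** The density [xi] is nonnegative almost everywhere only, whereas [integral_weighted] requires a
    weight that is nonnegative at every point; hence the absolute value. *)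
Lemma density_integral (F : T -> R) : L1 mu F ->
  L1 nu (fun z => `|xi z| * F z) /\ \int[nu]_z (`|xi z| * F z) = \int[mu]_z F z.
Proof.
move=> LF.
have mabs : measurable_fun setT (fun z => `|xi z|) by exact: measurableT_comp.
have [|L E] := integral_weighted (@measurable_id _ T setT) mabs (fun z => normr_ge0 _)
  (c := 1) (nu := mu) (mu := nu) _ LF; last by rewrite E mul1r.
move=> B mB; rewrite mul1e.
transitivity (\int[nu]_(x in B) f x)%E; last first.
  exact/esym/(Radon_Nikodym_SigmaFinite.f_integral mu_ac mB).
rewrite [RHS]integral_mkcond; apply: ae_eq_integral => //.
- apply/measurable_EFinP/measurable_funM => //; exact: measurable_indic.
- apply/(measurable_restrictT _ mB)/measurable_funTS.
  exact: (measurable_int nu (Radon_Nikodym_SigmaFinite.f_integrable mu_ac)).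
- apply: filterS2 xif density_abs => z h1 h2 _.
  rewrite /patch indicE; case: (z \in B); last by rewrite mulr0.
  by rewrite mulr1 -h2// h1.
Qed.

Lemma density_integralE (F : T -> R) : L1 mu F ->
  L1 nu (fun z => xi z * F z) /\ \int[nu]_z (xi z * F z) = \int[mu]_z F z.
Proof.
move=> LF; have [L E] := density_integral LF.
have mF := L1_measurable LF.
have H : (fun z => `|xi z| * F z) = (fun z => xi z * F z) %[ae nu].
  by apply: filterS density_abs => z h _ /=; rewrite -h.
have mxF : measurable_fun setT (fun z => xi z * F z) by exact: measurable_funM.
split; first exact: L1_ae H L.
by rewrite -E; apply/esym/Rintegral_ae => //; exact: L1_measurable L.
Qed.

End density.

(** * Second moment *)

Section colorings.
Local Close Scope classical_set_scope.
Context {R : realType}.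

Lemma perm_of_counts (N : nat) (C : finType) (c c0 : {ffun 'I_N -> C}) :
  (forall a, #|[set i | c i == a]| = #|[set i | c0 i == a]|) ->
  exists p : 'S_N, forall i, c0 (p i) = c i.
Proof.
move=> cc0.
have cnt (f : {ffun 'I_N -> C}) a :
    count_mem a [tuple f i | i < N] = #|[set i | f i == a]|.
  by rewrite /= count_map cardsE cardE size_filter enumT.
have : perm_eq [tuple c i | i < N] [tuple c0 i | i < N].
  by apply/allP => a _ /=; rewrite (cnt c a) (cnt c0 a) cc0.
move=> /tuple_permP[p pE]; exists p => i.
have := congr1 (fun s => nth (c i) s i) pE.
rewrite -!tnth_nth !tnth_mktuple => <- //.
Qed.

Variables (N L : nat) (q : nat -> R).
Hypotheses (q0 : q 0 = 1) (q_ge0 : forall k, 0 <= q k)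
  (q_lt1 : forall k, q k.+1 < 1).

Local Notation coloring := {ffun 'I_N -> 'I_L.+1}.

Let size_class (c : coloring) (a : 'I_L.+1) := #|[set i | c i == a]|.

Let size_classP c a : (size_class c a < N.+1)%N.
Proof. by rewrite ltnS /size_class (leq_trans (max_card _))// card_ord. Qed.

(* Records the sizes of the classes of the colors other than [ord0]. *)
Let profile (c : coloring) : {ffun 'I_L -> 'I_N.+1} :=
  [ffun k => Ordinal (size_classP c (lift ord0 k))].

Let profile_inj c c0 : profile c = profile c0 ->
  forall a, size_class c a = size_class c0 a.
Proof.
move=> /ffunP cc0.
have lft k : size_class c (lift ord0 k) = size_class c0 (lift ord0 k).
  by have := cc0 k; rewrite !ffunE => /(congr1 val).
(* The color [ord0] is absent from the profile; its class size is what the others leave of [N]. *)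
have tot (f : coloring) : N = (size_class f ord0 +
    \sum_(k < L) size_class f (lift ord0 k))%N.
  rewrite -[LHS]card_ord -sum1_card (partition_big f xpredT)//= big_ord_recl.
  by congr (_ + _)%N; [|apply: eq_bigr => k _]; rewrite sum1dep_card.
move=> a; case: (unliftP ord0 a) => [k ->|->] //.
have := tot c; rewrite [X in X = _](tot c0).
under [X in _ = (_ + X)%N]eq_bigr do rewrite lft.
by move=> /addIn.
Qed.

Let weightE (c : coloring) :
  \prod_(i < N) q (c i) = \prod_(k < L) q k.+1 ^+ profile c k.
Proof.
rewrite (partition_big c xpredT)//= big_ord_recl big1 ?mul1r; last first.
  by move=> i /eqP ->.
apply: eq_bigr => k _; rewrite ffunE /= /size_class cardsE -prodr_const.
by apply: eq_bigr => i /eqP ->; rewrite lift0.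
Qed.

(** Orbit-stabilizer count as an injection into the permutations. Fix [c0] of profile [m] and choose
    [f c] with c0 o f c = c. From [r * f c] one recovers c = c0 o (r * f c), because [r] fixes [c],
    and then [r]. *)
Let card_profile (m : {ffun 'I_L -> 'I_N.+1}) :
  (#|[set p : 'S_N * coloring |
    [forall i, p.2 (p.1 i) == p.2 i] && (profile p.2 == m)]| <= N`!)%N.
Proof.
set A := [set p | _]; have [->|[[r0 c0]]] := set_0Vmem A; first by rewrite cards0.
rewrite inE /= => /andP[_ /eqP c0m].
have ex (c : coloring) : exists p : 'S_N, (profile c == m) ==> [forall i, c0 (p i) == c i].
  have [cm|] := eqVneq (profile c) m; last by exists 1%g.
  have [|p pE] := @perm_of_counts N _ c c0.
    by move=> a; apply: profile_inj; rewrite cm c0m.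
  by exists p; apply/forallP => i; rewrite pE.
pose f (c : coloring) := xchoose (ex c).
have fP c : profile c = m -> forall i, c0 (f c i) = c i.
  by move=> /eqP cm i; have /implyP/(_ cm)/forallP/(_ i)/eqP := xchooseP (ex c).
rewrite -[N in N`!]card_ord -card_Sn ?card_ord//.
pose h (p : 'S_N * coloring) : 'S_N := (p.1 * f p.2)%g.
rewrite -(@card_in_imset _ _ h A) ?max_card//.
move=> [r c] [r' c']; rewrite !inE /= => /andP[/forallP rc /eqP cm].
move=> /andP[/forallP rc' /eqP cm'] hh.
have cE i : c i = c0 (h (r, c) i).
  by rewrite /h permM fP//; apply/esym/eqP/rc.
have cE' i : c' i = c0 (h (r', c') i).
  by rewrite /h permM fP//; apply/esym/eqP/rc'.
have cc' : c = c' by apply/ffunP => i; rewrite cE cE' hh.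
by move: hh; rewrite /h /= -cc' => /mulIg ->.
Qed.

(* Up to the factor [N`!], the left-hand side is the complete homogeneous
   symmetric polynomial of degree [N] in [1, q 1, ..., q L]. *)
Lemma sum_fixed_colorings :
  \sum_(r : 'S_N) \sum_(c : coloring)
    [forall i, c (r i) == c i]%:R * \prod_(i < N) q (c i) <=
  N`!%:R * \prod_(k < L) (1 - q k.+1)^-1.
Proof.
rewrite pair_bigA /= (partition_big (fun p => profile p.2) xpredT)//=.
(* All [m] are counted, although only profiles of total size at most [N] occur; after this
   enlargement the sum factors into geometric sums, one for each color. *)
apply: (@le_trans _ _ (\sum_(m : {ffun 'I_L -> 'I_N.+1})
    N`!%:R * \prod_(k < L) q k.+1 ^+ m k)).
  apply: ler_sum => m _.
  under eq_bigr => p /eqP pm do rewrite weightE pm mulr_natl mulrb.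
  rewrite -big_mkcondr /= sumr_const.
  rewrite -[leLHS]mulr_natl.
  apply: ler_wpM2r.
    by apply: prodr_ge0 => k _; exact: exprn_ge0.
  rewrite ler_nat; apply: leq_trans (card_profile m).
  by apply/eq_leq/eq_card => p; rewrite unfold_in; apply/esym; rewrite finset.in_set andbC.
rewrite -mulr_sumr; apply: ler_wpM2l => //.
rewrite -(bigA_distr_bigA (fun (k : 'I_L) (j : 'I_N.+1) => q k.+1 ^+ j)) /=.
apply: ler_prod => k _; apply/andP; split.
  by apply: sumr_ge0 => j _; exact: exprn_ge0.
have q1 : 0 < 1 - q k.+1 by rewrite subr_gt0.
rewrite -[leRHS]mul1r ler_pdivlMr// mulrC.
have -> : (1 - q k.+1) * (\sum_(j < N.+1) q k.+1 ^+ j) = 1 - q k.+1 ^+ N.+1.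
  by rewrite -[RHS]opprB subrX1 -mulNr opprB.
by rewrite lerBlDr lerDl exprn_ge0.
Qed.

End colorings.

Lemma sqr_sum_le (R : realFieldType) (I : Type) (s : seq I) (a : I -> R) :
  (\sum_(i <- s) a i) ^+ 2 <= (size s)%:R * \sum_(i <- s) a i ^+ 2.
Proof.
elim: s => [|i s IH]; first by rewrite !big_nil expr0n mul0r.
rewrite !big_cons /= -natr1; move: IH.
set S := \sum_(j <- s) a j; set V := \sum_(j <- s) a j ^+ 2 => IH.
have V0 : 0 <= V by apply: sumr_ge0 => j _; exact: sqr_ge0.
case: s @S @V IH V0 => [|j s] S V IH V0.
  by rewrite /S /V !big_nil !addr0 add0r mul1r.
set n : R := (size (j :: s))%:R in IH *.
have n0 : 0 < n by rewrite ltr0n.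
have := sqr_ge0 (n * a i - S) => H.
have : 0 <= n * (n * a i ^+ 2 + V - 2 * a i * S) by nra.
by rewrite pmulr_rge0// => H2; nra.
Qed.

Lemma sqr_sum_le_card (R : realFieldType) (I : finType) (a : I -> R) :
  (\sum_i a i) ^+ 2 <= #|I|%:R * \sum_i a i ^+ 2.
Proof. by apply: le_trans (sqr_sum_le _ _) _; rewrite -sum1_size sum1_card. Qed.

(** * Samples paired by a permutation *)

Section paired_samples.
Context {dO : measure_display} {Omega : measurableType dO} {R : realType}.
Variable Pr : probability Omega R.
Context {d : measure_display} {T : measurableType d}.
Variables (P Q : probability T R) (X Y : nat -> Omega -> T).
Hypotheses (mX : forall i, measurable_fun setT (X i))
  (mY : forall i, measurable_fun setT (Y i)).
Hypothesis lawX : forall i B, measurable B -> Pr (X i @^-1` B) = P B.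
Hypothesis lawY : forall i B, measurable B -> Pr (Y i @^-1` B) = Q B.
Hypothesis indXY : mutually_independent Pr (join_families X Y).
Local Notation nu := (product_probability P Q).

Section fixed_permutation.
Variables (N : nat) (r : 'S_N).

Definition paired (i : 'I_N) (w : Omega) : T * T := (X i w, Y (r i) w).

Let Z (i : 'I_N + 'I_N) : Omega -> T :=
  match i with inl k => X k | inr k => Y (r k) end.

Let mZ i : measurable_fun setT (Z i). Proof. by case: i => k; [exact: mX|exact: mY]. Qed.

Let indZ : mutually_independent Pr Z.
Proof.
pose phi (i : 'I_N + 'I_N) : nat + nat :=
  match i with inl k => inl (k : nat) | inr k => inr (r k : nat) end.
have -> : Z = fun i => join_families X Y (phi i) by apply/funext; case.
apply: mutually_independent_inj indXY.
by move=> [i|i] [j|j] //= [] /val_inj; [move->|move/perm_inj->].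
Qed.

Lemma measurable_paired i : measurable_fun setT (paired i).
Proof. exact: (measurable_pair mZ i). Qed.

Lemma paired_law i B : measurable B -> Pr (paired i @^-1` B) = nu B.
Proof.
apply: (pair_law mZ indZ (P := P) (Q := Q)) => k C mC.
- exact: lawX.
- exact: lawY.
Qed.

Lemma paired_independent : mutually_independent Pr paired.
Proof.
apply: (pair_independent mZ indZ (P := P) (Q := Q)) => k C mC.
- exact: lawX.
- exact: lawY.
Qed.

Lemma prod_paired (f : 'I_N -> T * T -> R) : (forall i, L1 nu (f i)) ->
  L1 Pr (fun w => \prod_(i < N) f i (paired i w)) /\
  \int[Pr]_w (\prod_(i < N) f i (paired i w)) = \prod_(i < N) \int[nu]_z f i z.
Proof.
move=> Lf; have mf i := L1_measurable (Lf i).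
have LZ i : L1 Pr (fun w => f i (paired i w)).
  exact: (L1_law (measurable_paired i) (@paired_law i) (Lf i)).
have u := index_enum_uniq 'I_N; split.
  exact: (L1_prod_indep measurable_paired paired_independent u mf LZ).
rewrite (Rintegral_prod_indep measurable_paired paired_independent u mf LZ).
by apply: eq_bigr => i _; exact: (Rintegral_law (measurable_paired i) (@paired_law i)).
Qed.

End fixed_permutation.

Lemma prod_two_samples N (F G : 'I_N -> T -> R) : (forall i, L1 P (F i)) ->
  (forall i, L1 Q (G i)) ->
  L1 Pr (fun w => (\prod_(i < N) F i (X i w)) * \prod_(i < N) G i (Y i w)) /\
  \int[Pr]_w ((\prod_(i < N) F i (X i w)) * \prod_(i < N) G i (Y i w)) =
  (\prod_(i < N) \int[P]_x F i x) * \prod_(i < N) \int[Q]_y G i y.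
Proof.
move=> LF LG; have L i : L1 nu (fun z => F i z.1 * G i z.2).
  exact: L1_tensor (LF i) (LG i).
have := prod_paired 1 L.
have E w : \prod_(i < N) (F i (paired 1 i w).1 * G i (paired 1 i w).2) =
    (\prod_(i < N) F i (X i w)) * \prod_(i < N) G i (Y i w).
  by rewrite big_split; congr (_ * _); apply: eq_bigr => i _; rewrite /= perm1.
under eq_fun do rewrite E.
move=> [L1 ->]; split=> //; rewrite -big_split; apply: eq_bigr => i _.
exact: Rintegral_tensor (LF i) (LG i).
Qed.

Lemma measurable_DN (xi : T * T -> R) N : measurable_fun setT xi ->
  measurable_fun setT (DN xi X Y N).
Proof.
move=> mxi; apply: measurable_funM => //; apply: measurable_sum => r.
apply: measurable_prod => i _; apply: (measurableT_comp mxi).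
exact: measurable_fun_pair.
Qed.

(** The square of an average over permutations is at most the average of the squares, and for each
    permutation the pairs are i.i.d. from the product law, so every term equals the right-hand side.
    The bound is used at fixed [N], with [eta] approaching [xi]. *)
Lemma sqint_DN_sub (xi eta : T * T -> R) N :
  square_integrable nu xi -> square_integrable nu eta ->
  square_integrable Pr (fun w => DN xi X Y N w - DN eta X Y N w) /\
  \int[Pr]_w ((DN xi X Y N w - DN eta X Y N w) ^+ 2) <=
  (\int[nu]_z (xi z ^+ 2)) ^+ N - 2 * (\int[nu]_z (xi z * eta z)) ^+ N +
  (\int[nu]_z (eta z ^+ 2)) ^+ N.
Proof.
move=> Sxi Seta.
pose p (h : T * T -> R) (r : 'S_N) w := \prod_(i < N) h (paired r i w).
have mp h r : measurable_fun setT h -> measurable_fun setT (p h r).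
  move=> mh; apply: measurable_prod => i _.
  exact: (measurableT_comp mh (measurable_paired r i)).
have pM h h' r : square_integrable nu h -> square_integrable nu h' ->
    L1 Pr (fun w => p h r w * p h' r w) /\
    \int[Pr]_w (p h r w * p h' r w) = (\int[nu]_z (h z * h' z)) ^+ N.
  move=> Sh Sh'.
  have := @prod_paired N r (fun _ z => h z * h' z) (fun=> sqint_mul Sh Sh').
  rewrite prodr_const card_ord.
  by under eq_fun do rewrite big_split.
have Sp h r : square_integrable nu h -> square_integrable Pr (p h r).
  move=> Sh; split; first by apply: mp; case: Sh.
  by under eq_fun do rewrite expr2; case: (pM h h r Sh Sh).
pose D r w := p xi r w - p eta r w.
have SD r : square_integrable Pr (D r) by apply: sqintB; exact: Sp.
have DE w : DN xi X Y N w - DN eta X Y N w = N`!%:R^-1 * \sum_(r : 'S_N) D r w.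
  by rewrite /DN -mulrBr /D sumrB.
have SsD : square_integrable Pr (fun w => \sum_(r : 'S_N) D r w).
  split; first by apply: measurable_sum => r; case: (SD r).
  apply: (L1_le (g := fun w => N`!%:R * \sum_(r : 'S_N) D r w ^+ 2)).
  - by apply: measurable_funX; apply: measurable_sum => r; case: (SD r).
  - move=> w; rewrite ger0_norm ?sqr_ge0//.
    by rewrite -card_Sn; exact: sqr_sum_le_card.
  - by apply: L1Z; apply: L1_sum => r _; case: (SD r).
split; first by under eq_fun do rewrite DE; exact: sqintZ.
set B := leRHS.
have ID r : \int[Pr]_w (D r w ^+ 2) = B.
  rewrite Rintegral_sub_sqr//; [|exact: Sp..].
  under eq_Rintegral do rewrite expr2.
  rewrite (pM _ _ r Sxi Sxi).2 (pM _ _ r Sxi Seta).2.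
  under [X in _ + X = _]eq_Rintegral do rewrite expr2.
  rewrite (pM _ _ r Seta Seta).2 /B.
  by congr (_ ^+ _ - _ + _ ^+ _); apply: eq_Rintegral => z _; rewrite expr2.
have Nf : 0 < N`!%:R :> R by rewrite ltr0n fact_gt0.
apply: (@le_trans _ _ (\int[Pr]_w (N`!%:R^-1 * \sum_(r : 'S_N) D r w ^+ 2))).
  have LR : L1 Pr (fun w => N`!%:R^-1 * \sum_(r : 'S_N) D r w ^+ 2).
    by apply: L1Z; apply: L1_sum => r _; case: (SD r).
  apply: le_Rintegral => //.
  - by under eq_fun do rewrite DE; case: (sqintZ N`!%:R^-1 SsD).
  - move=> w _; rewrite DE exprMn.
    apply: (@le_trans _ _ (N`!%:R^-1 ^+ 2 * (N`!%:R * \sum_(r : 'S_N) D r w ^+ 2))).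
      by apply: ler_wpM2l; [exact: sqr_ge0|rewrite -card_Sn; exact: sqr_sum_le_card].
    by rewrite expr2 -mulrA mulKf ?gt_eqF.
rewrite RintegralZl//; last by apply: L1_sum => r _; case: (SD r).
rewrite Rintegral_sum; last by move=> r _; case: (SD r).
under eq_bigr do rewrite ID.
by rewrite sumr_const card_Sn -[B *+ _]mulr_natl mulKf ?gt_eqF.
Qed.

End paired_samples.

Section second_moment.
Context {dO : measure_display} {Omega : measurableType dO} {R : realType}.
Variable Pr : probability Omega R.
Context {d : measure_display} {T : measurableType d}.
Variables (P Q : probability T R) (X Y : nat -> Omega -> T).
Hypotheses (mX : forall i, measurable_fun setT (X i))
  (mY : forall i, measurable_fun setT (Y i)).
Hypothesis lawX : forall i B, measurable B -> Pr (X i @^-1` B) = P B.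
Hypothesis lawY : forall i B, measurable B -> Pr (Y i @^-1` B) = Q B.
Hypothesis indXY : mutually_independent Pr (join_families X Y).
Local Notation nu := (product_probability P Q).
Variables (xi : T * T -> R) (s : nat -> R) (alpha beta : nat -> T -> R).
Hypothesis Sxi : square_integrable nu xi.
Hypothesis ss : singular_system P Q xi s alpha beta.
Hypothesis s_lt1 : forall k, s k.+1 < 1.
Hypothesis xi_abs : xi = (fun z => `|xi z|) %[ae nu].

Local Notation al := (active s alpha).
Local Notation be := (active s beta).
Local Notation q := (fun k => s k ^+ 2).

Let s_ge0 k : 0 <= s k. Proof. by have /andP[] := ss_bounds ss k. Qed.
Let q_lt1 k : s k.+1 ^+ 2 < 1. Proof. by rewrite expr_lt1. Qed.

Section finite_rank.
Variables N L : nat.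
Local Notation coloring := {ffun 'I_N -> 'I_L.+1}.

Let A (c : coloring) w : R := \prod_(i < N) al (c i) (X i w).
Let B (r : 'S_N) (c : coloring) w : R := \prod_(j < N) be (c ((r^-1)%g j)) (Y j w).
Let M (p : 'S_N * coloring) w : R :=
  (\prod_(i < N) s (p.2 i)) * (A p.2 w * B p.1 p.2 w).

Let DN_M w : DN (kernel_partial s alpha beta L.+1) X Y N w =
  N`!%:R^-1 * \sum_p M p w.
Proof.
rewrite /DN; congr (_ * _).
rewrite -(pair_bigA _ (fun r c => M (r, c) w)) /=; apply: eq_bigr => r _.
rewrite /kernel_partial /= bigA_distr_bigA /=; apply: eq_bigr => c _.
rewrite /M /= !big_split /= /A /B; congr (_ * (_ * _)).
rewrite (reindex_inj (@perm_inj _ (r^-1)%g)) /=.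
by apply: eq_bigr => j _; rewrite permKV.
Qed.

Let G (p p' : 'S_N * coloring) : R := (p.2 == p'.2)%:R *
  ([forall j, p.2 ((p.1^-1)%g j) == p.2 ((p'.1^-1)%g j)]%:R *
   \prod_(i < N) s (p.2 i) ^+ 2).

(** Orthogonality in the X-variables forces the two colorings to be equal; orthogonality in the
    Y-variables then forces c o r^-1 = c o r'^-1. What survives is a count of permutations fixing a
    coloring. *)
Let M_inner p p' : L1 Pr (fun w => M p w * M p' w) /\
  \int[Pr]_w (M p w * M p' w) = G p p'.
Proof.
pose F i x := al (p.2 i) x * al (p'.2 i) x.
pose H j y := be (p.2 ((p.1^-1)%g j)) y * be (p'.2 ((p'.1^-1)%g j)) y.
pose c := (\prod_(i < N) s (p.2 i)) * \prod_(i < N) s (p'.2 i).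
have E w : M p w * M p' w = c *
    ((\prod_(i < N) F i (X i w)) * \prod_(j < N) H j (Y j w)).
  by rewrite /M /A /B /F /H /c !big_split /=; ring.
have LF i : L1 P (F i) by apply: sqint_mul; exact: (sqint_al ss).
have LH j : L1 Q (H j) by apply: sqint_mul; exact: (sqint_be ss).
have [L1p Ep] := prod_two_samples mX mY lawX lawY indXY LF LH.
split; first by under eq_fun do rewrite E; exact: L1Z.
under eq_Rintegral do rewrite E.
rewrite RintegralZl// Ep /G; have [cc|ncc] := eqVneq p.2 p'.2; last first.
  rewrite mul0r [X in _ * (X * _)](_ : _ = 0) ?mul0r ?mulr0//.
  have [i /negbTE ni] : exists i, p.2 i != p'.2 i.
    apply/existsP; rewrite -negb_forall; apply: contra ncc => /forallP h.
    by apply/eqP/ffunP => i; apply/eqP.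
  by rewrite (bigD1 i)//= /F (inner_al ss) val_eqE ni mul0r.
rewrite mul1r /c -cc prodrXl expr2.
(* If an inactive color occurs both sides vanish; otherwise all functions involved have norm 1. *)
have [z|nz] := eqVneq (\prod_(i < N) s (p.2 i)) 0; first by rewrite z !(mul0r, mulr0).
have snz i : s (p.2 i) != 0 by move/prodf_neq0: nz; exact.
rewrite mulrC; congr (_ * _).
rewrite [X in X * _]big1 ?mul1r; last first.
  by move=> i _; rewrite /F -cc (inner_al ss) eqxx snz.
have -> : \prod_(j < N) \int[Q]_y H j y =
    \prod_(j < N) (p.2 ((p.1^-1)%g j) == p.2 ((p'.1^-1)%g j))%:R.
  by apply: eq_bigr => j _; rewrite /H -cc (inner_be ss) val_eqE snz andbT.
case: forallP => [h|/forallP].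
  by rewrite big1// => j _; rewrite h.
by rewrite negb_forall => /existsP[j /negbTE nj]; rewrite (bigD1 j)//= nj mul0r.
Qed.

Lemma second_moment_partial :
  square_integrable Pr (DN (kernel_partial s alpha beta L.+1) X Y N) /\
  \int[Pr]_w (DN (kernel_partial s alpha beta L.+1) X Y N w ^+ 2) <=
  \prod_(k < L) (1 - s k.+1 ^+ 2)^-1.
Proof.
have E w : DN (kernel_partial s alpha beta L.+1) X Y N w ^+ 2 =
    N`!%:R^-1 ^+ 2 * \sum_p \sum_p' M p w * M p' w.
  by rewrite DN_M exprMn [X in _ * X]expr2 big_distrlr.
have L1s : L1 Pr (fun w => \sum_p \sum_p' M p w * M p' w).
  by apply: L1_sum => p _; apply: L1_sum => p' _; case: (M_inner p p').
split.
  split; last by under eq_fun do rewrite E; exact: L1Z.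
  apply: measurable_DN => //.
  by case: (sqint_kernel_partial ss L.+1).
under eq_Rintegral do rewrite E.
rewrite RintegralZl// Rintegral_sum; last first.
  by move=> p _; apply: L1_sum => p' _; case: (M_inner p p').
have sumG p : \int[Pr]_w (\sum_p' M p w * M p' w) = \sum_(r' : 'S_N)
   [forall j, p.2 ((p.1^-1)%g j) == p.2 ((r'^-1)%g j)]%:R * \prod_(i < N) s (p.2 i) ^+ 2.
  rewrite Rintegral_sum; last by move=> p' _; case: (M_inner p p').
  under eq_bigr do rewrite (M_inner _ _).2.
  rewrite -(pair_bigA _ (fun r c => G p (r, c))) /=; apply: eq_bigr => r' _.
  rewrite (bigD1 p.2)//= /G eqxx mul1r [X in _ + X]big1 ?addr0// => c /negbTE.
  by rewrite eq_sym => ->; rewrite mul0r.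
under eq_bigr do rewrite sumG.
rewrite -(pair_bigA _ (fun (r : 'S_N) (c : coloring) => \sum_(r' : 'S_N)
   [forall j, c ((r^-1)%g j) == c ((r'^-1)%g j)]%:R * \prod_(i < N) s (c i) ^+ 2)) /=.
have Nf : 0 < N`!%:R :> R by rewrite ltr0n fact_gt0.
rewrite mulrC -ler_pdivlMr ?exprn_gt0 ?invr_gt0//.
rewrite exprVn invrK.
apply: (@le_trans _ _ (\sum_(r : 'S_N) (N`!%:R * \prod_(k < L) (1 - s k.+1 ^+ 2)^-1))).
  apply: ler_sum => r _; rewrite exchange_big /=.
  (* For fixed [r], the substitution r' = rho^-1 r turns c o r^-1 = c o r'^-1 into c o rho = c.
     Every [r] then gives the same bound, and the two factors [N]! cancel the squared prefactor. *)
  have inj : injective (fun rho : 'S_N => (rho^-1 * r)%g).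
    by move=> a b /= /mulIg /invg_inj.
  rewrite (reindex_inj inj) /=.
  have h := @sum_fixed_colorings R N L q.
  apply: le_trans (h _ _ _); [|by rewrite (ss_s0 ss) expr1n|by move=> k; exact: sqr_ge0|exact: q_lt1].
  apply: ler_sum => rho _; apply: ler_sum => c _; apply: ler_wpM2r.
    by apply: prodr_ge0 => i _; exact: sqr_ge0.
  rewrite ler_nat; case: forallP => [_|nH]; first exact: leq_b1.
  apply/eq_leq/eqP; rewrite eqb0; apply/negP => /forallP H; apply: nH => i.
  have rE : ((rho^-1 * r)^-1)%g (r i) = rho i.
    by apply: (@perm_inj _ (rho^-1 * r)%g); rewrite permKV permM permK.
  have := H (r i); rewrite permK rE.
  by rewrite eq_sym.
by rewrite sumr_const card_Sn -[X in X <= _]mulr_natl mulrA -expr2 mulrC.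
Qed.

End finite_rank.

Lemma sqint_DN N : square_integrable Pr (DN xi X Y N).
Proof.
have [S0 _] := second_moment_partial N 0.
have [SD _] := sqint_DN_sub mX mY lawX lawY indXY N Sxi (sqint_kernel_partial ss 1).
have := sqintD SD S0; congr square_integrable; apply/funext => w.
by rewrite subrK.
Qed.

(** At fixed [N], [D_N] is approximated in L^2 by its analogue for a partial kernel, for which the
    bound is known. *)
Lemma second_moment (C : R) N :
  (forall L, \prod_(k < L) (1 - s k.+1 ^+ 2)^-1 <= C) ->
  \int[Pr]_w (DN xi X Y N w ^+ 2) <= C.
Proof.
move=> PC; have C0 : 0 <= C by apply: le_trans (PC 0); rewrite big_ord0.
apply/ler_addgt0Pr => e e0.
(* Weight in D^2 <= (1 + h) F^2 + (1 + 1/h) (D - F)^2, chosen so that h C <= e / 2; the error [e1]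
   below makes the last term at most e / 2. *)
pose h := e / (2 * (C + 1)).
have h0 : 0 < h by rewrite divr_gt0//; lra.
pose I2 := \int[nu]_z (xi z ^+ 2).
have SC := cvg_sum_sqr Sxi ss xi_abs.
(* For a partial kernel the bound of [sqint_DN_sub] has the form I^N - 2 V + V = I^N - V, which
   tends to 0 by [cvg_sum_sqr]. *)
have cvgerr : I2 ^+ N - (\sum_(k < n) s k ^+ 2) ^+ N @[n --> \oo] --> (0 : R).
  suff : I2 ^+ N - (\sum_(k < n) s k ^+ 2) ^+ N @[n --> \oo] --> I2 ^+ N - I2 ^+ N.
    by rewrite subrr.
  apply: cvgB; first exact: cvg_cst.
  exact: (cvg_comp _ _ SC (@exprn_continuous R N I2)).
have e1 : 0 < e / (2 * (1 + h^-1)).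
  by rewrite divr_gt0// mulr_gt0// addr_gt0// invr_gt0.
have /cvgrPdist_le/(_ _ e1)[n0 _ /(_ n0.+1 (leqnSn n0))] := cvgerr.
rewrite sub0r normrN => herr.
have [S0 B0] := second_moment_partial N n0.
have [SD BD] := sqint_DN_sub mX mY lawX lawY indXY N Sxi (sqint_kernel_partial ss n0.+1).
move: BD; rewrite (inner_kernel_partial Sxi ss) (sqr_kernel_partial ss) -/I2.
set V := _ ^+ N in herr *.
move: (DN _ _ _ _) S0 B0 SD => F S0 B0 SD BD.
have {BD herr} BD : \int[Pr]_w ((DN xi X Y N w - F w) ^+ 2) <= e / (2 * (1 + h^-1)).
  by apply: le_trans herr; apply: le_trans (ler_norm _); lra.
have SDN := sqint_DN N.
have hi : 0 < h^-1 by rewrite invr_gt0.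
apply: (@le_trans _ _ (\int[Pr]_w ((1 + h) * F w ^+ 2 +
    (1 + h^-1) * (DN xi X Y N w - F w) ^+ 2))).
  apply: le_Rintegral => //; first by case: SDN.
    by apply: L1D; apply: L1Z; [case: S0|case: SD].
  move=> w _; rewrite -subr_ge0.
  have -> : (1 + h) * F w ^+ 2 + (1 + h^-1) * (DN xi X Y N w - F w) ^+ 2 -
     DN xi X Y N w ^+ 2 = h^-1 * (h * F w - (DN xi X Y N w - F w)) ^+ 2.
    by field; rewrite gt_eqF.
  by rewrite mulr_ge0 ?sqr_ge0// ltW.
rewrite RintegralD//; [|by apply: L1Z; case: S0|by apply: L1Z; case: SD].
rewrite !RintegralZl//; [|by case: SD|by case: S0].
have P1 : (1 + h) * \int[Pr]_w (F w ^+ 2) <= (1 + h) * C.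
  by apply: ler_wpM2l; [rewrite addr_ge0// ltW|exact: le_trans B0 (PC _)].
have P2 : (1 + h^-1) * \int[Pr]_w ((DN xi X Y N w - F w) ^+ 2) <= e / 2.
  rewrite mulrC -ler_pdivlMr ?addr_gt0//; apply: le_trans BD _.
  by rewrite invfM mulrA.
have P3 : h * C <= e / 2.
  rewrite /h -mulrA -[leRHS]mulr1 -mulrA; apply: ler_wpM2l; first exact: ltW.
  by rewrite mulr1 mulrC ler_pdivrMr; lra.
lra.
Qed.

End second_moment.

(** * Continuous functions of trigonometric polynomials *)

Section modulus.
Context {R : realType}.
Variables (h : R -> R) (M : R).
Hypotheses (ch : continuous h) (hM : forall x, `|h x| <= M).

Lemma uniform_modulus (B e : R) : 0 < e -> exists2 dl : R, 0 < dl &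
  forall x y, `|x| <= B -> `|x - y| <= dl -> `|h x - h y| <= e.
Proof.
move=> e0; have cB : compact `[-B, B]%classic by exact: segment_compact.
have := (@compact_near_coveringP R `[-B, B]%classic).1 cB R (0^'+)
  (fun dl x => forall y, `|x - y| <= dl -> `|h x - h y| <= e) _.
case=> [x _|r /= r0 H].
  have e2 : 0 < e / 2 by rewrite divr_gt0.
  have cx : h y @[y --> x] --> h x by exact: ch.
  have /cvgrPdist_le/(_ _ e2) := cx.
  move=> [r /= r0 H]; exists (ball x (r / 2), [set dl : R | dl < r / 2]).
    split => /=; first by apply: nbhsx_ballx; rewrite divr_gt0.
    by apply: nbhs_right_lt; rewrite divr_gt0.
  move=> [x' dl] /= [bx dlr] y xy.
  rewrite (le_trans (ler_distD (h x) _ _))//.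
  have h1 : `|h x - h x'| <= e / 2.
    by apply: H; rewrite /= (lt_trans bx)// ltr_pdivrMr// ltr_pMr// ltr1n.
  have h2 : `|h x - h y| <= e / 2.
    apply: H => /=; rewrite (le_lt_trans (ler_distD x' _ _))//.
    rewrite [ltRHS](splitr r) ltr_leD// ?(le_trans xy)//; exact: ltW.
  by rewrite [e]splitr lerD// distrC.
exists (r / 2); first by rewrite divr_gt0.
move=> x y xB xy; apply: (H (r / 2) _ _ x _ y xy).
- by rewrite /= sub0r normrN gtr0_norm ?divr_gt0// ltr_pdivrMr// ltr_pMr// ltr1n.
- by rewrite divr_gt0.
- by rewrite /= in_itv/= -ler_norml.
Qed.

(** A continuous bounded [h] need not be uniformly continuous. Large |x| is paid for by e x^2 and
    large |x - y| by C (x - y)^2, so that after integration second moments suffice. *)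
Lemma quadratic_modulus (e : R) : 0 < e -> exists2 C : R, 0 <= C &
  forall x y, `|h x - h y| <= e + C * (x - y) ^+ 2 + e * x ^+ 2.
Proof.
move=> e0; have M0 : 0 <= M by exact: le_trans (hM 0).
(* The trivial bound is 2 M: beyond [B] it is below e x^2, and beyond [dl] it is below C (x - y)^2
   with C = 2 M / dl^2. *)
pose B := Num.sqrt (2 * M / e) + 1.
have [dl dl0 H] := uniform_modulus B e0.
exists (2 * M / dl ^+ 2); first by rewrite divr_ge0 ?mulr_ge0// ?exprn_ge0// ltW.
move=> x y; have C0 : 0 <= 2 * M / dl ^+ 2 * (x - y) ^+ 2.
  apply: mulr_ge0; last exact: sqr_ge0.
  by apply: divr_ge0; [exact: mulr_ge0|exact: sqr_ge0].
have E0 : 0 <= e * x ^+ 2 by rewrite mulr_ge0 ?sqr_ge0// ltW.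
have triv : `|h x - h y| <= 2 * M.
  by rewrite (le_trans (ler_normB _ _))// mulr_natl mulr2n lerD.
have [xB|xB] := leP `|x| B; last first.
  have : 2 * M <= e * x ^+ 2; last by lra.
  rewrite [e * _]mulrC -ler_pdivrMr// -(@sqr_sqrtr _ (2 * M / e)); last first.
    by rewrite divr_ge0 ?mulr_ge0// ltW.
  rewrite -(real_normK (num_real x)); apply: lerXn2r; rewrite ?nnegrE ?sqrtr_ge0//.
  by apply/ltW/(le_lt_trans _ xB); rewrite lerDl.
have [xy|xy] := leP `|x - y| dl; first by have := H x y xB xy; lra.
have : 2 * M <= 2 * M / dl ^+ 2 * (x - y) ^+ 2; last by lra.
rewrite -mulrA ler_peMr ?mulr_ge0// mulrC ler_pdivlMr ?exprn_gt0// mul1r.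
rewrite -(real_normK (num_real (x - y))); apply: lerXn2r; rewrite ?nnegrE ?(ltW dl0)//.
exact: ltW.
Qed.

End modulus.

Section bernstein.
Context {R : realType}.

(* The expectation of [g k] for [k] binomial with parameters [n] and [x]. *)
Fixpoint binomial_mean n (g : nat -> R) (x : R) : R :=
  if n is n'.+1 then
    x * binomial_mean n' (g \o S) x + (1 - x) * binomial_mean n' g x
  else g 0.

Lemma binomial_mean_le n g g' x : 0 <= x <= 1 -> (forall k, g k <= g' k) ->
  binomial_mean n g x <= binomial_mean n g' x.
Proof.
move=> /andP[x0 x1]; elim: n g g' => [|n IH] g g' gg' //=.
have h1 : binomial_mean n (g \o S) x <= binomial_mean n (g' \o S) x.
  by apply: IH => k; exact: gg'.
have h2 := IH _ _ gg'; rewrite lerD// ler_wpM2l// subr_ge0//.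
Qed.

(** Variance plus squared bias. The center [a] is free because a success shifts it by 1 in the
    induction. *)
Lemma binomial_mean_quad n (p c a x : R) :
  binomial_mean n (fun k => p + c * (k%:R - a) ^+ 2) x =
  p + c * (n%:R * x * (1 - x) + (n%:R * x - a) ^+ 2).
Proof.
elim: n a => [|n IH] a /=; first by rewrite !mul0r sub0r add0r.
have -> : (fun k => p + c * (k%:R - a) ^+ 2) \o S =
    fun k => p + c * (k%:R - (a - 1)) ^+ 2.
  by apply/funext => k /=; rewrite -natr1; congr (p + c * _ ^+ 2); ring.
by rewrite !IH -natr1; ring.
Qed.

(** Bernstein approximation: integrating the quadratic bound against the binomial law replaces (y -
    x)^2 by the variance x (1 - x) / (n + 1), which is at most 1 / (n + 1). *)
Lemma binomial_mean_approx n (g : R -> R) (e C x : R) : 0 <= x <= 1 -> 0 <= C ->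
  (forall y, `|g y - g x| <= e + C * (y - x) ^+ 2) ->
  `|binomial_mean n.+1 (fun k => g (k%:R / n.+1%:R)) x - g x| <= e + C / n.+1%:R.
Proof.
move=> x01 C0 H; have n0 : 0 < n.+1%:R :> R by rewrite ltr0n.
set m : R := n.+1%:R in n0 *.
have Q (p c : R) : binomial_mean n.+1
    (fun k => p + c / m ^+ 2 * (k%:R - m * x) ^+ 2) x = p + c * (x * (1 - x) / m).
  by rewrite binomial_mean_quad -/m; field; rewrite gt_eqF.
have E k : (k%:R / m - x) ^+ 2 = m ^- 2 * (k%:R - m * x) ^+ 2.
  by field; rewrite gt_eqF.
have xx : x * (1 - x) <= 1 by move/andP: x01 => [x0 x1]; nra.
have bnd : C * (x * (1 - x) / m) <= C / m.
  by apply: ler_wpM2l => //; rewrite ler_pdivrMr// mulVf ?gt_eqF.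
have up : binomial_mean n.+1 (fun k => g (k%:R / m)) x <= g x + e + C / m.
  apply: le_trans (_ : _ <= (g x + e) + C * (x * (1 - x) / m)) _; last by rewrite lerD2l.
  rewrite -Q; apply: binomial_mean_le => // k.
  have := H (k%:R / m); rewrite E ler_norml mulrA => /andP[_ hh].
  by rewrite -subr_ge0; move: hh; rewrite -subr_ge0; congr (0 <= _); ring.
have lo : g x - e - C / m <= binomial_mean n.+1 (fun k => g (k%:R / m)) x.
  apply: le_trans (_ : _ <= (g x - e) + (- C) * (x * (1 - x) / m)) _.
    by rewrite mulNr lerD2l lerN2.
  rewrite -Q; apply: binomial_mean_le => // k.
  have := H (k%:R / m); rewrite E ler_norml mulrA => /andP[hh _].
  by rewrite -subr_ge0; move: hh; rewrite -subr_ge0; congr (0 <= _); ring.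
move: (binomial_mean _ _ _) (C / m) up lo => b c up lo.
rewrite ler_norml; apply/andP; split; lra.
Qed.

End bernstein.

Section trigonometric_functions.
Context {R : realType}.
Variable K : nat.
Implicit Types (t u a b : nat -> R) (f g : (nat -> R) -> (nat -> R) -> R).

Definition lform t u a b : R := \sum_(k < K) (t k * a k + u k * b k).

(** The phase [th] makes sines a special case of cosines. The class is closed under products by the
    product-to-sum formula, hence under polynomials. *)
Inductive trig : ((nat -> R) -> (nat -> R) -> R) -> Prop :=
| trig_cos th t u : trig (fun a b => cos (th + lform t u a b))
| trigD f g : trig f -> trig g -> trig (fun a b => f a b + g a b)
| trigZ c f : trig f -> trig (fun a b => c * f a b).

Lemma trig_cst (c : R) : trig (fun _ _ => c).
Proof.
have -> : (fun _ _ => c) = fun a b => c * cos (0 + lform (fun=> 0) (fun=> 0) a b).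
  apply/funext => a; apply/funext => b; rewrite /lform big1 ?addr0 ?cos0 ?mulr1//.
  by move=> k _; rewrite !mul0r addr0.
exact/trigZ/trig_cos.
Qed.

Lemma trigM f g : trig f -> trig g -> trig (fun a b => f a b * g a b).
Proof.
move=> tf; elim: tf g => {f} [th t u|f1 f2 _ IH1 _ IH2|c f _ IH] g tg.
- elim: tg => {g} [th' t' u'|g1 g2 _ IH1 _ IH2|c g _ IH].
  + have -> : (fun a b => cos (th + lform t u a b) * cos (th' + lform t' u' a b)) =
      fun a b => 2^-1 * (cos ((th + th') + lform (fun k => t k + t' k) (fun k => u k + u' k) a b) +
        cos ((th - th') + lform (fun k => t k - t' k) (fun k => u k - u' k) a b)).
      apply/funext => a; apply/funext => b.
      have -> : (th + th') + lform (fun k => t k + t' k) (fun k => u k + u' k) a b =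
          (th + lform t u a b) + (th' + lform t' u' a b).
        rewrite /lform addrACA; congr (_ + _); rewrite -big_split /=.
        by apply: eq_bigr => k _; ring.
      have -> : (th - th') + lform (fun k => t k - t' k) (fun k => u k - u' k) a b =
          (th + lform t u a b) - (th' + lform t' u' a b).
        rewrite /lform opprD addrACA; congr (_ + _); rewrite -sumrB /=.
        by apply: eq_bigr => k _; ring.
      move: (th + lform _ _ _ _) (th' + lform _ _ _ _) => A B.
      by rewrite cosD cosB; field.
    by apply/trigZ/trigD; exact: trig_cos.
  + by under eq_fun do under eq_fun do rewrite mulrDr; exact: trigD.
  + by under eq_fun do under eq_fun do rewrite mulrCA; exact: trigZ.
- have := trigD (IH1 _ tg) (IH2 _ tg); congr trig.
  by apply/funext => a; apply/funext => b; rewrite mulrDl.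
- have := trigZ c (IH _ tg); congr trig.
  by apply/funext => a; apply/funext => b; rewrite mulrA.
Qed.

Lemma trigX f n : trig f -> trig (fun a b => f a b ^+ n).
Proof.
move=> tf; elim: n => [|n IH]; first exact: trig_cst.
have := trigM tf IH; congr trig.
by apply/funext => a; apply/funext => b; rewrite exprS.
Qed.

Lemma trig_prod (f_ : nat -> (nat -> R) -> (nat -> R) -> R) n :
  (forall k, (k < n)%N -> trig (f_ k)) -> trig (fun a b => \prod_(k < n) f_ k a b).
Proof.
elim: n => [|n IH] tf.
  have := trig_cst 1; congr trig.
  by apply/funext => a; apply/funext => b; rewrite big_ord0.
have := trigM (IH (fun k kn => tf k (ltnW kn))) (tf n (ltnSn n)); congr trig.
by apply/funext => a; apply/funext => b; rewrite big_ord_recr.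
Qed.

Lemma trig_binomial_mean f n (c : nat -> R) : trig f ->
  trig (fun a b => binomial_mean n c (f a b)).
Proof.
move=> tf; elim: n c => [|n IH] c; first exact: trig_cst.
apply: trigD; first by apply: trigM tf _; exact: IH.
apply: trigM; last exact: IH.
apply: trigD; first exact: trig_cst.
have := trigZ (-1) tf; congr trig.
by apply/funext => a; apply/funext => b; rewrite mulN1r.
Qed.

Lemma trig_bounded f : trig f -> exists2 B, 0 < B & forall a b, `|f a b| <= B.
Proof.
elim=> [th t u|f1 f2 _ [B1 B10 H1] _ [B2 B20 H2]|c {}f _ [B B0 H]].
- by exists 1 => // a b; exact: cos_max.
- exists (B1 + B2); first exact: addr_gt0.
  by move=> a b; rewrite (le_trans (ler_normD _ _))// lerD.
- exists (`|c| * B + 1); first by rewrite ltr_wpDl// mulr_ge0// ltW.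
  by move=> a b; rewrite normrM ler_wpDr// ler_wpM2l.
Qed.

Lemma measurable_trig d (T : measurableType d) (a b : T -> nat -> R) f :
  (forall k, measurable_fun setT (a ^~ k)) ->
  (forall k, measurable_fun setT (b ^~ k)) ->
  trig f -> measurable_fun setT (fun w => f (a w) (b w)).
Proof.
move=> ma mb; elim=> [th t u|f1 f2 _ H1 _ H2|c {}f _ H].
- apply: measurableT_comp; first exact: measurable_cos.
  apply: measurable_funD => //; apply: measurable_sum => k.
  by apply: measurable_funD; exact: measurable_funM.
- exact: measurable_funD.
- exact: measurable_funM.
Qed.

Section transfer.
Context {d d' : measure_display} {T : measurableType d} {T' : measurableType d'}.
Variables (mu : probability T R) (mu' : probability T' R).
Variables (D : nat -> T -> R) (a b : nat -> T -> nat -> R).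
Variables a' b' : T' -> nat -> R.
Hypothesis LD : forall n, L1 mu (D n).
Hypotheses (ma : forall n k, measurable_fun setT (a n ^~ k))
  (mb : forall n k, measurable_fun setT (b n ^~ k))
  (ma' : forall k, measurable_fun setT (a' ^~ k))
  (mb' : forall k, measurable_fun setT (b' ^~ k)).
Hypothesis cvg_cos : forall th t u,
  \int[mu]_w (D n w * cos (th + lform t u (a n w) (b n w))) @[n --> \oo] -->
  \int[mu']_w cos (th + lform t u (a' w) (b' w)).

Lemma L1_trig n f : trig f -> L1 mu (fun w => D n w * f (a n w) (b n w)).
Proof.
move=> tf; have [B _ H] := trig_bounded tf.
by apply: (@L1_bmul _ _ _ _ B) => //; exact: measurable_trig.
Qed.

Lemma L1_trig' f : trig f -> L1 mu' (fun w => f (a' w) (b' w)).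
Proof.
move=> tf; have [B _ H] := trig_bounded tf.
by apply: (@L1_bounded _ _ _ _ B) => //; exact: measurable_trig.
Qed.

(** Used with [D] constantly 1 for the reference limit and with [D] = [D_N] for the tilted one. *)
Lemma cvg_trig f : trig f ->
  \int[mu]_w (D n w * f (a n w) (b n w)) @[n --> \oo] -->
  \int[mu']_w f (a' w) (b' w).
Proof.
elim=> [th t u|f1 f2 t1 H1 t2 H2|c {}f tf H]; first exact: cvg_cos.
- rewrite RintegralD//; [|exact: L1_trig'..].
  have -> : (fun n => \int[mu]_w (D n w * (f1 (a n w) (b n w) + f2 (a n w) (b n w)))) =
      fun n => \int[mu]_w (D n w * f1 (a n w) (b n w)) +
        \int[mu]_w (D n w * f2 (a n w) (b n w)).
    apply/funext => n; rewrite -RintegralD//; [|exact: L1_trig..].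
    by apply: eq_Rintegral => w _; rewrite mulrDr.
  exact: cvgD.
- rewrite RintegralZl//; last exact: L1_trig'.
  have -> : (fun n => \int[mu]_w (D n w * (c * f (a n w) (b n w)))) =
      fun n => c * \int[mu]_w (D n w * f (a n w) (b n w)).
    apply/funext => n; rewrite -RintegralZl//; last exact: L1_trig.
    by apply: eq_Rintegral => w _; rewrite mulrCA.
  by apply: cvgM => //; exact: cvg_cst.
Qed.

End transfer.

End trigonometric_functions.

Section trig_approximation.
Context {R : realType}.

Let r2 : R := (Num.sqrt 2)^-1.
Let r2_sqr : r2 ^+ 2 = 2^-1.
Proof. by rewrite exprVn sqr_sqrtr. Qed.

(* The two exponentials of [mehler s z] in the coordinates [z.1 + z.2] and
   [z.1 - z.2], in the form [(1 + x / n) ^+ n] with [x / n] replaced by a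
   trigonometric polynomial. *)
Definition mehler_approx (s : R) (n : nat) (z : R * R) : R :=
  (Num.sqrt (1 - s ^+ 2))^-1 *
  ((1 + s / (1 + s) / 2 * sin ((z.1 + z.2) * r2 * rsqrt n) ^+ 2) ^+ n *
   cos (Num.sqrt (s / (1 - s)) * ((z.1 - z.2) * r2) * rsqrt n) ^+ n).

(** Factors of a zero singular value are 1 whatever their arguments, so zeroing the inactive
    coordinates leaves the product unchanged. *)
Lemma mehler_approx0 n z : mehler_approx 0 n z = 1.
Proof.
rewrite /mehler_approx expr0n subr0 sqrtr1 invr1 mul0r mul0r mul0r addr0 expr1n.
by rewrite mul0r sqrtr0 !mul0r cos0 expr1n !mul1r.
Qed.

Lemma cvg_mehler_approx s z : 0 <= s < 1 ->
  mehler_approx s n z @[n --> \oo] --> mehler s z.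
Proof.
move=> /andP[s0 s1]; set p := (z.1 + z.2) * r2; set m := (z.1 - z.2) * r2.
have h1 : 1 - s != 0 by rewrite subr_eq0 gt_eqF.
have h2 : 1 + s != 0 by rewrite gt_eqF// ltr_wpDr.
have h3 : 1 - s ^+ 2 != 0.
  by rewrite (_ : 1 - s ^+ 2 = (1 - s) * (1 + s)) ?mulf_neq0//; ring.
have -> : mehler s z = (Num.sqrt (1 - s ^+ 2))^-1 *
   (expR (s / (1 + s) / 2 * p ^+ 2) *
    expR (- ((Num.sqrt (s / (1 - s)) * m) ^+ 2 / 2))).
  rewrite /mehler -expRD; congr (_ * expR _).
  rewrite [(Num.sqrt _ * _) ^+ 2]exprMn sqr_sqrtr; last by rewrite divr_ge0// subr_ge0 ltW.
  rewrite /p /m !exprMn r2_sqr; field.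
  by rewrite h1 h2 h3.
apply: cvgM; first exact: cvg_cst.
apply: cvgM.
  apply: cvg_exprn1D.
  have H : s / (1 + s) / 2 * (n%:R * sin (p * rsqrt n) ^+ 2) @[n --> \oo] -->
      s / (1 + s) / 2 * p ^+ 2.
    by apply: cvgM; [exact: cvg_cst|exact: cvg_scaled_sin].
  suff E : (fun n => n%:R * (s / (1 + s) / 2 * sin (p * rsqrt n) ^+ 2)) =
      fun n => s / (1 + s) / 2 * (n%:R * sin (p * rsqrt n) ^+ 2).
    by move: H; rewrite -E; exact.
  by apply/funext => n; rewrite mulrCA.
have H := cvg_exprn1D (@cvg_scaled_cos R (Num.sqrt (s / (1 - s)) * m)).
suff E : (fun n => cos (Num.sqrt (s / (1 - s)) * m * rsqrt n) ^+ n) =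
    fun n => (1 + (cos (Num.sqrt (s / (1 - s)) * m * rsqrt n) - 1)) ^+ n.
  by move: H; rewrite -E; exact.
by apply/funext => n; congr (_ ^+ n); ring.
Qed.

(** Uniform in [n], as dominated convergence requires: 1 + y <= exp y, n sin^2 (p / sqrt n) <= p^2,
    and the cosine factor is at most 1 in absolute value. *)
Lemma mehler_approx_bound s n z : 0 <= s < 1 ->
  `|mehler_approx s n z| <= mehler_bound s z.
Proof.
move=> /andP[s0 s1]; rewrite /mehler_approx /mehler_bound normrM.
rewrite ger0_norm ?invr_ge0 ?sqrtr_ge0//.
apply: ler_wpM2l; first by rewrite invr_ge0 sqrtr_ge0.
set p := (z.1 + z.2) * r2.
have lam : 0 <= s / (1 + s) / 2 by rewrite !divr_ge0// addr_ge0.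
rewrite normrM -[leRHS]mulr1; apply: ler_pM => //; last first.
  by rewrite normrX exprn_ile1// cos_max.
have y0 : 0 <= s / (1 + s) / 2 * sin (p * rsqrt n) ^+ 2.
  by rewrite mulr_ge0// sqr_ge0.
rewrite ger0_norm; last by rewrite exprn_ge0// addr_ge0.
apply: (@le_trans _ _ (expR (s / (1 + s) / 2 * sin (p * rsqrt n) ^+ 2) ^+ n)).
  by apply: lerXn2r; rewrite ?nnegrE ?addr_ge0 ?expR_ge0 ?expR_ge1Dx.
rewrite -expRM_natl ler_expR.
have -> : s / (1 + s) * (z.1 + z.2) ^+ 2 / 4 = s / (1 + s) / 2 * p ^+ 2.
  by rewrite /p exprMn r2_sqr; field; rewrite gt_eqF// ltr_wpDr.
rewrite mulrCA; apply: ler_wpM2l => //.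
apply: le_trans (rsqrtK_le n p); apply: ler_wpM2l => //.
rewrite -(real_normK (num_real (sin _))) -(real_normK (num_real (p * _))).
by apply: lerXn2r; rewrite ?nnegrE// normr_sin_le.
Qed.

Lemma trig_mehler_approx K k s n : (k < K)%N ->
  trig K (fun a b => mehler_approx s n (a k, b k)).
Proof.
move=> kK; pose e (c : R) (j : nat) : R := if j == k then c else 0.
have lf c c' (a b : nat -> R) : lform K (e c) (e c') a b = c * a k + c' * b k.
  rewrite /lform (bigD1 (Ordinal kK))//= /e eqxx big1 ?addr0// => j jk.
  by move: jk; rewrite -val_eqE /= => /negbTE ->; rewrite !mul0r addr0.
have tcos (th c c' : R) : trig K (fun a b => cos (th + (c * a k + c' * b k))).
  have := @trig_cos R K th (e c) (e c'); congr trig.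
  by apply/funext => a; apply/funext => b; rewrite lf.
apply: trigZ; apply: trigM; apply: trigX.
  apply: trigD; first exact: trig_cst.
  apply: trigZ.
  have := trigD (trig_cst K 1) (trigZ (-1) (trigX 2 (tcos 0 (r2 * rsqrt n) (r2 * rsqrt n)))).
  congr trig; apply/funext => a; apply/funext => b /=.
  rewrite add0r mulN1r -sin2cos2; congr (sin _ ^+ 2); ring.
have := tcos 0 (Num.sqrt (s / (1 - s)) * r2 * rsqrt n)
  (- (Num.sqrt (s / (1 - s)) * r2 * rsqrt n)); congr trig.
apply/funext => a; apply/funext => b /=.
by rewrite add0r; congr cos; ring.
Qed.

End trig_approximation.

Section gaussian_limit.
Context {R : realType}.
Local Notation gamma := (normal_prob (0 : R) 1).

Lemma normal_pair_cos (p q c : R) :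
  \int[(gamma \x gamma)%E]_z cos (c + (p * z.1 + q * z.2)) =
  expR (- ((p ^+ 2 + q ^+ 2) / 2)) * cos c.
Proof.
have mcos : measurable_fun setT (fun z : R * R => cos (c + (p * z.1 + q * z.2))).
  apply: measurableT_comp; first exact: measurable_cos.
  by apply: measurable_funD => //; apply: measurable_funD; exact: measurable_funM.
transitivity (\int[gamma]_x \int[gamma]_y cos (c + (p * x + q * y))).
  apply/esym/(@Rfubini1 _ _ _ _ _ gamma gamma (fun z => cos (c + (p * z.1 + q * z.2)))).
  by apply: (@L1_bounded _ _ _ _ 1) => // z; exact: cos_max.
have E x y : cos (c + (p * x + q * y)) = cos (y * q + (x * p + c)).
  by congr cos; ring.
under eq_Rintegral do (under eq_Rintegral do rewrite E).
under eq_Rintegral do rewrite normal_cos.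
rewrite RintegralZl//; last first.
  apply: (@L1_bounded _ _ _ _ 1); last by move=> x; exact: cos_max.
  apply: measurableT_comp; first exact: measurable_cos.
  by apply: measurable_funD => //; exact: measurable_funM.
by rewrite normal_cos mulrA -expRD; congr (expR _ * _); field.
Qed.

Context {d : measure_display} {Omega : measurableType d}.
Variable Pr : probability Omega R.
Variables U V : nat -> Omega -> R.
Hypotheses (mU : forall i, measurable_fun setT (U i))
  (mV : forall i, measurable_fun setT (V i)).
Hypothesis lawU : forall i B, measurable B -> Pr (U i @^-1` B) = gamma B.
Hypothesis lawV : forall i B, measurable B -> Pr (V i @^-1` B) = gamma B.
Hypothesis indUV : mutually_independent Pr (join_families U V).

Lemma Rintegral_cos_normal K (p q : nat -> R) th :
  \int[Pr]_w cos (th + \sum_(k < K) (p k * U k w + q k * V k w)) =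
  expR (- ((\sum_(k < K) (p k ^+ 2 + q k ^+ 2)) / 2)) * cos th.
Proof.
pose W (k : 'I_K) := paired U V 1 k.
have mW (k : 'I_K) : measurable_fun setT (W k) by exact: measurable_paired.
have lawW (k : 'I_K) B : measurable B -> Pr (W k @^-1` B) = (gamma \x gamma)%E B.
  exact: (@paired_law _ _ _ Pr _ _ gamma gamma _ _ mU mV lawU lawV indUV).
have indW : mutually_independent Pr W.
  exact: (@paired_independent _ _ _ Pr _ _ gamma gamma _ _ mU mV lawU lawV indUV).
pose z (k : 'I_K) (x : R * R) := p k * x.1 + q k * x.2.
have mz k : measurable_fun setT (z k) by apply: measurable_funD; exact: measurable_funM.
have mcz k : measurable_fun setT (fun x => cos (z k x)).
  by apply: measurableT_comp; [exact: measurable_cos|exact: mz].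
have msz k : measurable_fun setT (fun x => sin (z k x)).
  by apply: measurableT_comp; [exact: measurable_sin|exact: mz].
have [_ + _] := @trig_moments R _ _ Pr _ _ _ W mW indW (fun _ _ => 1) z
  (fun _ => measurable_cst _) mz (fun _ => L1_cst Pr 1) th _ (index_enum_uniq 'I_K).
have -> : [seq (\int[Pr]_w (1 * cos (z k (W k w))), \int[Pr]_w (1 * sin (z k (W k w))))
    | k <- index_enum 'I_K] =
    [seq (c, 0) | c <- [seq expR (- ((p (k : 'I_K) ^+ 2 + q (k : 'I_K) ^+ 2) / 2)) | k <- index_enum 'I_K]].
  rewrite -map_comp; apply: eq_map => k /=; congr (_, _).
    under eq_Rintegral do rewrite mul1r.
    rewrite (@Rintegral_law _ _ _ _ _ Pr (gamma \x gamma)%E _ (mW k) (lawW k) (fun x => cos (z k x))); last first.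
      apply: (@L1_bounded _ _ _ _ 1); last by move=> x; exact: cos_max.
      exact: mcz.
    transitivity (\int[(gamma \x gamma)%E]_x cos (0 + (p k * x.1 + q k * x.2))).
      by apply: eq_Rintegral => x _; rewrite add0r.
    by rewrite normal_pair_cos cos0 mulr1.
  under eq_Rintegral do rewrite mul1r.
  rewrite (@Rintegral_law _ _ _ _ _ Pr (gamma \x gamma)%E _ (mW k) (lawW k) (fun x => sin (z k x))); last first.
    apply: (@L1_bounded _ _ _ _ 1); last by move=> x; exact: sin_max.
    exact: msz.
  (* The sine is a cosine of phase - pi / 2, and cos (- pi / 2) = 0. *)
  transitivity (\int[(gamma \x gamma)%E]_x cos (- (pi / 2) + (p k * x.1 + q k * x.2))).
    by apply: eq_Rintegral => x _; rewrite addrC cosBpihalf.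
  by rewrite normal_pair_cos cosN cos_pihalf mulr0.
rewrite rotate0 /= big_map -expR_sum => H.
transitivity (\int[Pr]_w (\prod_(k < K) 1 * cos (th + \sum_(k < K) z k (W k w)))).
  apply: eq_Rintegral => w _; rewrite [X in _ = X * _]big1// mul1r; congr (cos (_ + _)).
  by apply: eq_bigr => k _; rewrite /z /W /paired /= perm1.
by rewrite H sumrN mulr_suml.
Qed.

Variable s : nat -> R.
Hypothesis s01 : forall k, 0 <= s k.+1 < 1.
Variable K : nat.

(** The factor mirrors [active]: the statistics of a zero singular value vanish identically, and so
    must their limits. *)
Definition normal_first w k : R := (s k.+1 != 0)%:R * U k w.
Definition normal_second w k : R := (s k.+1 != 0)%:R * V k w.
Definition correlated_second w k : R :=
  (s k.+1 != 0)%:R * (correlate (s k.+1) (U k w, V k w)).2.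

Let idem k : (s k.+1 != 0)%:R ^+ 2 = (s k.+1 != 0)%:R :> R.
Proof. by case: eqP => _; rewrite ?expr0n ?expr1n. Qed.

Lemma cos_normal th t u :
  \int[Pr]_w cos (th + lform K t u (normal_first w) (normal_second w)) =
  expR (- ((\sum_(k < K) (s k.+1 != 0)%:R * (t k ^+ 2 + u k ^+ 2)) / 2)) * cos th.
Proof.
have := Rintegral_cos_normal K (fun k => t k * (s k.+1 != 0)%:R)
  (fun k => u k * (s k.+1 != 0)%:R) th.
under eq_bigr do rewrite !exprMn idem -mulrDl mulrC; move=> <-.
apply: eq_Rintegral => w _; congr (cos (_ + _)); apply: eq_bigr => k _.
by rewrite /normal_first /normal_second !mulrA.
Qed.

Lemma cos_correlated th t u :
  \int[Pr]_w cos (th + lform K t u (normal_first w) (correlated_second w)) =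
  expR (- ((\sum_(k < K) ((s k.+1 != 0)%:R * (t k ^+ 2 + u k ^+ 2) +
    2 * t k * u k * s k.+1)) / 2)) * cos th.
Proof.
have := Rintegral_cos_normal K
  (fun k => (s k.+1 != 0)%:R * (t k + u k * s k.+1))
  (fun k => (s k.+1 != 0)%:R * (u k * Num.sqrt (1 - s k.+1 ^+ 2))) th.
have E k : ((s k.+1 != 0)%:R * (t k + u k * s k.+1)) ^+ 2 +
    ((s k.+1 != 0)%:R * (u k * Num.sqrt (1 - s k.+1 ^+ 2))) ^+ 2 =
    (s k.+1 != 0)%:R * (t k ^+ 2 + u k ^+ 2) + 2 * t k * u k * s k.+1.
  have /andP[s0 s1] := s01 k.
  have q : 0 <= 1 - s k.+1 ^+ 2 by rewrite subr_ge0 expr_le1// ltW.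
  rewrite !exprMn idem sqr_sqrtr//; have [->|_] := eqVneq (s k.+1) 0.
    by rewrite !mul0r mulr0 addr0.
  by rewrite !mul1r; ring.
under eq_bigr do rewrite E; move=> <-.
apply: eq_Rintegral => w _; congr (cos (_ + _)); apply: eq_bigr => k _.
by rewrite /normal_first /correlated_second /correlate /=; ring.
Qed.

(** The bounded function psi; as [n] grows it approaches the product of the first [K] Mehler
    kernels. *)
Definition mehler_trig n (a b : nat -> R) : R :=
  \prod_(k < K) mehler_approx (s k.+1) n (a k, b k).

Lemma trig_mehler_trig n : trig K (mehler_trig n).
Proof.
by apply: (@trig_prod R K (fun k a b => mehler_approx (s k.+1) n (a k, b k))) => k kK;
  exact: trig_mehler_approx.
Qed.

Lemma mehler_trig_normal n w : mehler_trig n (normal_first w) (normal_second w) =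
  \prod_(k < K) mehler_approx (s k.+1) n (U k w, V k w).
Proof.
apply: eq_bigr => k _; rewrite /normal_first /normal_second.
by have [->|_] := eqVneq (s k.+1) 0; rewrite ?mehler_approx0 ?mul1r.
Qed.

Lemma mehler_trig_correlated n w :
  mehler_trig n (normal_first w) (correlated_second w) =
  \prod_(k < K) mehler_approx (s k.+1) n (correlate (s k.+1) (U k w, V k w)).
Proof.
apply: eq_bigr => k _; rewrite /normal_first /correlated_second.
by have [->|_] := eqVneq (s k.+1) 0; rewrite ?mehler_approx0 ?mul1r.
Qed.

Definition mehler_prod w : R := \prod_(k < K) mehler (s k.+1) (U k w, V k w).

Let cvg_prod (f_ : nat -> nat -> R) (f : nat -> R) M :
  (forall k, f_ k n @[n --> \oo] --> f k) ->
  \prod_(k < M) f_ k n @[n --> \oo] --> \prod_(k < M) f k.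
Proof.
move=> H; elim: M => [|M IH].
  rewrite big_ord0; under [X in X @ _ --> _]eq_fun do rewrite big_ord0.
  exact: cvg_cst.
rewrite big_ord_recr; under [X in X @ _ --> _]eq_fun do rewrite big_ord_recr.
by apply: cvgM => //; exact: H.
Qed.

Lemma cvg_mehler_trig w :
  mehler_trig n (normal_first w) (normal_second w) @[n --> \oo] --> mehler_prod w.
Proof.
rewrite (funext (mehler_trig_normal^~ w)).
by apply: (@cvg_prod (fun k n => mehler_approx (s k.+1) n (U k w, V k w))
  (fun k => mehler (s k.+1) (U k w, V k w)) K) => k; exact: cvg_mehler_approx.
Qed.

Let mUV k : measurable_fun setT (fun w => (U k w, V k w)).
Proof. exact: measurable_fun_pair. Qed.

Lemma measurable_mehler_prod : measurable_fun setT mehler_prod.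
Proof.
apply: measurable_prod => k _; apply: measurableT_comp (mUV k).
exact: measurable_mehler.
Qed.

Let mapprox k n : measurable_fun setT (mehler_approx (s k.+1) n).
Proof.
apply: (@measurable_trig R 1 _ _ (fun z _ => z.1) (fun z _ => z.2)
  (fun a b => mehler_approx (s k.+1) n (a 0, b 0))).
- by move=> _; exact: measurable_fst.
- by move=> _; exact: measurable_snd.
- exact: trig_mehler_approx.
Qed.

Let prod_law (f : nat -> R * R -> R) : (forall k, L1 (gamma \x gamma)%E (f k)) ->
  L1 Pr (fun w => \prod_(k < K) f k (U k w, V k w)) /\
  \int[Pr]_w (\prod_(k < K) f k (U k w, V k w)) =
  \prod_(k < K) \int[(gamma \x gamma)%E]_z f k z.
Proof.
move=> Lf.
have := @prod_paired _ _ _ Pr _ _ gamma gamma _ _ mU mV lawU lawV indUV K 1 (fun k : 'I_K => f k) (fun k => Lf k).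
have E w : \prod_(k < K) f k (paired U V 1 k w) = \prod_(k < K) f k (U k w, V k w).
  by apply: eq_bigr => k _; rewrite /paired perm1.
by under eq_fun do rewrite E.
Qed.

Let dominated (f_ : nat -> nat -> R * R -> R) (f g : nat -> R * R -> R) :
  (forall k n, measurable_fun setT (f_ k n)) ->
  (forall k, measurable_fun setT (f k)) ->
  (forall k z, f_ k n z @[n --> \oo] --> f k z) ->
  (forall k n z, `|f_ k n z| <= g k z) ->
  (forall k, L1 (gamma \x gamma)%E (g k)) ->
  (forall k, L1 (gamma \x gamma)%E (f k)) ->
  \int[Pr]_w (\prod_(k < K) f_ k n (U k w, V k w)) @[n --> \oo] -->
  \prod_(k < K) \int[(gamma \x gamma)%E]_z f k z.
Proof.
move=> mf_ mf cf fg Lg Lf; rewrite -(prod_law Lf).2.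
apply: (@Rintegral_dct _ _ _ Pr (fun n w => \prod_(k < K) f_ k n (U k w, V k w))
  (fun w => \prod_(k < K) f k (U k w, V k w))
  (fun w => \prod_(k < K) g k (U k w, V k w)) _ _ _ _ _).2.
- by move=> n; apply: measurable_prod => k _; exact: measurableT_comp (mUV k).
- by apply: measurable_prod => k _; exact: measurableT_comp (mUV k).
- apply: aeW => w.
  exact: (cvg_prod (f_ := fun k n => f_ k n (U k w, V k w))
    (f := fun k => f k (U k w, V k w))).
- exact: (prod_law Lg).1.
- by move=> n w; rewrite normr_prod; apply: ler_prod => k _; rewrite normr_ge0/=.
Qed.

Lemma cvg_sqr_mehler_trig :
  \int[Pr]_w (mehler_trig n (normal_first w) (normal_second w) ^+ 2) @[n --> \oo] -->
  \prod_(k < K) (1 - s k.+1 ^+ 2)^-1.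
Proof.
have := @dominated (fun k n z => mehler_approx (s k.+1) n z ^+ 2)
  (fun k z => mehler (s k.+1) z ^+ 2) (fun k z => mehler_bound (s k.+1) z ^+ 2).
under [X in _ -> _ -> _ -> _ -> _ -> _ -> _ --> X]eq_bigr do rewrite Rintegral_mehler_sqr//.
under [X in _ -> _ -> _ -> _ -> _ -> _ -> X @ _ --> _]eq_fun => n.
  under eq_Rintegral => w _ do rewrite prodrXl -mehler_trig_normal.
  over.
apply.
- by move=> k n; apply: measurable_funX; exact: mapprox.
- by move=> k; apply: measurable_funX; exact: measurable_mehler.
- by move=> k z; apply: cvgM; exact: cvg_mehler_approx.
- move=> k n z; rewrite normrX; apply: lerXn2r; rewrite ?nnegrE ?mehler_approx_bound//.
  exact: le_trans (mehler_approx_bound n z (s01 k)).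
- by move=> k; exact: L1_mehler_bound_sqr.
- by move=> k; exact: L1_mehler_sqr.
Qed.

Lemma cvg_mehler_trig_correlated :
  \int[Pr]_w mehler_trig n (normal_first w) (correlated_second w) @[n --> \oo] -->
  \prod_(k < K) (1 - s k.+1 ^+ 2)^-1.
Proof.
have := @dominated (fun k n z => mehler_approx (s k.+1) n (correlate (s k.+1) z))
  (fun k z => mehler (s k.+1) (correlate (s k.+1) z))
  (fun k z => mehler_bound (s k.+1) (correlate (s k.+1) z)).
under [X in _ -> _ -> _ -> _ -> _ -> _ -> _ --> X]eq_bigr do rewrite Rintegral_mehler_correlate//.
under [X in _ -> _ -> _ -> _ -> _ -> _ -> X @ _ --> _]eq_fun => n.
  under eq_Rintegral => w _ do rewrite -mehler_trig_correlated.
  over.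
apply.
- by move=> k n; apply: (measurableT_comp (mapprox k n)); exact: measurable_correlate.
- by move=> k; apply: measurableT_comp; [exact: measurable_mehler|exact: measurable_correlate].
- by move=> k z; exact: cvg_mehler_approx.
- by move=> k n z; exact: mehler_approx_bound.
- by move=> k; exact: L1_mehler_bound_correlate.
- by move=> k; exact: L1_mehler_correlate.
Qed.

End gaussian_limit.

(** * Weighted and unweighted limits of the linear statistics *)

Section sample_limit.
Context {dO : measure_display} {Omega : measurableType dO} {R : realType}.
Variable Pr : probability Omega R.
Context {d : measure_display} {T : measurableType d}.
Variables (P Q : probability T R) (X Y : nat -> Omega -> T).
Hypotheses (mX : forall i, measurable_fun setT (X i))
  (mY : forall i, measurable_fun setT (Y i)).
Hypothesis lawX : forall i B, measurable B -> Pr (X i @^-1` B) = P B.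
Hypothesis lawY : forall i B, measurable B -> Pr (Y i @^-1` B) = Q B.
Hypothesis indXY : mutually_independent Pr (join_families X Y).
Local Notation nu := (product_probability P Q).
Variables (xi : T * T -> R) (s : nat -> R) (alpha beta : nat -> T -> R).
Hypothesis Sxi : square_integrable nu xi.
Hypothesis ss : singular_system P Q xi s alpha beta.
Variable mu : probability (T * T)%type R.
Hypothesis mu_fst : forall A, measurable A -> mu (fst @^-1` A) = P A.
Hypothesis mu_snd : forall A, measurable A -> mu (snd @^-1` A) = Q A.
Hypothesis xi_mu : forall F : T * T -> R, L1 mu F ->
  L1 nu (fun z => xi z * F z) /\ \int[nu]_z (xi z * F z) = \int[mu]_z F z.
Hypothesis norm_xi1 : \int[nu]_z `|xi z| = 1.

Definition first_stat N w k : R :=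
  rsqrt N * \sum_(i < N) active s alpha k.+1 (X i w).
Definition second_stat N w k : R :=
  rsqrt N * \sum_(i < N) active s beta k.+1 (Y i w).

Lemma measurable_first_stat N k : measurable_fun setT (first_stat N ^~ k).
Proof.
apply: measurable_funM => //; apply: measurable_sum => i.
by apply: (measurableT_comp _ (mX i)); case: (sqint_al ss k.+1).
Qed.

Lemma measurable_second_stat N k : measurable_fun setT (second_stat N ^~ k).
Proof.
apply: measurable_funM => //; apply: measurable_sum => i.
by apply: (measurableT_comp _ (mY i)); case: (sqint_be ss k.+1).
Qed.

Variable K : nat.

Let lin (t u : nat -> R) := linear_stat s alpha beta t u K.

(** The linear form is symmetric in the Y-sample, so it can be written along the pairs of any
    permutation. In each term of [D_N] the trigonometric factor therefore splits over the same pairs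
    as the product of densities. *)
Lemma lform_stat N (r : 'S_N) t u w :
  lform K t u (first_stat N w) (second_stat N w) =
  \sum_(i < N) lin t u (paired X Y r i w) * rsqrt N.
Proof.
rewrite -mulr_suml /lin /linear_stat exchange_big /= mulr_suml.
apply: eq_bigr => k _; rewrite big_split /= -!mulr_sumr.
rewrite /first_stat /second_stat [in LHS](reindex_inj (@perm_inj _ r)) /=.
rewrite [X in _ + u k * (_ * X) = _](reindex_inj (@perm_inj _ r)) /=.
by rewrite [in LHS](reindex_inj (@perm_inj _ (r^-1)%g)) /=; under eq_bigr do rewrite permKV; ring.
Qed.

Let mlin t u : measurable_fun setT (lin t u).
Proof.
by case: (sqint_linear_stat ss mu_fst mu_snd t u K).
Qed.

(** The value does not depend on [r], so averaging over all permutations does not change it. *)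
Lemma permutation_moment (g : T * T -> R) N (r : 'S_N) t u th : L1 nu g ->
  L1 Pr (fun w => \prod_(i < N) g (paired X Y r i w) *
    cos (th + lform K t u (first_stat N w) (second_stat N w))) /\
  \int[Pr]_w (\prod_(i < N) g (paired X Y r i w) *
    cos (th + lform K t u (first_stat N w) (second_stat N w))) =
  (rotate th (nseq N (\int[nu]_z (g z * cos (lin t u z * rsqrt N)),
     \int[nu]_z (g z * sin (lin t u z * rsqrt N))))).1.
Proof.
move=> Lg; have mg := L1_measurable Lg.
have mW (i : 'I_N) := measurable_paired mX mY r i.
have lW (i : 'I_N) := @paired_law _ _ _ Pr _ _ P Q _ _ mX mY lawX lawY indXY N r i.
have iW := @paired_independent _ _ _ Pr _ _ P Q _ _ mX mY lawX lawY indXY N r.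
have mz : measurable_fun setT (fun z => lin t u z * rsqrt N).
  by apply: measurable_funM => //; exact: mlin.
have Lg' i : L1 Pr (fun w => g (paired X Y r i w)) by exact: (L1_law (mW i) (lW i) Lg).
have [L E _] := @trig_moments R _ _ Pr _ _ _ (paired X Y r) mW iW
  (fun=> g) (fun _ z => lin t u z * rsqrt N) (fun=> mg) (fun=> mz) Lg' th _
  (index_enum_uniq 'I_N).
have cE w : th + lform K t u (first_stat N w) (second_stat N w) =
    th + \sum_(i < N) lin t u (paired X Y r i w) * rsqrt N by rewrite (lform_stat r).
split; first by under eq_fun do rewrite cE; exact: L.
under eq_Rintegral do rewrite cE.
rewrite E; congr (rotate th _).1.
have Lc (f : T * T -> R) : measurable_fun setT f -> (forall z, `|f z| <= 1) ->
    L1 nu (fun z => g z * f z) by move=> mf f1; apply: (@L1_bmul _ _ _ _ 1).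
have mc : measurable_fun setT (fun z => cos (lin t u z * rsqrt N)).
  by apply: measurableT_comp mz; exact: measurable_cos.
have ms : measurable_fun setT (fun z => sin (lin t u z * rsqrt N)).
  by apply: measurableT_comp mz; exact: measurable_sin.
transitivity [seq (\int[nu]_z (g z * cos (lin t u z * rsqrt N)),
     \int[nu]_z (g z * sin (lin t u z * rsqrt N))) | _ <- index_enum 'I_N].
  apply: eq_map => i; congr (_, _).
    apply: (Rintegral_law (mW i) (lW i) (f := fun z => g z * cos (lin t u z * rsqrt N))).
    by apply: Lc => // z; exact: cos_max.
  apply: (Rintegral_law (mW i) (lW i) (f := fun z => g z * sin (lin t u z * rsqrt N))).
  by apply: Lc => // z; exact: sin_max.
have nE (A : Type) (c : A) (l : seq 'I_N) : [seq c | _ <- l] = nseq (size l) c.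
  by elim: l => //= _ l ->.
by rewrite nE -sum1_size sum1_card card_ord.
Qed.

Lemma sqint_marginal1 (m : probability (T * T)%type R) (f : T -> R) :
  (forall A, measurable A -> m (fst @^-1` A) = P A) ->
  square_integrable P f -> square_integrable m (fun z => f z.1).
Proof.
move=> m1 [mf Lf]; split; first exact: (measurableT_comp mf measurable_fst).
exact: (L1_law measurable_fst m1 Lf).
Qed.

Lemma sqint_marginal2 (m : probability (T * T)%type R) (f : T -> R) :
  (forall A, measurable A -> m (snd @^-1` A) = Q A) ->
  square_integrable Q f -> square_integrable m (fun z => f z.2).
Proof.
move=> m2 [mf Lf]; split; first exact: (measurableT_comp mf measurable_snd).
exact: (L1_law measurable_snd m2 Lf).
Qed.

Let cross_mu j k :
  \int[mu]_z (active s alpha j.+1 z.1 * active s beta k.+1 z.2) = s k.+1 * (j == k)%:R.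
Proof.
have L : L1 mu (fun z => active s alpha j.+1 z.1 * active s beta k.+1 z.2).
  apply: sqint_mul.
    by apply: (@sqint_marginal1 mu _ mu_fst); exact: (sqint_al ss).
  by apply: (@sqint_marginal2 mu _ mu_snd); exact: (sqint_be ss).
rewrite -(xi_mu L).2 (inner_kernel Sxi ss) eqSS.
by have [->|_] := eqVneq j k; rewrite ?mulr0.
Qed.

Let nu_fst A : measurable A -> nu (fst @^-1` A) = P A.
Proof.
move=> mA; rewrite -setXT /product_probability /= product_measure1E//.
transitivity (P A * 1)%E; last by rewrite mule1.
by congr (_ * _)%E; exact: probability_setT.
Qed.

Let nu_snd A : measurable A -> nu (snd @^-1` A) = Q A.
Proof.
move=> mA; rewrite -setTX /product_probability /= product_measure1E//.
transitivity (1 * Q A)%E; last by rewrite mul1e.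
by congr (_ * _)%E; exact: probability_setT.
Qed.

Let cross_nu j k :
  \int[nu]_z (active s alpha j.+1 z.1 * active s beta k.+1 z.2) = 0 * (j == k)%:R.
Proof.
rewrite mul0r (Rintegral_tensor (sqint_L1 (sqint_al ss j.+1)) (sqint_L1 (sqint_be ss k.+1))).
by rewrite (mean_al ss) mul0r.
Qed.

(** [cvg_rotate] with the weight [xi]: integrals against [xi] under the product law are integrals
    under mu, where the covariance of the k-th pair of functions is [s k.+1]. *)
Lemma cvg_weighted_cos t u th :
  \int[Pr]_w (DN xi X Y N w * cos (th + lform K t u (first_stat N w) (second_stat N w)))
    @[N --> \oo] -->
  expR (- ((\sum_(k < K) ((s k.+1 != 0)%:R * (t k ^+ 2 + u k ^+ 2) +
    2 * t k * u k * s k.+1)) / 2)) * cos th.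
Proof.
have Sl := sqint_linear_stat ss mu_fst mu_snd t u K.
have [L1xi E1] := xi_mu (L1_cst mu 1).
have Lxi : L1 nu xi by move: L1xi; under eq_fun do rewrite mulr1.
have Exi : \int[nu]_z xi z = 1.
  by move: E1; rewrite Rintegral_cst1 => <-; apply: eq_Rintegral => z _; rewrite mulr1.
have [L2 E2] := xi_mu Sl.2.
have [_ E3] := xi_mu (sqint_L1 Sl).
have V0 : 0 <= \int[nu]_z (xi z * lin t u z ^+ 2).
  by rewrite E2; apply: Rintegral_ge0 => z _; exact: sqr_ge0.
have E3' : \int[nu]_z (xi z * lin t u z) = 0.
  by rewrite E3 (mean_linear_stat ss mu_fst mu_snd).
have := @cvg_rotate _ _ _ nu xi (lin t u) Lxi (mlin t u) L2 Exi norm_xi1 E3' V0 th.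
rewrite E2 (var_linear_stat ss mu_fst mu_snd t u cross_mu).
move=> H.
suff E N : (rotate th (nseq N (\int[nu]_z (xi z * cos (lin t u z * rsqrt N)),
    \int[nu]_z (xi z * sin (lin t u z * rsqrt N))))).1 =
    \int[Pr]_w (DN xi X Y N w * cos (th + lform K t u (first_stat N w) (second_stat N w))).
  by rewrite -(funext E); exact: H.
pose I0 := \int[Pr]_w (\prod_(i < N) xi (paired X Y 1 i w) *
    cos (th + lform K t u (first_stat N w) (second_stat N w))).
have IE (r : 'S_N) : \int[Pr]_w (\prod_(i < N) xi (paired X Y r i w) *
    cos (th + lform K t u (first_stat N w) (second_stat N w))) = I0.
  by rewrite /I0 !(permutation_moment _ t u th Lxi).2.
rewrite -(permutation_moment 1 t u th Lxi).2 -/I0.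
have Nf : N`!%:R != 0 :> R by rewrite pnatr_eq0 -lt0n fact_gt0.
transitivity (\int[Pr]_w (N`!%:R^-1 * \sum_(r : 'S_N)
  (\prod_(i < N) xi (paired X Y r i w) *
    cos (th + lform K t u (first_stat N w) (second_stat N w))))); last first.
  by apply: eq_Rintegral => w _; rewrite /DN -mulrA mulr_suml.
rewrite RintegralZl//; last by apply: L1_sum => r _; case: (permutation_moment r t u th Lxi).
rewrite Rintegral_sum; last by move=> r _; case: (permutation_moment r t u th Lxi).
under eq_bigr do rewrite IE.
by rewrite sumr_const card_Sn -[I0 *+ _]mulr_natl mulKf.
Qed.

Lemma cvg_unweighted_cos t u th :
  \int[Pr]_w (1 * cos (th + lform K t u (first_stat N w) (second_stat N w)))
    @[N --> \oo] -->
  expR (- ((\sum_(k < K) (s k.+1 != 0)%:R * (t k ^+ 2 + u k ^+ 2)) / 2)) * cos th.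
Proof.
have Sl := sqint_linear_stat ss nu_fst nu_snd t u K.
have L2 : L1 nu (fun z => 1 * lin t u z ^+ 2).
  by under eq_fun do rewrite mul1r; case: Sl.
have m1 (F : T * T -> R) : \int[nu]_z (1 * F z) = \int[nu]_z F z.
  by apply: eq_Rintegral => z _; rewrite mul1r.
have V0 : 0 <= \int[nu]_z (1 * lin t u z ^+ 2).
  by rewrite m1; apply: Rintegral_ge0 => z _; exact: sqr_ge0.
have E3 : \int[nu]_z (1 * lin t u z) = 0.
  by rewrite m1 (mean_linear_stat ss nu_fst nu_snd).
have n1 : \int[nu]_z `|1 : R| = 1 by rewrite normr1 Rintegral_cst1.
have := @cvg_rotate _ _ _ nu (fun=> 1) (lin t u) (L1_cst nu 1) (mlin t u) L2
  (Rintegral_cst1 nu 1) n1 E3 V0 th.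
rewrite m1 (var_linear_stat ss nu_fst nu_snd t u cross_nu).
have vE : \sum_(k < K) ((s k.+1 != 0)%:R * (t k ^+ 2 + u k ^+ 2) + 2 * t k * u k * 0) =
    \sum_(k < K) (s k.+1 != 0)%:R * (t k ^+ 2 + u k ^+ 2).
  by apply: eq_bigr => k _; rewrite mulr0 addr0.
rewrite vE.
move=> H.
suff E N : (rotate th (nseq N (\int[nu]_z (1 * cos (lin t u z * rsqrt N)),
    \int[nu]_z (1 * sin (lin t u z * rsqrt N))))).1 =
    \int[Pr]_w (1 * cos (th + lform K t u (first_stat N w) (second_stat N w))).
  by rewrite -(funext E); exact: H.
rewrite -(permutation_moment 1 t u th (L1_cst nu 1)).2.
by apply: eq_Rintegral => w _; rewrite big1.
Qed.

End sample_limit.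

Section continuous_mapping.
Context {R : realType} {d d' : measure_display} {T : measurableType d}
  {T' : measurableType d'}.
Variables (mu : probability T R) (mu' : probability T' R) (K : nat).
Variables (a b : nat -> T -> nat -> R) (a' b' : T' -> nat -> R).
Hypotheses (ma : forall n k, measurable_fun setT (a n ^~ k))
  (mb : forall n k, measurable_fun setT (b n ^~ k))
  (ma' : forall k, measurable_fun setT (a' ^~ k))
  (mb' : forall k, measurable_fun setT (b' ^~ k)).
Hypothesis cvg_cos : forall th t u,
  \int[mu]_w (1 * cos (th + lform K t u (a n w) (b n w))) @[n --> \oo] -->
  \int[mu']_w cos (th + lform K t u (a' w) (b' w)).
Variables (h : R -> R) (M : R).
Hypotheses (ch : continuous h) (hM : forall x, `|h x| <= M).

Let mh : measurable_fun setT h. Proof. exact: continuous_measurable_fun. Qed.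

Lemma trig_approximation f (e : R) : trig K f -> 0 < e ->
  exists2 p, trig K p & forall a b, `|h (f a b) - p a b| <= e.
Proof.
move=> tf e0; have [B B0 fB] := trig_bounded tf.
(* Affine rescaling of the bounded function [f] into [0, 1], where Bernstein polynomials
   approximate; a polynomial in [phi] is again in [trig]. *)
pose phi a b := (f a b + B) / (2 * B).
have B2 : 0 < 2 * B by rewrite mulr_gt0.
have phi01 x y : 0 <= phi x y <= 1.
  have := fB x y; rewrite ler_norml /phi => /andP[l r].
  by rewrite divr_ge0 ?(ltW B2)//= ?ler_pdivrMr//; lra.
have tphi : trig K phi.
  have := trigZ (2 * B)^-1 (trigD tf (trig_cst K B)); congr trig.
  by apply/funext => x; apply/funext => y; rewrite mulrC.
pose g x := h (2 * B * x - B).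
have gphi x y : g (phi x y) = h (f x y).
  by rewrite /g /phi mulrC divfK ?gt_eqF// addrK.
have cg : continuous g.
  move=> x; apply: (@continuous_comp _ _ _ (fun x => 2 * B * x - B) h); last exact: ch.
  by apply: cvgB; [apply: cvgM; [exact: cvg_cst|exact: cvg_id]|exact: cvg_cst].
have e4 : 0 < e / 4 by rewrite divr_gt0.
(* On [0, 1] the two terms in e / 4 add up to at most e / 2; the other half of [e] is left for C /
   (n + 1). *)
have [C C0 H] := quadratic_modulus cg (fun x => hM _) e4.
pose n := Num.bound (C / (e / 2)).
have nC : C / n.+1%:R <= e / 2.
  rewrite ler_pdivrMr// mulrC -ler_pdivrMr ?divr_gt0//.
  have := @archi_boundP R (C / (e / 2)) (divr_ge0 C0 (ltW (divr_gt0 e0 (ltr0n R 2)))).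
  by rewrite -/n => /ltW/le_trans; apply; rewrite ler_nat.
exists (fun a b => binomial_mean n.+1 (fun k => g (k%:R / n.+1%:R)) (phi a b)).
  exact: trig_binomial_mean.
move=> x y; rewrite -gphi distrC.
apply: le_trans (@binomial_mean_approx R n g (e / 2) C (phi x y) (phi01 x y) C0 _) _.
  move=> z; rewrite distrC; apply: le_trans (H (phi x y) z) _.
  have /andP[p0 p1] := phi01 x y; rewrite -[(z - _) ^+ 2]sqrrN opprB.
  have : phi x y ^+ 2 <= 1 by rewrite expr_le1.
  nra.
by rewrite [leRHS](splitr e) lerD2l.
Qed.

(** The approximation by [p] is uniform over all arguments, so it costs e / 3 under either law,
    whatever the index. *)
Lemma cvg_trig_comp f : trig K f ->
  \int[mu]_w h (f (a n w) (b n w)) @[n --> \oo] --> \int[mu']_w h (f (a' w) (b' w)).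
Proof.
move=> tf; apply/cvgrPdist_le => e e0; have e3 : 0 < e / 3 by rewrite divr_gt0.
have [p tp hp] := trig_approximation tf e3.
have Lh d0 (S : measurableType d0) (m : probability S R) (x y : S -> nat -> R) :
    (forall k, measurable_fun setT (x ^~ k)) -> (forall k, measurable_fun setT (y ^~ k)) ->
    L1 m (fun w => h (f (x w) (y w))) /\ L1 m (fun w => p (x w) (y w)).
  move=> mx my; split.
    apply: (@L1_bounded _ _ _ _ M) => //.
    by apply: (measurableT_comp mh); exact: (measurable_trig mx my tf).
  have [B _ pB] := trig_bounded tp.
  by apply: (@L1_bounded _ _ _ _ B) => //; exact: (measurable_trig mx my tp).
have close d0 (S : measurableType d0) (m : probability S R) (x y : S -> nat -> R) :
    (forall k, measurable_fun setT (x ^~ k)) -> (forall k, measurable_fun setT (y ^~ k)) ->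
    `|\int[m]_w h (f (x w) (y w)) - \int[m]_w p (x w) (y w)| <= e / 3.
  move=> mx my; have [L1h L1p] := Lh _ _ m x y mx my.
  rewrite -RintegralB//; apply: le_trans (le_normr_Rintegral _ _) _ => //.
    exact: L1B.
  rewrite -(Rintegral_cst1 m (e / 3)); apply: le_Rintegral => //.
  - by apply: L1_norm; exact: L1B.
  - exact: L1_cst.
have := @cvg_trig R K _ _ _ _ mu mu' (fun _ _ => 1) a b a' b' (fun _ => L1_cst mu 1)
  ma mb ma' mb' cvg_cos p tp.
move=> /cvgrPdist_le/(_ _ e3); apply: filterS => n hn.
have h1 := close _ _ mu' _ _ ma' mb'.
have h2 := close _ _ mu _ _ (ma n) (mb n).
move: hn; under [X in `|_ - X|]eq_Rintegral do rewrite mul1r.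
move: h1 h2; rewrite !ler_norml => /andP[? ?] /andP[? ?] /andP[? ?].
by apply/andP; split; lra.
Qed.

End continuous_mapping.

(** * Almost sure convergence of the limit variable *)

Section maximal_inequality.
Context {d : measure_display} {Omega : measurableType d} {R : realType}.
Variable Pr : probability Omega R.
Variable Z : nat -> Omega -> R.
Hypothesis mZ : forall i, measurable_fun setT (Z i).
Hypothesis indZ : mutually_independent Pr Z.
Hypothesis LZ2 : forall i, L1 Pr (fun w => Z i w ^+ 2).
Hypothesis EZ : forall i, \int[Pr]_w Z i w = 0.

Definition past k : set (set Omega) := [set A | exists2 B : nat -> set R,
  (forall i, measurable (B i)) & A = \bigcap_(i in `I_k) Z i @^-1` B i].

Let mZi i B : measurable B -> measurable (Z i @^-1` B).
Proof. by move=> mB; rewrite -[X in measurable X]setTI; exact: mZ. Qed.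

Let LZ i : L1 Pr (Z i). Proof. exact: L1_sqr. Qed.

Lemma measurable_past k A : <<s past k >> A -> measurable A.
Proof.
move: A; apply: smallest_sub; first exact: sigma_algebra_measurable.
move=> _ [B mB ->]; apply: bigcap_measurableType => // i _; exact: mZi.
Qed.

(** For a cylinder event the integrand is a product over independent variables, one of which is the
    centered [Z k]. Dynkin's theorem extends this to the generated sigma-algebra. *)
Lemma past_orthogonal k j A : (j < k)%N -> <<s past k >> A ->
  (\int[Pr]_(w in A) (Z j w * Z k w)%:E = 0)%E.
Proof.
move=> jk; have Lr : L1 Pr (fun w => Z j w * Z k w) by exact: L1_mul_sqr.
have IT : (\int[Pr]_w (Z j w * Z k w)%:E = 0)%E.
  rewrite -EFin_Rintegral//; congr (_%:E).
  have u : uniq [:: j; k] by rewrite /= inE ltn_eqF.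
  have := Rintegral_prod_indep mZ indZ u (f := fun _ x => x) (fun _ => @measurable_id _ _ setT) LZ.
  rewrite !big_cons big_nil EZ mul0r => <-.
  by apply: eq_Rintegral => w _; rewrite !big_cons big_nil mulr1.
move: A; apply: (@dynkin_induction _ (g_sigma_algebraType (past k)) (past k)
  (fun A => (\int[Pr]_(w in A) (Z j w * Z k w)%:E = 0)%E)) => //.
- move=> _ _ [B mB ->] [C mC ->]; exists (fun i => B i `&` C i).
    by move=> i; exact: measurableI.
  by rewrite -bigcapI; apply: eq_bigcapr => i _; rewrite preimage_setI.
- move=> _ [B mB ->]; set A := \bigcap_(i in _) _.
  (* Everything that depends on [Z i] is gathered in [f i]. At index [k] the indicator is absent
     since [k] is not in its own past, leaving [Z k] of mean 0. *)
  pose f i (x : R) := (if (i < k)%N then \1_(B i) x else 1) *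
     ((if i == j then x else 1) * (if i == k then x else 1)).
  have mf i : measurable_fun setT (f i).
    apply: measurable_funM; last by apply: measurable_funM; case: (_ == _).
    by case: (i < k)%N => //; exact: measurable_indic.
  have Lf i : L1 Pr (fun w => f i (Z i w)).
    apply: (@L1_le _ _ _ _ _ (fun w => 2 + 2 * Z i w ^+ 2)).
    - exact: measurableT_comp.
    - move=> w; rewrite /f !normrM.
      have n0 := normr_ge0 (Z i w).
      have h c : `|if c then Z i w else 1| <= 1 + `|Z i w|.
        by case: c; rewrite ?normr1 ?lerDl ?lerDr.
      have h1 : `|if (i < k)%N then \1_(B i) (Z i w) else 1| <= 1 :> R.
        by case: ifP => _; rewrite ?normr1// indicE; case: (_ \in _); rewrite ?normr1 ?normr0.
      rewrite -[leRHS]mul1r; apply: ler_pM => //.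
      apply: (@le_trans _ _ ((1 + `|Z i w|) * (1 + `|Z i w|))); first exact: ler_pM.
      rewrite -(real_normK (num_real (Z i w))) -subr_ge0.
      rewrite (_ : _ - _ = (1 - `|Z i w|) ^+ 2); [exact: sqr_ge0|ring].
    - by apply: L1D; [exact: L1_cst|exact: L1Z].
  have [J [u kin jin inJ]] : exists J : seq nat, [/\ uniq J, k \in J, j \in J &
      forall i, (i < k)%N -> i \in J].
    exists (iota 0 k.+1); split; first exact: iota_uniq.
    - by rewrite mem_iota leq0n add0n ltnSn.
    - by rewrite mem_iota leq0n add0n ltnS ltnW.
    - by move=> i ik; rewrite mem_iota leq0n add0n ltnS ltnW.
  have I0 : \int[Pr]_w \prod_(i <- J) f i (Z i w) = 0.
    rewrite (Rintegral_prod_indep mZ indZ u mf Lf) (bigD1_seq k)//=.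
    have -> : \int[Pr]_w f k (Z k w) = 0.
      by rewrite -(EZ k); apply: eq_Rintegral => w _; rewrite /f ltnn eqxx gtn_eqF// !mul1r.
    by rewrite mul0r.
  rewrite integral_mkcond.
  transitivity (\int[Pr]_w (\prod_(i <- J) f i (Z i w))%:E)%E; last first.
    by rewrite -EFin_Rintegral ?I0//; exact: (L1_prod_indep mZ indZ u mf Lf).
  apply: eq_integral => w _; rewrite /patch big_split.
  have one l : l \in J ->
      \prod_(i <- J) (if i == l then Z i w else 1) = Z l w.
    move=> lin; rewrite (bigD1_seq l)//= eqxx big1 ?mulr1// => i.
    by move=> /negbTE ->.
  rewrite big_split /= one// one//.
  case: ifPn => [|]; rewrite ?inE ?notin_setE => wA.
    rewrite big1_seq ?mul1r// => i _; case: ifP => // ik.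
    by rewrite indicE mem_set//; exact: wA.
  have [i [ik nB]] : exists i, (i < k)%N /\ ~ B i (Z i w).
    by apply: contrapT => h; apply: wA => i /= ik; apply: contrapT => nB; apply: h; exists i.
  rewrite (bigD1_seq i) ?inJ//= ik indicE memNset//.
  by rewrite !mul0r.
- move=> S mS IS; have mS' := measurable_past mS.
  have := IT; rewrite -(setUv S) integral_setU//.
  + by rewrite IS add0e.
  + exact: measurableC.
  + by rewrite setUv; exact: (measurable_int Pr Lr).
  + by rewrite disj_set2E setICr.
- move=> F mF tF IF.
  rewrite integral_bigcup//; first by apply: eseries0 => i _ _; exact: IF.
    by move=> i; exact: (measurable_past (mF i)).
  apply: (integrableS measurableT) => //.
  by apply: bigcup_measurable => i _; exact: (measurable_past (mF i)).
Qed.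

Definition partial_sum n w : R := \sum_(k < n) Z k w.

Variable e : R.
Hypothesis e0 : 0 < e.

Definition bounded_until n : set Omega :=
  [set w | forall i, (i <= n)%N -> `|partial_sum i w| < e].

(** The partial sum of index [n] stops at [Z] of index n - 1, so the event is still independent of
    [Z n]. *)
Lemma past_bounded_until n : <<s past n >> (bounded_until n).
Proof.
have mZ' l : (l < n)%N ->
    measurable_fun [set: g_sigma_algebraType (past n)] (Z l : g_sigma_algebraType (past n) -> R).
  move=> ln _ B mB; rewrite setTI; apply: sub_sigma_algebra.
  exists (fun i => if i == l then B else setT); first by move=> i; case: ifP.
  apply/seteqP; split => [w wB i /= il|w]; first by case: eqP => // ->.
  by move=> /(_ l ln); rewrite eqxx.
have mS i : (i <= n)%N -> measurable_fun [set: g_sigma_algebraType (past n)]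
    (partial_sum i : g_sigma_algebraType (past n) -> R).
  move=> le_in; apply: measurable_sum => l; apply: mZ'.
  exact: leq_trans (ltn_ord l) le_in.
have -> : bounded_until n =
    \bigcap_(i in `I_n.+1) [set w | `|partial_sum i w| < e].
  by apply/seteqP; split => w H i /= ile; apply: H.
suff : @measurable _ (g_sigma_algebraType (past n))
  (\bigcap_(i in `I_n.+1) [set w | `|partial_sum i w| < e]) by [].
apply: bigcap_measurableType => // i /= ile.
have := measurableT_comp (@normr_measurable R setT) (mS i ile).
move=> /(_ measurableT `]-oo, e[%classic (measurable_itv _)).
by rewrite setTI; congr measurable; apply/seteqP; split => w /=; rewrite in_itv.
Qed.

Let A := bounded_until.
Let mA n : measurable (A n). Proof. exact: measurable_past (@past_bounded_until n). Qed.
Let AS m n : (m <= n)%N -> A n `<=` A m.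
Proof. by move=> mn w An i im; apply: An; exact: leq_trans mn. Qed.

(* The partial sums stopped when they leave [`]-e, e[`]. *)
Let M n w : R := \sum_(k < n) \1_(A k) w * Z k w.

Let SM k : square_integrable Pr (fun w => \1_(A k) w * Z k w).
Proof.
split; first by apply: measurable_funM => //; exact: measurable_indic.
apply: (L1_le (g := fun w => Z k w ^+ 2)) => //.
  by apply: measurable_funX; apply: measurable_funM => //; exact: measurable_indic.
move=> w; rewrite ger0_norm ?sqr_ge0// exprMn indicE; case: (_ \in _).
  by rewrite expr1n mul1r.
by rewrite expr0n mul0r sqr_ge0.
Qed.

(** The increments are orthogonal: for j < k the event [A k] is contained in [A j] and belongs to
    the past of [k]. *)
Let M_sqr n : \int[Pr]_w (M n w ^+ 2) <= \sum_(k < n) \int[Pr]_w (Z k w ^+ 2).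
Proof.
have orth j k : (j < k)%N ->
    \int[Pr]_w ((\1_(A j) w * Z j w) * (\1_(A k) w * Z k w)) = 0.
  move=> jk; have := past_orthogonal jk (@past_bounded_until k).
  rewrite integral_mkcond /Rintegral => H; rewrite -[RHS]/(fine 0%E) -H.
  congr fine; apply: eq_integral => w _; rewrite /patch !indicE -/A.
  case: ifPn => wA; last by rewrite mul0r mulr0.
  by rewrite mem_set ?mul1r//; move: wA; rewrite inE; apply: AS; exact: ltnW.
rewrite (@Rintegral_sqr_sum _ _ _ Pr (fun k w => \1_(A k) w * Z k w))//.
  apply: ler_sum => k _; apply: le_Rintegral => //; first by case: (SM k).
  move=> w _; rewrite exprMn indicE; case: (_ \in _).
    by rewrite expr1n mul1r.
  by rewrite expr0n mul0r sqr_ge0.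
move=> j k; rewrite neq_ltn => /orP[/orth//|/orth <-].
by apply: eq_Rintegral => w _; rewrite mulrC.
Qed.

Let M_stop n w : (A n w -> M n w = partial_sum n w) /\ (~ A n w -> e <= `|M n w|).
Proof.
elim: n => [|n [IH1 IH2]].
  rewrite /M /partial_sum !big_ord0; split=> //; case.
  by move=> i; rewrite leqn0 => /eqP ->; rewrite /partial_sum big_ord0 normr0.
have MS : M n.+1 w = M n w + \1_(A n) w * Z n w by rewrite /M big_ord_recr.
have SS : partial_sum n.+1 w = partial_sum n w + Z n w by rewrite /partial_sum big_ord_recr.
have [An|nAn] := pselect (A n w); last first.
  rewrite MS indicE memNset// mul0r addr0; split=> [An1|_]; last exact: IH2.
  by exfalso; apply: nAn; exact: AS An1.
have ME : M n.+1 w = partial_sum n.+1 w.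
  by rewrite MS SS IH1// indicE mem_set// mul1r.
split=> // nA; rewrite ME leNgt; apply/negP => lt; apply: nA => i.
by rewrite leq_eqVlt => /orP[/eqP -> //|]; rewrite ltnS => /An.
Qed.

(** Chebyshev's inequality for the stopped sum, which off [A n] is frozen at a value of modulus at
    least [e]. *)
Lemma maximal_inequality n :
  e ^+ 2 * fine (Pr (~` A n)) <= \sum_(k < n) \int[Pr]_w (Z k w ^+ 2).
Proof.
apply: le_trans (M_sqr n).
have mC : measurable (~` A n) by exact: measurableC.
have -> : fine (Pr (~` A n)) = \int[Pr]_w (\1_(~` A n) w).
  by rewrite /Rintegral integral_indic// setIT.
have LC : L1 Pr (\1_(~` A n) : Omega -> R) by exact: L1_indic.
rewrite -RintegralZl//; apply: le_Rintegral => //; first exact: L1Z.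
  by case: (@sqint_sum _ _ _ Pr (fun k w => \1_(A k) w * Z k w) n SM).
move=> w _; rewrite indicE in_setC; case: (boolP (w \in A n)) => /= [_|].
  by rewrite mulr0 sqr_ge0.
rewrite notin_setE mulr1 => nA; rewrite -(real_normK (num_real (M n w))).
by apply: lerXn2r; rewrite ?nnegrE ?(ltW e0)//; exact: (M_stop n w).2.
Qed.

End maximal_inequality.

Section independent_series.
Context {d : measure_display} {Omega : measurableType d} {R : realType}.
Variable Pr : probability Omega R.
Variable Z : nat -> Omega -> R.
Hypothesis mZ : forall i, measurable_fun setT (Z i).
Hypothesis indZ : mutually_independent Pr Z.
Hypothesis LZ2 : forall i, L1 Pr (fun w => Z i w ^+ 2).
Hypothesis EZ : forall i, \int[Pr]_w Z i w = 0.
Variable C : R.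
Hypothesis varZ : forall n, \sum_(k < n) \int[Pr]_w (Z k w ^+ 2) <= C.

Let V n : R := \sum_(k < n) \int[Pr]_w (Z k w ^+ 2).
Let v_ge0 k : 0 <= \int[Pr]_w (Z k w ^+ 2).
Proof. by apply: Rintegral_ge0 => w _; exact: sqr_ge0. Qed.

Let V_cauchy (e : R) : 0 < e -> exists m, forall n,
  \sum_(k < n) \int[Pr]_w (Z (m + k)%N w ^+ 2) <= e.
Proof.
move=> e0; have ndV : nondecreasing_seq V.
  apply/nondecreasing_seqP => n; rewrite /V big_ord_recr /= lerDl//.
have bV : has_ubound (range V) by exists C => _ [n _ <-]; exact: varZ.
have cV := nondecreasing_cvgn ndV bV.
have /cvgrPdist_le/(_ _ e0)[m _ H] := cV.
exists m => n; have := H m (leqnn m).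
have VE : V (m + n)%N = V m + \sum_(k < n) \int[Pr]_w (Z (m + k)%N w ^+ 2).
  by rewrite /V big_split_ord.
have : V (m + n)%N <= sup (range V) by apply: ub_le_sup => //; exists (m + n)%N.
by rewrite VE ler_norml => h1 /andP[_ h2]; lra.
Qed.

Let shift m k := Z (m + k)%N.
Let shift_ind m : mutually_independent Pr (shift m).
Proof. by apply: (mutually_independent_inj _ indZ) => i j /addnI. Qed.

Let unbounded m (e : R) : set Omega := \bigcup_n ~` bounded_until (shift m) e n.

Let munb m (e : R) n : 0 < e -> measurable (~` bounded_until (shift m) e n).
Proof.
move=> e0; apply: measurableC.
have mS i : measurable_fun setT (shift m i) by exact: mZ.
exact: (measurable_past mS (@past_bounded_until _ _ _ (shift m) e n)).
Qed.

Let unbounded_le m (e x : R) : 0 < e ->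
  (forall n, \sum_(k < n) \int[Pr]_w (Z (m + k)%N w ^+ 2) <= x) ->
  measurable (unbounded m e) /\ e ^+ 2 * fine (Pr (unbounded m e)) <= x.
Proof.
move=> e0 Hx; have mB n := munb m n e0.
have mU : measurable (unbounded m e) by exact: bigcupT_measurable.
split=> //.
have ndB : {homo (fun n => ~` bounded_until (shift m) e n) : n p / (n <= p)%N >-> (n <= p)%O}.
  move=> n p np; rewrite subsetEset; apply: subsetC => w H i ile.
  by apply: H; exact: leq_trans np.
have cB := nondecreasing_cvg_mu (mu := Pr) mB mU ndB.
have cF : e ^+ 2 * fine (Pr (~` bounded_until (shift m) e n)) @[n --> \oo] -->
    e ^+ 2 * fine (Pr (unbounded m e)).
  apply: cvgM; first exact: cvg_cst.
  by apply: fine_cvg; rewrite fineK ?fin_num_measure//; exact: cB.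
rewrite -(cvg_lim _ cF)//; apply: limr_le; first by apply/cvg_ex; eexists; exact: cF.
apply: nearW => n; apply: le_trans (Hx n).
exact: (maximal_inequality (fun i => mZ (m + i)) (shift_ind m)
  (fun i => LZ2 (m + i)) (fun i => EZ (m + i)) e0).
Qed.

Lemma ae_cvg_independent_series :
  {ae Pr, forall w, cvgn (fun n => \sum_(k < n) Z k w)}.
Proof.
pose ep (j : nat) : R := j.+1%:R^-1.
have ep0 j : 0 < ep j by rewrite invr_gt0.
(* The paths whose increments after any [m] reach 1 / (j + 1). Each [unbounded m (ep j)] has a
   probability bounded by a tail of the variances, so [N j] is null; off all [N j] the partial sums
   are Cauchy. *)
pose N j := \bigcap_m unbounded m (ep j).
have negN j : Pr.-negligible (N j).
  have mN : measurable (N j).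
    apply: bigcapT_measurable => m.
    by apply: bigcupT_measurable => n; exact: munb.
  exists (N j); split=> //.
  have N0 : fine (Pr (N j)) <= 0.
    apply/ler_addgt0Pr => x x0; rewrite add0r.
    have [m Hm] := V_cauchy (mulr_gt0 (exprn_gt0 2 (ep0 j)) x0).
    have [mU] := unbounded_le (ep0 j) Hm.
    rewrite ler_pM2l ?exprn_gt0//; apply: le_trans.
    apply: fine_le; rewrite ?fin_num_measure//.
    by apply: le_measure; rewrite ?inE//; exact: bigcap_inf.
  apply/eqP; rewrite eq_le measure_ge0 andbT -(fineK (fin_num_measure Pr _ mN)).
  by rewrite lee_fin.
have negU : Pr.-negligible (\bigcup_j N j) by exact: negligible_bigcup.
apply: negligibleS negU => w /= ncvg; apply: contrapT => nN; apply: ncvg.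
apply/cauchy_cvgP/cauchy_exP => x x0.
have [j jx] : exists j, ep j <= x.
  exists (Num.bound x^-1); rewrite /ep invf_ple ?posrE//.
  have /ltW/le_trans := archi_boundP (ltW (etrans (invr_gt0 x) x0)); apply.
  by rewrite ler_nat.
have [m nm] : exists m, ~ unbounded m (ep j) w.
  by apply: contrapT => h; apply: nN; exists j => // m _; apply: contrapT => nm; apply: h; exists m.
exists (\sum_(k < m) Z k w); exists m => // n /= mn.
have -> : \sum_(k < n) Z k w = \sum_(k < m) Z k w + partial_sum (shift m) (n - m) w.
  have E p : \sum_(k < m + p) Z k w =
      \sum_(k < m) Z k w + partial_sum (shift m) p w by rewrite big_split_ord.
  by have := E (n - m)%N; rewrite subnKC.
have bnd : bounded_until (shift m) (ep j) (n - m) w.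
  by apply: contrapT => h; apply: nm; exists (n - m)%N.
rewrite /ball /= opprD addrA subrr sub0r normrN.
exact: lt_le_trans (bnd _ (leqnn _)) jx.
Qed.

End independent_series.

Section measurable_limits.
Context {d : measure_display} {T : measurableType d} {R : realType}.
Variable S : nat -> T -> R.
Hypothesis mS : forall n, measurable_fun setT (S n).

Lemma measurable_cvg_set : measurable [set w | cvgn (S ^~ w)].
Proof.
have -> : [set w | cvgn (S ^~ w)] = \bigcap_j \bigcup_m \bigcap_n
    [set w | `|S m w - S (m + n)%N w| <= j.+1%:R^-1].
  apply/seteqP; split => w /=.
    move=> cv j _; have j0 : 0 < j.+1%:R^-1 / 2 :> R by rewrite divr_gt0.
    have /cvgrPdist_le/(_ _ j0)[m _ H] := cv; exists m => // n _ /=.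
    rewrite (le_trans (ler_distD (limn (S ^~ w)) _ _))//.
    rewrite [leRHS]splitr lerD//; first by rewrite distrC; apply: H => /=.
    by apply: H => /=; exact: leq_addr.
  move=> H; apply/cauchy_cvgP/cauchy_exP => x x0.
  have [j jx] : exists j : nat, j.+1%:R^-1 < x.
    exists (Num.bound x^-1); rewrite invf_plt ?posrE//.
    apply: lt_le_trans (archi_boundP _) _; first by rewrite invr_ge0 ltW.
    by rewrite ler_nat.
  have [m _ Hm] := H j Logic.I; exists (S m w); exists m => // n /= mn.
  by apply: le_lt_trans jx; have := Hm (n - m)%N Logic.I; rewrite /= subnKC.
apply: bigcapT_measurable => j; apply: bigcupT_measurable => m.
apply: bigcapT_measurable => n.
have mB : measurable_fun setT (fun w => `|S m w - S (m + n)%N w|).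
  by apply: measurableT_comp => //; exact: measurable_funB.
have := mB measurableT `]-oo, (j.+1%:R^-1)]%classic (measurable_itv _).
by rewrite setTI; congr measurable; apply/seteqP; split => w /=; rewrite in_itv.
Qed.

Lemma measurable_limn : measurable_fun setT (fun w => limn (S ^~ w)).
Proof.
set C := [set w | cvgn (S ^~ w)].
have mC : measurable C by exact: measurable_cvg_set.
(* [limn] takes the default value [point] where the sequence diverges; replacing the sequence by
   that constant there makes it converge everywhere to [limn]. *)
apply: (@measurable_fun_cvg _ _ _ setT (fun n w => \1_C w * S n w + \1_(~` C) w * (point : R))).
  move=> n; apply: measurable_funD; apply: measurable_funM => //.
  by apply: measurable_indic; exact: measurableC.
move=> w _; have [Cw|nCw] := pselect (C w).
  rewrite !indicE in_setC mem_set//=.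
  have -> : (fun n => 1 * S n w + 0 * (point : R)) = (S ^~ w).
    by apply/funext => n; rewrite mul1r mul0r addr0.
  exact: Cw.
rewrite !indicE in_setC memNset//= (dvgP nCw).
have -> : (fun n => 0 * S n w + 1 * (point : R)) = cst point.
  by apply/funext => n; rewrite mul1r mul0r add0r.
exact: cvg_cst.
Qed.

End measurable_limits.

Section nonnegative_series.
Context {d : measure_display} {T : measurableType d} {R : realType}.
Variables (mu : probability T R) (f : nat -> T -> R) (C : R).
Hypotheses (Lf : forall k, L1 mu (f k)) (f0 : forall k w, 0 <= f k w).
Hypothesis fC : forall n, \sum_(k < n) \int[mu]_w f k w <= C.

Lemma ae_cvg_nonneg_series : {ae mu, forall w, cvgn (fun n => \sum_(k < n) f k w)}.
Proof.
pose F w := \big[+%E/0%E]_(0 <= k <oo) (f k w)%:E.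
have f0' k w : (0 <= (f k w)%:E)%E by rewrite lee_fin.
have mf k : measurable_fun setT (fun w => (f k w)%:E).
  by apply/measurable_EFinP; exact: L1_measurable (Lf k).
have F0 w : (0 <= F w)%E by exact: nneseries_ge0.
have mF : measurable_fun setT F by apply: ge0_emeasurable_sum.
have IF : (\int[mu]_w F w <= C%:E)%E.
  rewrite integral_nneseries//.
  apply: lime_le; first by apply: is_cvg_nneseries => n _ _; exact: integral_ge0.
  apply: nearW => n; rewrite big_mkord.
  under eq_bigr do rewrite -EFin_Rintegral//.
  by rewrite sumEFin lee_fin.
have LF : mu.-integrable setT F.
  apply/integrableP; split=> //.
  under eq_integral do rewrite gee0_abs//.
  exact: le_lt_trans IF (ltry _).
have := integrable_ae measurableT LF; apply: filterS => w /(_ Logic.I) finF.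
apply: nondecreasing_is_cvgn.
  by apply/nondecreasing_seqP => n; rewrite big_ord_recr /= lerDl.
exists (fine (F w)) => _ [n _ <-]; rewrite -lee_fin fineK//.
rewrite -sumEFin -(big_mkord xpredT (fun k => (f k w)%:E)).
by apply: nneseries_lim_ge => // *; rewrite lee_fin.
Qed.

End nonnegative_series.

Section limit_variable.
Context {R : realType} {d : measure_display} {Omega : measurableType d}.
Local Notation gamma := (normal_prob (0 : R) 1).
Variable Pr : probability Omega R.
Variables U V : nat -> Omega -> R.
Hypotheses (mU : forall i, measurable_fun setT (U i))
  (mV : forall i, measurable_fun setT (V i)).
Hypothesis lawU : forall i B, measurable B -> Pr (U i @^-1` B) = gamma B.
Hypothesis lawV : forall i B, measurable B -> Pr (V i @^-1` B) = gamma B.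
Hypothesis indUV : mutually_independent Pr (join_families U V).
Variables (s : nat -> R) (r S : R).
Hypotheses (r_lt1 : r < 1) (s_le : forall k, 0 <= s k.+1 <= r)
  (sum_s : forall n, \sum_(k < n) s k.+1 ^+ 2 <= S).

Let r_ge0 : 0 <= r. Proof. by have /andP[a b] := s_le 0; exact: le_trans b. Qed.
Let s01 k : 0 <= s k.+1 < 1.
Proof. by have /andP[-> b] := s_le k; exact: le_lt_trans r_lt1. Qed.
Let q01 k : 0 <= s k.+1 ^+ 2 < 1.
Proof. by have /andP[a b] := s01 k; rewrite sqr_ge0 expr_lt1. Qed.
Let c : R := (1 - r ^+ 2)^-1.
Let r2 : 0 < 1 - r ^+ 2. Proof. by rewrite subr_gt0 expr_lt1. Qed.
Let c0 : 0 < c. Proof. by rewrite invr_gt0. Qed.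
Let invq_le k : (1 - s k.+1 ^+ 2)^-1 <= c.
Proof.
have /andP[a b] := s_le k; have /andP[_ q1] := q01 k.
rewrite /c lef_pV2 ?posrE ?r2 ?subr_gt0// lerD2l lerN2.
by apply: lerXn2r; rewrite ?nnegrE.
Qed.

(** 1 / (1 - q) = 1 + q / (1 - q) <= exp (c q) for q = s_k^2, with [c] uniform thanks to the
    spectral gap. This bounds the second moments and keeps the infinite product away from 0. *)
Lemma prod_inv_le n : \prod_(k < n) (1 - s k.+1 ^+ 2)^-1 <= expR (c * S).
Proof.
apply: (@le_trans _ _ (\prod_(k < n) expR (c * s k.+1 ^+ 2))).
  apply: ler_prod => k _; have /andP[q0 q1] := q01 k.
  rewrite invr_ge0 subr_ge0 (ltW q1)/=.
  have -> : (1 - s k.+1 ^+ 2)^-1 = 1 + (1 - s k.+1 ^+ 2)^-1 * s k.+1 ^+ 2.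
    by field; rewrite subr_eq0 gt_eqF.
  apply: le_trans (expR_ge1Dx _); rewrite lerD2l; apply: ler_wpM2r => //.
by rewrite -expR_sum ler_expR -mulr_sumr; apply: ler_wpM2l => //; exact: ltW.
Qed.

Let m2 : R := \int[gamma]_x (x ^+ 2).

Let L2gamma : square_integrable gamma (@idfun R).
Proof. by split; [exact: measurable_id|exact: L1_gauss_sqr]. Qed.

(** Read off from [normal_cos]: the integral of sin (x t) is 0, so [t] times the mean is at most 2
    t^2 m2 in absolute value; divide by [t] and let it tend to 0. *)
Lemma mean_normal : \int[gamma]_x x = 0.
Proof.
have L1id : L1 gamma (@idfun R) by exact: sqint_L1.
have m20 : 0 <= m2 by apply: Rintegral_ge0 => x _; exact: sqr_ge0.
have bnd (t : R) : 0 < t -> `|\int[gamma]_x x| <= 2 * t * m2.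
  move=> t0; have sin0 : \int[gamma]_x sin (x * t) = 0.
    transitivity (\int[gamma]_x cos (x * t + - (pi / 2))).
      by apply: eq_Rintegral => x _; rewrite cosBpihalf.
    by rewrite normal_cos cosN cos_pihalf mulr0.
  have msin : measurable_fun setT (fun x : R => sin (x * t)).
    by apply: measurableT_comp; [exact: measurable_sin|exact: measurable_funM].
  have Lsin : L1 gamma (fun x => sin (x * t)).
    by apply: (@L1_bounded _ _ _ _ 1) => // x; exact: sin_max.
  have LB : L1 gamma (fun x => sin (x * t) - t * x) by apply: L1B => //; exact: L1Z.
  have E : \int[gamma]_x (sin (x * t) - t * x) = - (t * \int[gamma]_x x).
    by rewrite RintegralB//; [rewrite sin0 sub0r RintegralZl|exact: L1Z].
  have : `|- (t * \int[gamma]_x x)| <= 2 * t ^+ 2 * m2.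
    rewrite -E; apply: le_trans (le_normr_Rintegral _ LB) _ => //.
    rewrite -RintegralZl//; last exact: L2gamma.2.
    apply: le_Rintegral => //; first exact: L1_norm.
      by apply: L1Z; exact: L2gamma.2.
    move=> x _; rewrite [t * x]mulrC; apply: le_trans (normr_sin_subid_sqr _) _.
    by rewrite exprMn; lra.
  rewrite normrN normrM gtr0_norm// => H.
  by rewrite -(ler_pM2l t0); apply: le_trans H _; lra.
apply/eqP; rewrite -normr_le0; apply/ler_addgt0Pr => e e0; rewrite add0r.
have m21 : 0 < 2 * (m2 + 1) by lra.
have := bnd (e / (2 * (m2 + 1))) (divr_gt0 e0 m21) => /le_trans; apply.
have -> : 2 * (e / (2 * (m2 + 1))) * m2 = e * (m2 / (m2 + 1)).
  by field; rewrite gt_eqF; lra.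
by rewrite ler_piMr ?(ltW e0)// ler_pdivrMr; lra.
Qed.

Let W k w := (U k w, V k w).
Let mW k : measurable_fun setT (W k). Proof. exact: measurable_fun_pair. Qed.
Let mjoin i : measurable_fun setT (join_families U V i).
Proof. by case: i => k; [exact: mU|exact: mV]. Qed.
Let indW : mutually_independent Pr W.
Proof.
have H := @pair_independent _ _ _ Pr _ _ (measurableTypeR R) (join_families U V) gamma gamma mjoin indUV lawU lawV.
move=> J B uJ mB; have := H J B uJ mB.
exact.
Qed.
Let lawW k B : measurable B -> Pr (W k @^-1` B) = (gamma \x gamma)%E B.
Proof.
have H := @pair_law _ _ _ Pr _ _ (measurableTypeR R) (join_families U V) gamma gamma mjoin indUV lawU lawV k B.
exact: H.
Qed.

Let b k : R := 2 * s k.+1 / (1 - s k.+1 ^+ 2).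
(** Cross terms of the exponent. Their coefficients are of the order of s_k, which need only be
    square-summable, so they converge as a series of independent centered variables; the terms
    [X k], of order s_k^2, have summable means. *)
Let Y k w : R := b k * (U k w * V k w).
Let mY k : measurable_fun setT (Y k).
Proof. by apply: measurable_funM => //; exact: measurable_funM. Qed.

Let indY : mutually_independent Pr Y.
Proof.
move=> J B uJ mB; pose f k (z : R * R) := b k * (z.1 * z.2).
have mf k : measurable_fun setT (f k) by do 2 apply: measurable_funM => //.
have mfB k : measurable (f k @^-1` B k).
  by rewrite -[X in measurable X]setTI; exact: mf.
exact: (indW uJ mfB).
Qed.

Let L1xy2 : L1 (gamma \x gamma)%E (fun z : R * R => z.1 ^+ 2 * z.2 ^+ 2).
Proof.
by apply: (@L1_tensor _ _ _ _ _ gamma gamma (fun x => x ^+ 2) (fun y => y ^+ 2));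
  exact: L2gamma.2.
Qed.

Let L1xy : L1 (gamma \x gamma)%E (fun z : R * R => z.1 * z.2).
Proof.
by apply: (@L1_tensor _ _ _ _ _ gamma gamma (fun x => x) (fun y => y));
  exact: sqint_L1 L2gamma.
Qed.

Let LUV2 k : L1 Pr (fun w => U k w ^+ 2 * V k w ^+ 2) /\
  \int[Pr]_w (U k w ^+ 2 * V k w ^+ 2) = m2 ^+ 2.
Proof.
split; first exact: (@L1_law _ _ _ _ _ Pr (gamma \x gamma)%E (W k) (mW k) (@lawW k) _ L1xy2).
rewrite (@Rintegral_law _ _ _ _ _ Pr (gamma \x gamma)%E (W k) (mW k) (@lawW k) _ L1xy2).
by rewrite expr2; apply: Rintegral_tensor; exact: L2gamma.2.
Qed.

Let YE k : (fun w => Y k w ^+ 2) = fun w => b k ^+ 2 * (U k w ^+ 2 * V k w ^+ 2).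
Proof. by apply/funext => w; rewrite /Y !exprMn. Qed.

Let LY2 k : L1 Pr (fun w => Y k w ^+ 2).
Proof. by rewrite YE; apply: L1Z; exact: (LUV2 k).1. Qed.

Let EY k : \int[Pr]_w Y k w = 0.
Proof.
have L : L1 Pr (fun w => U k w * V k w) by exact: (@L1_law _ _ _ _ _ Pr (gamma \x gamma)%E (W k) (mW k) (@lawW k) _ L1xy).
rewrite RintegralZl// (@Rintegral_law _ _ _ _ _ Pr (gamma \x gamma)%E (W k) (mW k) (@lawW k) _ L1xy).
rewrite (Rintegral_tensor (sqint_L1 L2gamma) (sqint_L1 L2gamma)).
by rewrite mean_normal mul0r mulr0.
Qed.

Let varY n : \sum_(k < n) \int[Pr]_w (Y k w ^+ 2) <= 4 * c ^+ 2 * S * m2 ^+ 2.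
Proof.
apply: (@le_trans _ _ (\sum_(k < n) 4 * c ^+ 2 * s k.+1 ^+ 2 * m2 ^+ 2)).
  apply: ler_sum => k _; rewrite YE RintegralZl; [|by []|exact: (LUV2 k).1].
  rewrite (LUV2 k).2; apply: ler_wpM2r; first exact: sqr_ge0.
  rewrite /b !exprMn (_ : 4 * c ^+ 2 * s k.+1 ^+ 2 = 2 ^+ 2 * s k.+1 ^+ 2 * c ^+ 2); last by ring.
  apply: ler_wpM2l; first by rewrite mulr_ge0 ?sqr_ge0.
  have /andP[_ q1] := q01 k.
  apply: lerXn2r; [|by rewrite nnegrE ltW|exact: invq_le].
  by rewrite nnegrE invr_ge0 subr_ge0 ltW.
rewrite -mulr_suml -mulr_sumr; apply: ler_wpM2r; first exact: sqr_ge0.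
by apply: ler_wpM2l => //; rewrite mulr_ge0// sqr_ge0.
Qed.

Let a k : R := s k.+1 ^+ 2 / (1 - s k.+1 ^+ 2).
Let X k w : R := a k * (U k w ^+ 2 + V k w ^+ 2).

Let a_ge0 k : 0 <= a k.
Proof. by have /andP[q0 q1] := q01 k; rewrite divr_ge0// subr_ge0 ltW. Qed.

Let LU2 k : L1 Pr (fun w => U k w ^+ 2) /\ \int[Pr]_w (U k w ^+ 2) = m2.
Proof.
split; first exact: (@L1_law _ _ _ _ _ Pr gamma (U k) (mU k) (@lawU k) _ L2gamma.2).
exact: (@Rintegral_law _ _ _ _ _ Pr gamma (U k) (mU k) (@lawU k) _ L2gamma.2).
Qed.

Let LV2 k : L1 Pr (fun w => V k w ^+ 2) /\ \int[Pr]_w (V k w ^+ 2) = m2.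
Proof.
split; first exact: (@L1_law _ _ _ _ _ Pr gamma (V k) (mV k) (@lawV k) _ L2gamma.2).
exact: (@Rintegral_law _ _ _ _ _ Pr gamma (V k) (mV k) (@lawV k) _ L2gamma.2).
Qed.

Let LX k : L1 Pr (X k).
Proof. by apply: L1Z; apply: L1D; [exact: (LU2 k).1|exact: (LV2 k).1]. Qed.

Let sumX n : \sum_(k < n) \int[Pr]_w X k w <= c * S * (m2 + m2).
Proof.
have m20 : 0 <= m2 by apply: Rintegral_ge0 => x _; exact: sqr_ge0.
apply: (@le_trans _ _ (\sum_(k < n) c * s k.+1 ^+ 2 * (m2 + m2))).
  apply: ler_sum => k _; rewrite /X RintegralZl; [|by []|]; last first.
    by apply: L1D; [exact: (LU2 k).1|exact: (LV2 k).1].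
  rewrite RintegralD; [|by []|exact: (LU2 k).1|exact: (LV2 k).1].
  rewrite (LU2 k).2 (LV2 k).2; apply: ler_wpM2r; first exact: addr_ge0.
  by rewrite /a [leLHS]mulrC; apply: ler_wpM2r; [have /andP[] := q01 k|exact: invq_le].
rewrite -mulr_suml -mulr_sumr; apply: ler_wpM2r; first exact: addr_ge0.
by apply: ler_wpM2l => //; exact: ltW.
Qed.

Let t k w := - (s k.+1 ^+ 2 / (1 - s k.+1 ^+ 2)) * (U k w ^+ 2 + V k w ^+ 2)
  + 2 * s k.+1 / (1 - s k.+1 ^+ 2) * (U k w * V k w).

Let prodq n : R := \prod_(0 <= k < n) (1 - s k.+1 ^+ 2).

Let prodq_ge n : expR (- (c * S)) <= prodq n.
Proof.
have P0 : 0 < prodq n.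
  by apply: prodr_gt0 => k _; have /andP[_ q1] := q01 k; rewrite subr_gt0.
rewrite expRN -[prodq n]invrK lef_pV2 ?posrE ?expR_gt0 ?invr_gt0//.
by rewrite /prodq big_mkord -prodfV; exact: prod_inv_le.
Qed.

Let cvg_prodq : prodq n @[n --> \oo] --> limn prodq.
Proof.
apply: nonincreasing_is_cvgn.
  apply/nonincreasing_seqP => n; rewrite /prodq big_nat_recr//=.
  have P0 : 0 <= prodq n by apply: le_trans (prodq_ge n); exact: expR_ge0.
  have /andP[q0 _] := q01 n.
  by rewrite -[leRHS]mulr1; apply: ler_wpM2l => //; rewrite gerBl.
by exists (expR (- (c * S))) => _ [n _ <-]; exact: prodq_ge.
Qed.

Lemma mehler_prodE K w : mehler_prod U V s K w =
  (Num.sqrt (prodq K))^-1 * expR (2^-1 * \sum_(0 <= k < K) t k w).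
Proof.
rewrite /mehler_prod; elim: K => [|K IH].
  by rewrite /prodq !big_geq// big_ord0 sqrtr1 invr1 mulr0 expR0 mulr1.
rewrite big_ord_recr /= IH /prodq !big_nat_recr//= -/(prodq K).
rewrite sqrtrM; last by apply: le_trans (prodq_ge K); exact: expR_ge0.
by rewrite invfM mulrDr expRD /mehler /t /=; ring.
Qed.

Lemma cvg_mehler_prod :
  {ae Pr, forall w, mehler_prod U V s K w @[K --> \oo] --> Dlim s U V w}.
Proof.
have aeY := ae_cvg_independent_series mY indY LY2 EY varY.
have aeX := ae_cvg_nonneg_series LX (fun k w => mulr_ge0 (a_ge0 k)
  (addr_ge0 (sqr_ge0 (U k w)) (sqr_ge0 (V k w)))) sumX.
apply: filterS2 aeX aeY => w cX cY.
rewrite (funext (fun K => mehler_prodE K w)) /Dlim.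
have ct : \sum_(0 <= k < n) t k w @[n --> \oo] --> limn (fun n => \sum_(0 <= k < n) t k w).
  have E : (fun n => \sum_(0 <= k < n) t k w) =
      fun n => - (\sum_(k < n) X k w) + \sum_(k < n) Y k w.
    apply/funext => n; rewrite big_mkord -sumrN -big_split /=.
    by apply: eq_bigr => k _; rewrite /t /X /Y /a /b mulNr.
  rewrite E; apply/cvg_ex; eexists.
  by apply: cvgD; [apply: cvgN; exact: cX|exact: cY].
apply: cvgM; last first.
  apply: (cvg_comp _ expR); last exact: continuous_expR.
  by apply: cvgM => //; exact: cvg_cst.
apply: cvgV; last first.
  exact: (cvg_comp _ _ cvg_prodq (@sqrt_continuous R _)).
(* The infinite product is at least exp (- c S) > 0, hence the inverse square root is continuous at
   the limit. *)
rewrite gt_eqF// sqrtr_gt0; apply: lt_le_trans (expR_gt0 (- (c * S))) _.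
apply: limr_ge; first exact: cvg_prodq.
exact: nearW.
Qed.

Lemma measurable_Dlim : measurable_fun setT (Dlim s U V).
Proof.
apply: measurable_funM => //; apply: measurableT_comp => //.
apply: measurable_funM => //.
apply: (measurable_limn (S := fun n w => \sum_(0 <= k < n) t k w)) => n.
apply: measurable_sum => k; apply: measurable_funD; apply: measurable_funM => //.
  by apply: measurable_funD; exact: measurable_funX.
exact: measurable_funM.
Qed.

End limit_variable.

(** * The limit theorem *)

Section limit_theorem.
Context {R : realType} {dO : measure_display} {Omega : measurableType dO}.
Variable Pr : probability Omega R.
Context {d : measure_display} {T : measurableType d}.
Variables (P Q : probability T R) (X Y : nat -> Omega -> T).
Hypotheses (mX : forall i, measurable_fun setT (X i))
  (mY : forall i, measurable_fun setT (Y i)).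
Hypothesis lawX : forall i B, measurable B -> Pr (X i @^-1` B) = P B.
Hypothesis lawY : forall i B, measurable B -> Pr (Y i @^-1` B) = Q B.
Hypothesis indXY : mutually_independent Pr (join_families X Y).
Local Notation nu := (product_probability P Q).
Variables (xi : T * T -> R) (s : nat -> R) (alpha beta : nat -> T -> R).
Hypothesis Sxi : square_integrable nu xi.
Hypothesis ss : singular_system P Q xi s alpha beta.
Variable mu : probability (T * T)%type R.
Hypothesis mu_fst : forall A, measurable A -> mu (fst @^-1` A) = P A.
Hypothesis mu_snd : forall A, measurable A -> mu (snd @^-1` A) = Q A.
Hypothesis xi_mu : forall F : T * T -> R, L1 mu F ->
  L1 nu (fun z => xi z * F z) /\ \int[nu]_z (xi z * F z) = \int[mu]_z F z.
Hypothesis norm_xi1 : \int[nu]_z `|xi z| = 1.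
Hypothesis xi_abs : xi = (fun z => `|xi z|) %[ae nu].
Hypothesis gap : (forall k, (1 <= k)%N -> s k <= s 1%N) /\ s 1%N < 1.
Context {d' : measure_display} {Omega' : measurableType d'}.
Variable Pr' : probability Omega' R.
Local Notation gamma := (normal_prob (0 : R) 1).
Variables U V : nat -> Omega' -> R.
Hypotheses (mU : forall i, measurable_fun setT (U i))
  (mV : forall i, measurable_fun setT (V i)).
Hypothesis lawU : forall i B, measurable B -> Pr' (U i @^-1` B) = gamma B.
Hypothesis lawV : forall i B, measurable B -> Pr' (V i @^-1` B) = gamma B.
Hypothesis indUV : mutually_independent Pr' (join_families U V).

Let s_le k : 0 <= s k.+1 <= s 1%N.
Proof. by have /andP[-> _] := ss_bounds ss k.+1; apply: gap.1. Qed.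
Let s01 k : 0 <= s k.+1 < 1.
Proof. by have /andP[-> b] := s_le k; exact: le_lt_trans gap.2. Qed.

Let S : R := \int[nu]_z (xi z ^+ 2).
Let sum_s n : \sum_(k < n) s k.+1 ^+ 2 <= S.
Proof.
have : 0 <= \int[nu]_z ((xi z - kernel_partial s alpha beta n.+1 z) ^+ 2).
  by apply: Rintegral_ge0 => z _; exact: sqr_ge0.
rewrite (sqr_kernel_sub Sxi ss) subr_ge0; apply: le_trans.
by rewrite big_ord_recl lerDr sqr_ge0.
Qed.

Let Pk n : R := \prod_(k < n) (1 - s k.+1 ^+ 2)^-1.
Let L : R := sup (range Pk).

Let ndPk : nondecreasing_seq Pk.
Proof.
apply/nondecreasing_seqP => n; rewrite /Pk big_ord_recr /=.
have /andP[a b] := s01 n.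
have q0 j : 0 <= (1 - s j.+1 ^+ 2)^-1.
  by have /andP[h1 h2] := s01 j; rewrite invr_ge0 subr_ge0 expr_le1// ltW.
rewrite -[leLHS]mulr1; apply: ler_wpM2l; first by apply: prodr_ge0.
have q1 : 0 < 1 - s n.+1 ^+ 2 by rewrite subr_gt0 expr_lt1.
by rewrite -[leRHS]div1r ler_pdivlMr// mul1r gerBl sqr_ge0.
Qed.

Let ubPk : has_ubound (range Pk).
Proof. by eexists => _ [n _ <-]; exact: (prod_inv_le gap.2 s_le sum_s). Qed.

Let Pk_le n : Pk n <= L.
Proof. by apply: ub_le_sup => //; exists n. Qed.

Let cvgPk : Pk n @[n --> \oo] --> L. Proof. exact: nondecreasing_cvgn. Qed.

Variables (h : R -> R) (M : R).
Hypotheses (ch : continuous h) (hM : forall x, `|h x| <= M).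

Let mh : measurable_fun setT h. Proof. exact: continuous_measurable_fun. Qed.

Let Lh d0 (W : measurableType d0) (m : probability W R) (f : W -> R) :
  measurable_fun setT f -> L1 m (fun w => h (f w)).
Proof. by move=> mf; apply: (@L1_bounded _ _ _ _ M) => //; exact: measurableT_comp. Qed.

Let mDlim : measurable_fun setT (Dlim s U V).
Proof. exact: measurable_Dlim. Qed.

Let cvg_h_mehler_prod :
  \int[Pr']_w h (mehler_prod U V s K w) @[K --> \oo] --> \int[Pr']_w h (Dlim s U V w).
Proof.
apply: (@Rintegral_dct _ _ _ Pr' (fun K w => h (mehler_prod U V s K w))
  (fun w => h (Dlim s U V w)) (fun=> M) _ _ _ _ _).2.
- by move=> K; apply: (measurableT_comp mh); exact: measurable_mehler_prod.
- exact: (measurableT_comp mh).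
- have := cvg_mehler_prod mU mV lawU lawV indUV gap.2 s_le sum_s.
  by apply: filterS => w H; apply: (cvg_comp _ h H); exact: ch.
- exact: L1_cst.
- by move=> K w; exact: hM.
Qed.

Section fixed_rank.
Variable K : nat.
Local Notation psi := (mehler_trig s K).
Local Notation a := (first_stat X s alpha).
Local Notation b := (second_stat Y s beta).
Local Notation a' := (normal_first U s).
Local Notation b' := (normal_second V s).
Local Notation c' := (correlated_second U V s).

Let ma N k : measurable_fun setT (a N ^~ k).
Proof. exact: (measurable_first_stat mX ss). Qed.
Let mb N k : measurable_fun setT (b N ^~ k).
Proof. exact: (measurable_second_stat mY ss). Qed.
Let ma' k : measurable_fun setT (a' ^~ k).
Proof. exact: measurable_funM. Qed.
Let mb' k : measurable_fun setT (b' ^~ k).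
Proof. exact: measurable_funM. Qed.
Let mc' k : measurable_fun setT (c' ^~ k).
Proof.
apply: measurable_funM => //; apply: (measurableT_comp measurable_snd).
apply: (measurableT_comp (measurable_correlate _)).
exact: measurable_fun_pair.
Qed.

Let cos1 th t u :
  \int[Pr]_w (1 * cos (th + lform K t u (a N w) (b N w))) @[N --> \oo] -->
  \int[Pr']_w cos (th + lform K t u (a' w) (b' w)).
Proof.
rewrite (cos_normal mU mV lawU lawV indUV).
exact: (cvg_unweighted_cos mX mY lawX lawY indXY ss mu_fst mu_snd).
Qed.

Let cos2 th t u :
  \int[Pr]_w (DN xi X Y N w * cos (th + lform K t u (a N w) (b N w))) @[N --> \oo] -->
  \int[Pr']_w cos (th + lform K t u (a' w) (c' w)).
Proof.
rewrite (cos_correlated mU mV lawU lawV indUV s01).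
exact: (cvg_weighted_cos mX mY lawX lawY indXY Sxi ss mu_fst mu_snd xi_mu norm_xi1).
Qed.

Let SDN N : square_integrable Pr (DN xi X Y N).
Proof.
exact: (sqint_DN mX mY lawX lawY indXY Sxi ss (fun k => proj2 (andP (s01 k)))).
Qed.

Let tpsi n : trig K (psi n). Proof. exact: trig_mehler_trig. Qed.

Let mpsi n N : measurable_fun setT (fun w => psi n (a N w) (b N w)).
Proof. exact: measurable_trig (tpsi n). Qed.

Let Spsi n N : square_integrable Pr (fun w => psi n (a N w) (b N w)).
Proof.
split=> //; have [B _ H] := trig_bounded (trigX 2 (tpsi n)).
by apply: (@L1_bounded _ _ _ _ B) => //; exact: measurable_funX.
Qed.

(** [A n] and [B n] are the limits in [N] of [AN n] and [BN n]; as [n] grows, both tend to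
    [Pk K]. *)
Let A n := \int[Pr']_w psi n (a' w) (c' w).
Let B n := \int[Pr']_w (psi n (a' w) (b' w) ^+ 2).
Let AN n N := \int[Pr]_w (DN xi X Y N w * psi n (a N w) (b N w)).
Let BN n N := \int[Pr]_w (psi n (a N w) (b N w) ^+ 2).

Let cvgAN n : AN n N @[N --> \oo] --> A n.
Proof. exact: (cvg_trig (fun N => sqint_L1 (SDN N)) ma mb ma' mc' cos2 (tpsi n)). Qed.

Let cvgBN n : BN n N @[N --> \oo] --> B n.
Proof.
have H := cvg_trig (fun _ => L1_cst Pr 1) ma mb ma' mb' cos1 (trigX 2 (tpsi n)).
suff E N : \int[Pr]_w (1 * psi n (a N w) (b N w) ^+ 2) = BN n N.
  by rewrite -(funext E); exact: H.
by apply: eq_Rintegral => w _; exact: mul1r.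
Qed.

Let cvg_h_psi : \int[Pr']_w h (psi n (a' w) (b' w)) @[n --> \oo] -->
  \int[Pr']_w h (mehler_prod U V s K w).
Proof.
apply: (@Rintegral_dct _ _ _ Pr' (fun n w => h (psi n (a' w) (b' w)))
  (fun w => h (mehler_prod U V s K w)) (fun=> M) _ _ _ _ _).2.
- by move=> n; apply: (measurableT_comp mh); exact: measurable_trig (tpsi n).
- by apply: (measurableT_comp mh); exact: measurable_mehler_prod.
- apply: aeW => w; have H := @cvg_mehler_trig _ _ _ U V s s01 K w.
  by apply: (cvg_comp _ h H); exact: ch.
- exact: L1_cst.
- by move=> n w; exact: hM.
Qed.

(** The quadratic bound integrated at x = D_N and y = psi. The bound [L] on E D_N^2 enters twice, in
    the expanded square and in the term e x^2. *)
Let hdist n N (e C : R) : 0 <= e -> 0 <= C ->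
  (forall x y, `|h x - h y| <= e + C * (x - y) ^+ 2 + e * x ^+ 2) ->
  `|\int[Pr]_w h (DN xi X Y N w) - \int[Pr]_w h (psi n (a N w) (b N w))| <=
  e + C * (L - 2 * AN n N + BN n N) + e * L.
Proof.
move=> e0 C0 H; have SB := sqintB (SDN N) (Spsi n N).
have mD : measurable_fun setT (DN xi X Y N) by case: (SDN N).
have Lc1 : L1 Pr (fun w => C * (DN xi X Y N w - psi n (a N w) (b N w)) ^+ 2).
  by apply: L1Z; case: SB.
have Lc2 : L1 Pr (fun w => e * DN xi X Y N w ^+ 2) by apply: L1Z; case: (SDN N).
have LB : L1 Pr (fun w => h (DN xi X Y N w) - h (psi n (a N w) (b N w))).
  by apply: L1B; exact: Lh.
rewrite -RintegralB//; [|exact: Lh..].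
apply: le_trans (le_normr_Rintegral _ LB) _ => //.
apply: (@le_trans _ _ (\int[Pr]_w ((e +
   C * (DN xi X Y N w - psi n (a N w) (b N w)) ^+ 2) + e * DN xi X Y N w ^+ 2))).
  apply: le_Rintegral => //; first exact: L1_norm.
  by do 2 apply: L1D => //; exact: L1_cst.
rewrite RintegralD//; last by apply: L1D => //; exact: L1_cst.
rewrite RintegralD//; last exact: L1_cst.
rewrite Rintegral_cst1 !RintegralZl//; [|by case: (SDN N)|by case: SB].
have D2 := second_moment mX mY lawX lawY indXY Sxi ss
  (fun k => proj2 (andP (s01 k))) xi_abs N Pk_le.
rewrite Rintegral_sub_sqr//; apply: lerD; last exact: ler_wpM2l.
rewrite lerD2l; apply: ler_wpM2l => //.
by rewrite -/(AN n N) -/(BN n N) lerD2r lerD2r.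
Qed.

Lemma near_limit (e C dl eps : R) : 0 <= e -> 0 <= C -> 0 < dl -> 0 < eps ->
  (forall x y, `|h x - h y| <= e + C * (x - y) ^+ 2 + e * x ^+ 2) ->
  L - Pk K <= dl ->
  \forall N \near \oo, `|\int[Pr']_w h (mehler_prod U V s K w) -
    \int[Pr]_w h (DN xi X Y N w)| <= e + C * (7 * dl) + e * L + 2 * eps.
Proof.
move=> e0 C0 dl0 eps0 H LK.
have cC := @cvg_mehler_trig_correlated _ _ _ Pr' U V mU mV lawU lawV indUV s s01 K.
have cS := @cvg_sqr_mehler_trig _ _ _ Pr' U V mU mV lawU lawV indUV s s01 K.
move/cvgrPdist_le/(_ _ dl0) : cC => [n1 _ H1].
move/cvgrPdist_le/(_ _ dl0) : cS => [n2 _ H2].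
have /cvgrPdist_le/(_ _ eps0)[n3 _ H3] := cvg_h_psi.
(* The parameter of psi is fixed here, depending on [K] but not on [N]: the limits in [N] hold for
   one function psi at a time. *)
pose n := maxn n1 (maxn n2 n3).
have {}H1 := H1 n (leq_maxl _ _).
have {}H2 := H2 n (leq_trans (leq_maxl _ _) (leq_maxr _ _)).
have {}H3 := H3 n (leq_trans (leq_maxr _ _) (leq_maxr _ _)).
have cA := @cvgAN n; have cB := @cvgBN n.
have cH := cvg_trig_comp ma mb ma' mb' cos1 ch hM (tpsi n).
move/cvgrPdist_le/(_ _ dl0) : cA; move/cvgrPdist_le/(_ _ dl0) : cB.
move/cvgrPdist_le/(_ _ eps0) : cH.
apply: filterS3 => N hH hB hA.
have hD := @hdist n N e C e0 C0 H.
(* L <= Pk K + dl, AN >= Pk K - 2 dl and BN <= Pk K + 2 dl, which adds up to 1 + 4 + 2 = 7 times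
   dl. *)
have P1 : L - 2 * AN n N + BN n N <= 7 * dl.
  move: H1 H2 hA hB; rewrite -/(A n) -/(B n) -/(Pk K) !ler_norml.
  by move=> /andP[? ?] /andP[? ?] /andP[? ?] /andP[? ?]; lra.
have P2 : C * (L - 2 * AN n N + BN n N) <= C * (7 * dl) by exact: ler_wpM2l.
move: H3 hH hD; rewrite !ler_norml.
move=> /andP[? ?] /andP[? ?] /andP[? ?].
by apply/andP; split; lra.
Qed.

End fixed_rank.

Lemma cvg_Rintegral_DN :
  \int[Pr]_w h (DN xi X Y N w) @[N --> \oo] --> \int[Pr']_w h (Dlim s U V w).
Proof.
apply/cvgrPdist_le => eps eps0.
have L0 : 0 <= L by apply: le_trans (Pk_le 0); rewrite /Pk big_ord0.
(* The terms e (1 + L) and 7 C dl are at most eps / 6 each; the other errors are 2 eps / 6 from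
   [near_limit] and eps / 6 from the choice of [K]. *)
pose e := eps / (6 * (1 + L)).
have e0 : 0 < e by rewrite divr_gt0//; lra.
have [C C0 H] := quadratic_modulus ch hM e0.
pose dl := eps / (42 * (C + 1)).
have dl0 : 0 < dl by rewrite divr_gt0//; lra.
have e6 : 0 < eps / 6 by rewrite divr_gt0.
have /cvgrPdist_le/(_ _ e6)[K1 _ H1] := cvg_h_mehler_prod.
have /cvgrPdist_le/(_ _ dl0)[K2 _ H2] := cvgPk.
pose K := maxn K1 K2.
have {}H1 := H1 K (leq_maxl _ _); have {}H2 := H2 K (leq_maxr _ _).
have LK : L - Pk K <= dl by apply: le_trans H2; exact: ler_norm.
have := near_limit (ltW e0) C0 dl0 e6 H LK; apply: filterS => N HN.
have b1 : e + e * L = eps / 6 by rewrite /e; field; rewrite gt_eqF//; lra.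
have b2 : C * (7 * dl) <= eps / 6.
  have -> : C * (7 * dl) = eps / 6 * (C / (C + 1)).
    by rewrite /dl; field; rewrite gt_eqF//; lra.
  by rewrite ler_piMr ?(ltW e6)// ler_pdivrMr; lra.
move: H1 HN; rewrite !ler_norml => /andP[? ?] /andP[? ?].
by apply/andP; split; lra.
Qed.

End limit_theorem.

Local Open Scope charge_scope.

Theorem theorem2 (R : realType) (d : nat)
  (P Q : probability (d.-tuple R) R)
  (mu : probability (d.-tuple R * d.-tuple R)%type R)
  (mu_fst : forall A, measurable A -> pushforward mu fst A = P A)
  (mu_snd : forall B, measurable B -> pushforward mu snd B = Q B)
  (mu_ac : mu `<< (product_probability P Q))
  (xi : d.-tuple R * d.-tuple R -> R)
  (xi_density : EFin \o xi =
    'd (charge_of_finite_measure mu) '/d (product_probability P Q) %[ae (product_probability P Q)])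
  (xi_L2 : xi \in Lfun (product_probability P Q) 2%:E)
  (s : nat -> R) (alpha beta : nat -> d.-tuple R -> R)
  (ss : singular_system P Q xi s alpha beta)
  (gap : (forall k, (1 <= k)%N -> s k <= s 1%N) /\ s 1%N < 1)
  (dO : measure_display) (Omega : measurableType dO) (Pr : probability Omega R)
  (X Y : nat -> {RV Pr >-> d.-tuple R})
  (X_iid : iid X P) (Y_iid : iid Y Q)
  (XY_indep : independent_families Pr X Y)
  (dO' : measure_display) (Omega' : measurableType dO')
  (Pr' : probability Omega' R)
  (U V : nat -> {RV Pr' >-> R})
  (U_normal : forall k A, measurable A ->
    distribution Pr' (U k) A = normal_prob 0 1 A)
  (V_normal : forall k A, measurable A ->
    distribution Pr' (V k) A = normal_prob 0 1 A)
  (UV_indep : mutually_independent Pr' (join_families U V)) :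
  cvg_in_distribution Pr Pr' (DN xi X Y) (Dlim s U V).
Proof.
have Sxi : square_integrable (product_probability P Q) xi by apply/Lfun2P.
have mX i : measurable_fun setT (X i) by exact: measurable_funP.
have mY i : measurable_fun setT (Y i) by exact: measurable_funP.
have mU i : measurable_fun setT (U i) by exact: measurable_funP.
have mV i : measurable_fun setT (V i) by exact: measurable_funP.
have lawX i B : measurable B -> Pr (X i @^-1` B) = P B by exact: X_iid.2.
have lawY i B : measurable B -> Pr (Y i @^-1` B) = Q B by exact: Y_iid.2.
have lawU i B : measurable B -> Pr' (U i @^-1` B) = normal_prob 0 1 B by exact: U_normal.
have lawV i B : measurable B -> Pr' (V i @^-1` B) = normal_prob 0 1 B by exact: V_normal.
have indXY := mutually_independent_join X_iid.1 Y_iid.1 XY_indep.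
have mu1 A : measurable A -> mu (fst @^-1` A) = P A by exact: mu_fst.
have mu2 A : measurable A -> mu (snd @^-1` A) = Q A by exact: mu_snd.
have xi_mu := density_integralE mu_ac xi_density Sxi.1.
have xi_abs := density_abs mu_ac xi_density.
have norm_xi1 : \int[product_probability P Q]_z `|xi z| = 1.
  have [_] := density_integral mu_ac xi_density Sxi.1 (L1_cst mu 1).
  rewrite Rintegral_cst1 => <-.
  by apply: eq_Rintegral => z _; rewrite mulr1.
move=> h ch [M [_ HM]].
(* Boundedness provides a threshold [M] beyond which every number is a bound; M + 1 is one. *)
have hM x : `|h x| <= M + 1 by apply: HM => //; rewrite ltrDl.
have mh : measurable_fun setT h by exact: continuous_measurable_fun.
have Lh d0 (W : measurableType d0) (m : probability W R) (f : W -> R) :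
    measurable_fun setT f -> L1 m (fun w => h (f w)).
  by move=> mf; apply: (@L1_bounded _ _ _ _ (M + 1)) => //; exact: measurableT_comp.
have mDN N : measurable_fun setT (DN xi X Y N) by exact: measurable_DN Sxi.1.
have mDlim : measurable_fun setT (Dlim s U V) by exact: measurable_Dlim.
have H := cvg_Rintegral_DN mX mY lawX lawY indXY Sxi ss mu1 mu2 xi_mu norm_xi1
  xi_abs gap mU mV lawU lawV UV_indep ch hM.
have EN N : 'E_Pr[h \o DN xi X Y N]%E = (\int[Pr]_w h (DN xi X Y N w))%:E.
  by rewrite unlock EFin_Rintegral//; exact: Lh.
have EL : 'E_Pr'[h \o Dlim s U V]%E = (\int[Pr']_w h (Dlim s U V w))%:E.
  by rewrite unlock EFin_Rintegral//; exact: Lh.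
rewrite (funext EN) EL; apply/fine_cvgP; split; first exact: nearW.
exact: H.
Qed.
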